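(* Let $\mathbf{L}=\coprod_{k\geq 1}\mathbf{L}_k$ be an $\mathbb{N}$-graded Lie algebra over a field $\mathbb{F}$ which is generated in degree $1$ and of type FP, and suppose that its entropy satisfies $\mathbf{h}(\mathbf{L})\leq 1$. Then $\mathbf{L}$ is finite-dimensional and nilpotent, i.e., $\mathbf{h}(\mathbf{L})=0$.
   Context: $\mathbb{F}$ is an arbitrary field and $\mathbb{N}=\{1,2,\dots\}$. An $\mathbb{N}$-graded Lie algebra $\mathbf{L}=\coprod_{k\geq1}\mathbf{L}_k$ satisfies $[\mathbf{L}_n,\mathbf{L}_m]\subseteq\mathbf{L}_{n+m}$. It is generated in degree $1$ if $[\mathbf{L},\mathbf{L}]=\coprod_{k\geq2}\mathbf{L}_k$ (equivalently, $\mathbf{L}_1$ generates $\mathbf{L}$ as a Lie algebra). $\mathcal{U}(\mathbf{L})$ denotes the universal enveloping algebra. $\mathbf{L}$ is of type FP$_\infty$ if the trivial left $\mathcal{U}(\mathbf{L})$-module $\mathbb{F}$ has a projective resolution $(P_\bullet,\partial_\bullet,\varepsilon)$ with every $P_k$ a finitely generated projective left $\mathcal{U}(\mathbf{L})$-module. $\mathbf{L}$ has finite cohomological dimension if $\mathbb{F}$ has a projective resolution of finite length (there is $n$ with $P_k=0$ for all $k\geq n$). $\mathbf{L}$ is of type FP if it is of type FP$_\infty$ and of finite cohomological dimension. (Such an $\mathbf{L}$ is finitely generated, hence all $\dim(\mathbf{L}_k)$ are finite.) The entropy is $\mathbf{h}(\mathbf{L})=\limsup_{n\to\infty}\sqrt[n]{\dim(\mathbf{L}_n)}$.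 *)

(* Defs.v *)
From HB Require Import structures.
From mathcomp Require Import all_boot all_order all_algebra.
From mathcomp Require Import finmap.
From mathcomp.multinomials Require Import monalg.
From mathcomp Require Import boolp classical_sets reals constructive_ereal.
From mathcomp Require Import ereal topology sequences exp.

Set Implicit Arguments.
Unset Strict Implicit.
Unset Printing Implicit Defensive.

Import GRing.Theory.
Local Open Scope classical_set_scope.
Local Open Scope ring_scope.

HB.mixin Record Lmodule_isLieAlgebra (F : fieldType) L of GRing.Lmodule F L := {
  lie : L -> L -> L;
  lie_linearl : forall y, linear (lie^~ y);
  lie_linearr : forall x, linear (lie x);
  liexx : forall x, lie x x = 0;
  lie_jacobi : forall x y z,
    lie x (lie y z) + lie y (lie z x) + lie z (lie x y) = 0
}.

#[short(type="lieAlgType")]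
HB.structure Definition LieAlgebra (F : fieldType) :=
  {L of Lmodule_isLieAlgebra F L & GRing.Lmodule F L}.

Section LinearAlgebra.
Variables (F : fieldType) (V : lmodType F).

Definition subspace (A : set V) : Prop :=
  A 0 /\ forall a x y, A x -> A y -> A (a *: x + y).

Definition has_dim (A : set V) (n : nat) : Prop :=
  exists e : 'I_n -> V,
    [/\ forall i, A (e i),
        forall x, A x -> exists c : 'I_n -> F, x = \sum_i c i *: e i
      & forall c : 'I_n -> F, \sum_i c i *: e i = 0 -> forall i, c i = 0].

Definition finite_dim (A : set V) : Prop := exists n, has_dim A n.

(* [has_dim A] holds of at most one number, so the infimum is the dimension
   of A when A is finite-dimensional, and +oo (the infimum of the empty set)
   otherwise. *)
Definition edim (R : realType) (A : set V) : \bar R :=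
  ereal_inf [set n%:R%:E | n in has_dim A].

End LinearAlgebra.

Section LieAlgebraTheory.
Variables (F : fieldType) (L : lieAlgType F).

Definition lie_span (A B : set L) : set L :=
  [set z | exists (n : nat) (c : 'I_n -> F) (x y : 'I_n -> L),
     [/\ forall i, A (x i), forall i, B (y i)
       & z = \sum_i c i *: lie (x i) (y i)]].

Fixpoint lower_central (n : nat) : set L :=
  if n is m.+1 then lie_span setT (lower_central m) else setT.

Definition lie_nilpotent : Prop := exists n, lower_central n = [set 0].

(* Only the values of Lg at positive indices are used. *)
Definition coprod_from (Lg : nat -> set L) (m : nat) : set L :=
  [set x | exists (n : nat) (y : nat -> L),
     (forall k, (m <= k)%N -> Lg k (y k)) /\ x = \sum_(m <= k < n) y k].

Record is_grading (Lg : nat -> set L) : Prop := {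
  grading_subspace : forall k, (0 < k)%N -> subspace (Lg k);
  grading_span : coprod_from Lg 1 = setT;
  grading_direct : forall (n : nat) (y : nat -> L),
    (forall k, (0 < k)%N -> Lg k (y k)) -> \sum_(1 <= k < n) y k = 0 ->
    forall k, (0 < k < n)%N -> y k = 0;
  grading_lie : forall m n x y, (0 < m)%N -> (0 < n)%N ->
    Lg m x -> Lg n y -> Lg (m + n)%N (lie x y)
}.

Definition generated_in_degree1 (Lg : nat -> set L) : Prop :=
  lie_span setT setT = coprod_from Lg 2.

Definition entropy (R : realType) (Lg : nat -> set L) : \bar R :=
  limn_esup (fun n => poweR (edim R (Lg n.+1)) (n.+1%:R^-1)).

End LieAlgebraTheory.

(* The universal enveloping algebra is the free associative algebra on the
   set L modulo the two-sided ideal generated by the relations making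
   L -> U(L) linear and compatible with the brackets. *)
Section EnvelopingIdeal.
Variables (F : fieldType) (L : lieAlgType F).
Local Notation T := {malg F[{fmonom L}]}.

Definition free_gen (x : L) : T := << fmu x >>.

Inductive env_relator : T -> Prop :=
| env_relator_linear a x y :
    env_relator (free_gen (a *: x + y) - (a *: free_gen x + free_gen y))
| env_relator_lie x y :
    env_relator (free_gen (lie x y)
                 - (free_gen x * free_gen y - free_gen y * free_gen x)).

Inductive env_ideal : T -> Prop :=
| env_ideal_relator r : env_relator r -> env_ideal r
| env_ideal0 : env_ideal 0
| env_idealB u v : env_ideal u -> env_ideal v -> env_ideal (u - v)
| env_idealM a u b : env_ideal u -> env_ideal (a * u * b).

Definition env_idealb : pred T := fun u => `[< env_ideal u >].

Fact env_idealb_zmod_closed : zmod_closed env_idealb.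
Proof.
split=> [|u v]; first exact/asboolP/env_ideal0.
by move=> /asboolP Iu /asboolP Iv; apply/asboolP/env_idealB.
Qed.

HB.instance Definition _ :=
  GRing.isZmodClosed.Build T env_idealb env_idealb_zmod_closed.

Definition env_zmod : zmodClosed T := GRing.ZmodClosed.clone T env_idealb _.

Definition envelope : Type := Quotient.quot env_zmod.

HB.instance Definition _ := GRing.Zmodule.on envelope.

Definition env_pi : T -> envelope := \pi_(Quotient.quot env_zmod)%qT.
Definition env_repr (u : envelope) : T := repr (u : Quotient.quot env_zmod).

Lemma env_reprK u : env_pi (env_repr u) = u.
Proof. exact: reprK. Qed.

Lemma env_piP u v : env_pi u = env_pi v <-> env_ideal (u - v).
Proof.
split=> [/eqP|Iuv].
- by rewrite -(Quotient.idealrBE env_zmod) => /asboolP.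
- by apply/eqP; rewrite -(Quotient.idealrBE env_zmod); apply/asboolP.
Qed.

Fact env_pi_is_zmod_morphism : zmod_morphism env_pi.
Proof. by move=> u v; rewrite /env_pi raddfB. Qed.

HB.instance Definition _ :=
  GRing.isZmodMorphism.Build T envelope env_pi env_pi_is_zmod_morphism.

Fact env_idealD u v : env_ideal u -> env_ideal v -> env_ideal (u + v).
Proof.
move=> Iu Iv; rewrite -[v]opprK; apply: env_idealB => //.
by rewrite -sub0r; apply: env_idealB => //; apply: env_ideal0.
Qed.

Fact env_idealMl a u : env_ideal u -> env_ideal (a * u).
Proof. by move=> Iu; rewrite -[_ * _]mulr1; apply: env_idealM. Qed.

Fact env_idealMr a u : env_ideal u -> env_ideal (u * a).
Proof. by move=> Iu; rewrite -[u]mul1r; apply: env_idealM. Qed.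

Fact env_idealZ (a : F) u : env_ideal u -> env_ideal (a *: u).
Proof. by move=> Iu; rewrite -mul_malgC; apply: env_idealMl. Qed.

Definition env_one : envelope := env_pi 1.
Definition env_mul (u v : envelope) : envelope :=
  env_pi (env_repr u * env_repr v).
Definition env_scale (a : F) (u : envelope) : envelope :=
  env_pi (a *: env_repr u).

Fact env_repr_pi u : env_ideal (env_repr (env_pi u) - u).
Proof. by apply/env_piP; rewrite env_reprK. Qed.

Fact env_mulE u v : env_mul (env_pi u) (env_pi v) = env_pi (u * v).
Proof.
apply/env_piP.
set u' := env_repr _; set v' := env_repr _.
have -> : u' * v' - u * v = (u' - u) * v' + u * (v' - v).
  by rewrite mulrBl mulrBr addrA subrK.
by apply: env_idealD; [apply: env_idealMr|apply: env_idealMl];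
  apply: env_repr_pi.
Qed.

Fact env_scaleE a u : env_scale a (env_pi u) = env_pi (a *: u).
Proof.
by apply/env_piP; rewrite -scalerBr; apply/env_idealZ/env_repr_pi.
Qed.

Fact env_ind (P : envelope -> Prop) :
  (forall u, P (env_pi u)) -> forall u, P u.
Proof. by move=> H u; rewrite -[u]env_reprK. Qed.

(* The augmentation sends a noncommutative polynomial to its constant
   coefficient. *)
Definition env_aug (u : envelope) : F := mcoeff mone (env_repr u).

Fact env_ideal_mcoeff1 u : env_ideal u -> mcoeff mone u = 0.
Proof.
have c0 x : mcoeff mone (free_gen x) = 0 :> F.
  by rewrite mcoeffU1 fm1_eq1.
have cM (v w : T) : mcoeff mone (v * w) = mcoeff mone v * mcoeff mone w :> F.
  exact: (rmorphM (mcoeff mone)).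
have cB (v w : T) : mcoeff mone (v - w) = mcoeff mone v - mcoeff mone w :> F.
  exact: mcoeffB.
elim=> {u} [r [a x y|x y]||u v _ cu _ cv|a u b _ cu].
- move: (c0 (a *: x + y)) (c0 x) (c0 y).
  move: (free_gen (a *: x + y)) (free_gen x) (free_gen y) => p q s cp cq cs.
  by rewrite (cB p (a *: q + s)) mcoeffD mcoeffZ cp cq cs mulr0 addr0 subrr.
- move: (c0 (lie x y)) (c0 x) (c0 y).
  move: (free_gen (lie x y)) (free_gen x) (free_gen y) => p q s cp cq cs.
  have cqs := cM q s; have csq := cM s q; rewrite cq cs !mul0r in cqs csq.
  apply: (etrans (cB p (q * s - s * q))); rewrite cp sub0r.
  apply/eqP; rewrite oppr_eq0; apply/eqP; apply: (etrans (cB (q * s) (s * q))).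
  exact: (etrans (congr2 (fun a b => a - b) cqs csq) (subrr 0)).
- exact: mcoeff0.
- by rewrite cB cu cv subrr.
- by rewrite (cM (a * u)) (cM a) cu mulr0 mul0r.
Qed.

Lemma env_augE u : env_aug (env_pi u) = mcoeff mone u.
Proof.
apply/eqP; rewrite -subr_eq0 /env_aug -mcoeffB; apply/eqP.
by apply: env_ideal_mcoeff1; apply: env_repr_pi.
Qed.

Fact env_mulA : associative env_mul.
Proof.
by elim/env_ind=> u; elim/env_ind=> v; elim/env_ind=> w; rewrite !env_mulE mulrA.
Qed.

Fact env_mul1 : left_id env_one env_mul.
Proof. by elim/env_ind=> u; rewrite env_mulE mul1r. Qed.

Fact env_mulr1 : right_id env_one env_mul.
Proof. by elim/env_ind=> u; rewrite env_mulE mulr1. Qed.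

Fact env_mulDl : left_distributive env_mul +%R.
Proof.
elim/env_ind=> u; elim/env_ind=> v; elim/env_ind=> w.
by rewrite -raddfD !env_mulE mulrDl raddfD.
Qed.

Fact env_mulDr : right_distributive env_mul +%R.
Proof.
elim/env_ind=> u; elim/env_ind=> v; elim/env_ind=> w.
by rewrite -raddfD !env_mulE mulrDr raddfD.
Qed.

Fact env_one_neq0 : env_one != 0.
Proof.
apply/eqP; rewrite -(raddf0 env_pi) => /(congr1 env_aug)/eqP.
by rewrite !env_augE mcoeff0 rmorph1 oner_eq0.
Qed.

HB.instance Definition _ := GRing.Zmodule_isNzRing.Build envelope
  env_mulA env_mul1 env_mulr1 env_mulDl env_mulDr env_one_neq0.

Fact env_pi_is_monoid_morphism : monoid_morphism env_pi.
Proof. by split=> [//|u v]; apply/esym/env_mulE. Qed.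

HB.instance Definition _ :=
  GRing.isMonoidMorphism.Build T envelope env_pi env_pi_is_monoid_morphism.

Fact env_scaleA a b u : env_scale a (env_scale b u) = env_scale (a * b) u.
Proof. by elim/env_ind: u => u; rewrite !env_scaleE scalerA. Qed.

Fact env_scale1 : left_id 1 env_scale.
Proof. by elim/env_ind=> u; rewrite env_scaleE scale1r. Qed.

Fact env_scaleDr : right_distributive env_scale +%R.
Proof.
move=> a; elim/env_ind=> u; elim/env_ind=> v.
by rewrite -raddfD !env_scaleE scalerDr raddfD.
Qed.

Fact env_scaleDl u : {morph env_scale^~ u : a b / a + b}.
Proof.
by move=> a b /=; elim/env_ind: u => u; rewrite !env_scaleE scalerDl raddfD.
Qed.

HB.instance Definition _ := GRing.Zmodule_isLmodule.Build F envelope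
  env_scaleA env_scale1 env_scaleDr env_scaleDl.

Fact env_pi_is_scalable : scalable env_pi.
Proof. by move=> a u; rewrite -env_scaleE. Qed.

Lemma env_piM u v : env_pi (u * v) = env_pi u * env_pi v.
Proof. exact: rmorphM. Qed.

Lemma env_piZ a u : env_pi (a *: u) = a *: env_pi u.
Proof. exact: env_pi_is_scalable. Qed.

HB.instance Definition _ :=
  GRing.isScalable.Build F T envelope *:%R env_pi env_pi_is_scalable.

Fact env_scaleAl (a : F) (u v : envelope) : a *: (u * v) = a *: u * v.
Proof.
elim/env_ind: u => u; elim/env_ind: v => v.
by rewrite -env_piM -!env_piZ -env_piM scalerAl.
Qed.

HB.instance Definition _ := GRing.Lmodule_isLalgebra.Build F envelope
  env_scaleAl.

Fact env_scaleAr (a : F) (u v : envelope) : a *: (u * v) = u * (a *: v).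
Proof.
elim/env_ind: u => u; elim/env_ind: v => v.
rewrite -env_piM -!env_piZ -env_piM; congr env_pi.
apply/malgP => k; apply: (etrans (mcoeffZ a (u * v) k)).
apply: (etrans (congr1 ( *%R a) (mcoeffMl u v k))); apply: esym.
have suppZ := msuppZ_le a v.
apply: (etrans (@mcoeffMlw _ _ _ _ u (a *: v) k (fsubset_refl _) suppZ)).
apply: esym; rewrite mulr_sumr; apply: eq_bigr => k1 _.
rewrite mulr_sumr; apply: eq_bigr => k2 _.
by rewrite mcoeffZ mulrnAr mulrCA.
Qed.

HB.instance Definition _ := GRing.Lalgebra_isAlgebra.Build F envelope
  env_scaleAr.

Definition env_iota (x : L) : envelope := env_pi (free_gen x).

Fact env_iota_is_linear : linear env_iota.
Proof.
move=> a x y; rewrite -env_piZ -raddfD; apply/env_piP.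
exact/env_ideal_relator/env_relator_linear.
Qed.

HB.instance Definition _ :=
  GRing.isLinear.Build F L envelope *:%R env_iota env_iota_is_linear.

Lemma env_iota_lie x y :
  env_iota (lie x y) = env_iota x * env_iota y - env_iota y * env_iota x.
Proof.
rewrite -!env_piM -raddfB; apply/env_piP.
exact/env_ideal_relator/env_relator_lie.
Qed.

Fact env_aug_is_zmod_morphism : zmod_morphism env_aug.
Proof.
elim/env_ind=> u; elim/env_ind=> v.
by rewrite -raddfB !env_augE mcoeffB.
Qed.

HB.instance Definition _ := GRing.isZmodMorphism.Build envelope F env_aug
  env_aug_is_zmod_morphism.

Fact env_aug_is_monoid_morphism : monoid_morphism env_aug.
Proof.
split; first by rewrite env_augE rmorph1.
elim/env_ind=> u; elim/env_ind=> v.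
by rewrite -env_piM !env_augE rmorphM.
Qed.

HB.instance Definition _ := GRing.isMonoidMorphism.Build envelope F env_aug
  env_aug_is_monoid_morphism.

Lemma env_aug_iota x : env_aug (env_iota x) = 0.
Proof. by rewrite env_augE mcoeffU1 fm1_eq1. Qed.

Lemma env_augZ (a : F) (u : envelope) : env_aug (a *: u) = a * env_aug u.
Proof. by elim/env_ind: u => u; rewrite -env_piZ !env_augE mcoeffZ. Qed.

Section Universal.
Variables (A : algType F) (f : L -> A).
Hypothesis f_linear : linear f.
Hypothesis f_lie : forall x y, f (lie x y) = f x * f y - f y * f x.

Let h (m : {fmonom L}) : A := \prod_(x <- fmonom_val m) f x.
Let g0 : T -> A := mmap (in_alg A) h.

Let h_mmorphism : mmorphism h.
Proof.
split=> [m1 m2|]; rewrite /h; first by rewrite fmM big_cat.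
by rewrite fm1 big_nil.
Qed.

Let g0_zmod_morphism : zmod_morphism g0.
Proof. exact: mmap_is_additive. Qed.

Let g0_monoid_morphism : monoid_morphism g0.
Proof.
pose h' : {mmorphism {fmonom L} -> A} :=
  HB.pack h (isMultiplicative.Build _ _ h h_mmorphism).
have X (g : T) (m m' : {fmonom L}) : GRing.comm (in_alg A g@_m) (h' m').
  by rewrite /GRing.comm mulr_algl mulr_algr.
by have [] := commr_mmap_is_multiplicative X.
Qed.

Let g0Z a u : g0 (a *: u) = a *: g0 u.
Proof.
pose h' : {mmorphism {fmonom L} -> A} :=
  HB.pack h (isMultiplicative.Build _ _ h h_mmorphism).
by have := @mmapZ _ _ _ (in_alg A) h' a u; rewrite mulr_algl.
Qed.

Let g0_gen x : g0 (free_gen x) = f x.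
Proof.
have g0U := @mmapU _ _ _ (in_alg A) h 1 (fmu x).
have hU : h (fmu x) = f x by rewrite /h fmU big_seq1.
by rewrite /g0 /free_gen; apply: (etrans g0U); rewrite hU mulr_algl scale1r.
Qed.

Let g0_ideal u : env_ideal u -> g0 u = 0.
Proof.
have g0D (v w : T) : g0 (v + w) = g0 v + g0 w by exact: (raddfD (mmap _ _)).
have g0B := g0_zmod_morphism.
have [_ g0M] := g0_monoid_morphism.
elim=> {u} [r [a x y|x y]||u v _ cu _ cv|a u b _ cu].
- move: (g0_gen (a *: x + y)) (g0_gen x) (g0_gen y).
  move: (free_gen (a *: x + y)) (free_gen x) (free_gen y) => p q s gp gq gs.
  rewrite (g0B p (a *: q + s)) (g0D (a *: q) s) (g0Z a q) gp gq gs.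
  by rewrite f_linear subrr.
- move: (g0_gen (lie x y)) (g0_gen x) (g0_gen y).
  move: (free_gen (lie x y)) (free_gen x) (free_gen y) => p q s gp gq gs.
  rewrite (g0B p (q * s - s * q)) gp; apply/eqP; rewrite subr_eq0; apply/eqP.
  apply: esym; apply: (etrans (g0B (q * s) (s * q))); rewrite f_lie -gq -gs.
  by congr (_ - _); [apply: (g0M q s)|apply: (g0M s q)].
- exact: (raddf0 (mmap _ _)).
- by rewrite g0B cu cv subrr.
- by rewrite (g0M (a * u)) (g0M a) cu mulr0 mul0r.
Qed.

Let g (u : envelope) : A := g0 (env_repr u).

Let gE u : g (env_pi u) = g0 u.
Proof.
apply/eqP; rewrite -subr_eq0 /g -g0_zmod_morphism; apply/eqP.
by apply: g0_ideal; apply: env_repr_pi.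
Qed.

Let g_zmod_morphism : zmod_morphism g.
Proof.
elim/env_ind=> u; elim/env_ind=> v.
by rewrite -raddfB !gE g0_zmod_morphism.
Qed.

Let g_monoid_morphism : monoid_morphism g.
Proof.
have [g01 g0M] := g0_monoid_morphism.
split; first by rewrite gE.
by elim/env_ind=> u; elim/env_ind=> v; rewrite -env_piM !gE g0M.
Qed.

Let g_scalable : scalable g.
Proof. by move=> a; elim/env_ind=> u; rewrite -env_piZ !gE g0Z. Qed.

Lemma envelope_universal :
  exists phi : {lrmorphism envelope -> A},
    (forall x, phi (env_iota x) = f x) /\
    forall psi : {lrmorphism envelope -> A},
      (forall x, psi (env_iota x) = f x) -> psi =1 phi.
Proof.
pose phi0 : {lrmorphism envelope -> A} := HB.pack g
  (GRing.isZmodMorphism.Build _ _ g g_zmod_morphism)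
  (GRing.isMonoidMorphism.Build _ _ g g_monoid_morphism)
  (GRing.isScalable.Build _ _ _ _ g g_scalable).
have [phi phi_iota] : exists phi : {lrmorphism envelope -> A},
    forall x, phi (env_iota x) = f x.
  by exists phi0 => x; apply: (etrans (gE _)); apply: g0_gen.
exists phi; split=> // psi psi_iota.
have chiZ (chi : {lrmorphism envelope -> A}) a (w : envelope) :
  chi (a *: w) = a *: chi w by exact: linearZ.
have U_scale a m : mkmalgU m a = a *: mkmalgU m 1 :> T.
  apply/malgP => k; apply: esym; apply: (etrans (mcoeffZ a (mkmalgU m 1) k)).
  apply: (etrans (congr1 ( *%R a) (mcoeffU m 1 k))); rewrite mulrnAr mulr1.
  exact/esym/mcoeffU.
have U_cons x s : mkmalgU (FMonom (x :: s)) 1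
    = free_gen x * mkmalgU (FMonom s) 1 :> T.
  have := @fgmulUU {fmonom L} F 1 1 (fmu x) (FMonom s).
  rewrite mulr1 => /esym E1; rewrite malgM_def; apply: etrans E1.
  by rewrite fmuE; congr mkmalgU; rewrite /mmul /= fmmulE.
have word m : psi (env_pi (mkmalgU m 1)) = phi (env_pi (mkmalgU m 1)).
  case: m; elim=> [|x s IHs].
    have -> : mkmalgU (FMonom [::]) 1 = 1 :> T by rewrite -fmoneE.
    by rewrite (rmorph1 env_pi) !rmorph1.
  rewrite U_cons env_piM (rmorphM psi) (rmorphM phi).
  by congr (_ * _); [apply: etrans (psi_iota x) _; rewrite -phi_iota|].
elim/env_ind=> u; rewrite [u]monalgE !raddf_sum /=; apply: eq_bigr => m _.
by rewrite U_scale env_piZ !chiZ word.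
Qed.

End Universal.

End EnvelopingIdeal.

(* F as a left U(L)-module through the augmentation. *)
Definition trivial_module (F : fieldType) (L : lieAlgType F) : Type := F.

Section TrivialModule.
Variables (F : fieldType) (L : lieAlgType F).

HB.instance Definition _ := GRing.Zmodule.copy (trivial_module L) F.

Definition trivial_scale (u : envelope L) (a : trivial_module L) :
  trivial_module L := env_aug u * (a : F).

Fact trivial_scaleA u v a :
  trivial_scale u (trivial_scale v a) = trivial_scale (u * v) a.
Proof. by rewrite /trivial_scale rmorphM mulrA. Qed.

Fact trivial_scale1 : left_id 1 trivial_scale.
Proof. by move=> a; rewrite /trivial_scale rmorph1 mul1r. Qed.

Fact trivial_scaleDr : right_distributive trivial_scale +%R.
Proof. by move=> u a b; apply: mulrDr. Qed.

Fact trivial_scaleDl a : {morph trivial_scale^~ a : u v / u + v}.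
Proof. by move=> u v; rewrite /trivial_scale raddfD; apply: mulrDl. Qed.

HB.instance Definition _ :=
  GRing.Zmodule_isLmodule.Build (envelope L) (trivial_module L)
    trivial_scaleA trivial_scale1 trivial_scaleDr trivial_scaleDl.

Lemma trivial_moduleE (u : envelope L) (a : trivial_module L) :
  u *: a = env_aug u * (a : F) :> F.
Proof. by []. Qed.

End TrivialModule.

Section Resolutions.
Variable A : nzRingType.

Definition projective_module (P : lmodType A) : Prop :=
  forall (M N : lmodType A) (g : {linear M -> N}) (f : {linear P -> N}),
    (forall y, exists x, g x = y) ->
    exists h : {linear P -> M}, forall p, g (h p) = f p.

Definition finitely_generated (P : lmodType A) : Prop :=
  exists (n : nat) (e : 'I_n -> P),
    forall p, exists c : 'I_n -> A, p = \sum_i c i *: e i.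

(* ... -> P_1 -> P_0 -> M -> 0, with d k : P_(k+1) -> P_k. *)
Record projective_resolution (M : lmodType A) := ProjectiveResolution {
  res_module : nat -> lmodType A;
  res_diff : forall k, {linear res_module k.+1 -> res_module k};
  res_aug : {linear res_module 0%N -> M};
  res_projective : forall k, projective_module (res_module k);
  res_aug_surjective : forall m, exists p, res_aug p = m;
  res_exact0 : forall p, res_aug p = 0 <-> exists q, res_diff 0 q = p;
  res_exact : forall k p,
    res_diff k p = 0 <-> exists q, res_diff k.+1 q = p
}.

End Resolutions.

Section FinitenessConditions.
Variables (F : fieldType) (L : lieAlgType F).

Definition type_FP_infty : Prop :=
  exists P : projective_resolution (trivial_module L),
    forall k, finitely_generated (res_module P k).

Definition finite_cohomological_dim : Prop :=
  exists (P : projective_resolution (trivial_module L)) (n : nat),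
    forall k, (n <= k)%N -> forall p : res_module P k, p = 0.

Definition type_FP : Prop := type_FP_infty /\ finite_cohomological_dim.

End FinitenessConditions.

Arguments lie_nilpotent {F} L.
Arguments type_FP_infty {F} L.
Arguments finite_cohomological_dim {F} L.
Arguments type_FP {F} L.

(* Main.v *)
Require Import Defs.
From HB Require Import structures.
From mathcomp Require Import all_boot all_order all_algebra.
From mathcomp Require Import finmap.
From mathcomp.multinomials Require Import monalg.
From mathcomp Require Import boolp classical_sets functions reals.
From mathcomp Require Import constructive_ereal ereal topology normedtype.
From mathcomp Require Import sequences exp.
From mathcomp Require Import ring.
From mathcomp Require Import algC.

Set Implicit Arguments.
Unset Strict Implicit.
Unset Printing Implicit Defensive.

Import Order.TTheory GRing.Theory Num.Theory.
Local Open Scope classical_set_scope.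
Local Open Scope ring_scope.

(* With l_k := dim L_k and U := U(L), the proof compares two expressions for
   the Hilbert series u(t) of U.
   - By Poincare-Birkhoff-Witt, u(t) * prod_k (1 - t^k)^(l_k) = 1.  Peeling off
     a lowest homogeneous element x, with complementary graded ideal M, the Ore
     extension U(M)[X; ad x] is a U(L)-module showing that U(L) is the direct sum
     of U(M) and U(L) x, whence (1 - t^(deg x)) u_L = u_M.
   - By type FP, comparing a graded free resolution of F with the given
     projective ones shows that its syzygies are finitely generated, and that one
     of them is projective, hence graded free.  So chi(t) u(t) = 1 for some
     integer polynomial chi.
   Therefore chi(t) = prod_k (1 - t^k)^(l_k).  Writing chi = prod_i (1 - a_i t)
   over the algebraic numbers, the logarithmic derivative gives
   sum_i a_i^n = sum_(k | n) k l_k.  Entropy at most 1 makes the right-hand side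
   subexponential, so every |a_i| <= 1 and n l_n <= deg chi: l_n vanishes for
   n > deg chi. *)

(** * The envelope: induction and modules *)

(** The modules of the given resolutions carry no grading, so they have no Hilbert series; only the
    free resolution built alongside them does. It takes finite generation of its syzygies from one
    given resolution and the splitting at the last step from another, because the two halves of type
    FP may be witnessed by different resolutions. Peeling off a lowest element [x] works because a
    coordinate functional in the lowest degree kills all brackets, so its kernel is an ideal. The
    obstacle is then to see that U(M) -> U(L) is injective and that [x] can be cancelled on the
    right; the action on the Ore extension provides both. Since [L] may have infinite dimension, the
    product is truncated at a degree N, so that finitely many peelings suffice; [chi] does not
    depend on N. The entropy lives in a real field and the a_i among the algebraic numbers.
    Inequalities l_n q^n <= (q+1)^n between natural numbers carry the growth bound from one to the
    other. *)

Section Endomorphisms.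
Variables (F : fieldType) (V0 : lmodType F).

(* [algType] excludes the zero ring, hence the factor [F^o]. *)
Local Notation V := (V0 * F^o)%type.

Definition endo_pred : pred (V -> V) := fun f => `[< linear f >].

Fact endo_pred_submod_closed : submod_closed endo_pred.
Proof.
split=> [|a f g /asboolP lf /asboolP lg]; apply/asboolP => b u v.
  by rewrite -[(0 : V -> V) _]/(0 : V) -[(0 : V -> V) u]/(0 : V) -[(0 : V -> V) v]/(0 : V) scaler0 addr0.
have E w : (a *: f + g) w = a *: f w + g w by [].
rewrite !E lf lg !scalerDr !scalerA (mulrC a b) -!addrA.
by congr (_ + _); rewrite addrCA.
Qed.

HB.instance Definition _ :=
  GRing.isSubmodClosed.Build F (V -> V) endo_pred endo_pred_submod_closed.

Record endo := Endo { endo_fun :> V -> V; endo_funP : endo_pred endo_fun }.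

HB.instance Definition _ := [isSub for endo_fun].
HB.instance Definition _ := [Choice of endo by <:].
HB.instance Definition _ := [SubChoice_isSubLmodule of endo by <:].

Lemma endo_linear (f : endo) : linear f.
Proof. exact/asboolP/endo_funP. Qed.

Fact endo_id_subproof : endo_pred idfun.
Proof. exact/asboolP. Qed.

Fact endo_comp_subproof (f g : endo) : endo_pred (f \o g).
Proof. by apply/asboolP => a u v /=; rewrite !endo_linear. Qed.

Definition endo_one : endo := Endo endo_id_subproof.
Definition endo_mul (f g : endo) : endo := Endo (endo_comp_subproof f g).

Fact endo_mulA : associative endo_mul.
Proof. by move=> f g h; apply: val_inj. Qed.

Fact endo_mul1 : left_id endo_one endo_mul.
Proof. by move=> f; apply: val_inj. Qed.

Fact endo_mulr1 : right_id endo_one endo_mul.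
Proof. by move=> f; apply: val_inj. Qed.

Fact endo_mulDl : left_distributive endo_mul +%R.
Proof. by move=> f g h; apply: val_inj. Qed.

Fact endo_mulDr : right_distributive endo_mul +%R.
Proof.
move=> f g h; apply: val_inj; apply/funext => v.
change (f (g v + h v) = f (g v) + f (h v)).
by rewrite -[g v]scale1r endo_linear !scale1r.
Qed.

Fact endo_one_neq0 : endo_one != 0.
Proof.
apply/eqP => /(congr1 (fun f : endo => (f (0, 1)).2)) /eqP.
by rewrite /= oner_eq0.
Qed.

HB.instance Definition _ := GRing.Zmodule_isNzRing.Build endo
  endo_mulA endo_mul1 endo_mulr1 endo_mulDl endo_mulDr endo_one_neq0.

Fact endo_scaleAl (a : F) (f g : endo) : a *: (f * g) = a *: f * g.
Proof. exact: val_inj. Qed.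

HB.instance Definition _ := GRing.Lmodule_isLalgebra.Build F endo endo_scaleAl.

Fact endo_scaleAr (a : F) (f g : endo) : a *: (f * g) = f * (a *: g).
Proof.
apply: val_inj; apply/funext => v.
change (a *: f (g v) = f (a *: g v)).
have f0 : f 0 = 0.
  by have := endo_linear f (-1) 0 0; rewrite scaler0 addr0 scaleN1r addNr.
by have := endo_linear f a (g v) 0; rewrite f0 !addr0.
Qed.

HB.instance Definition _ := GRing.Lalgebra_isAlgebra.Build F endo endo_scaleAr.

End Endomorphisms.

Section EnvelopeInduction.
Variables (F : fieldType) (L : lieAlgType F).
Local Notation U := (envelope L).

(** Words in the elements of [L] span the free algebra, hence their classes span [U], and a word
    grows by one letter on the left. So closure under left multiplication by generators is
    enough. *)
Lemma envelope_ind (P : U -> Prop) :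
  (forall a u v, P u -> P v -> P (a *: u + v)) -> P 1 ->
  (forall x u, P u -> P (env_iota x * u)) -> forall u, P u.
Proof.
move=> PD P1 PM; have P0 : P 0.
  by rewrite -(addNr 1) -scaleN1r; apply: PD.
have U_scale a m : mkmalgU m a = a *: mkmalgU m 1 :> {malg F[{fmonom L}]}.
  apply/malgP => k; apply: esym; apply: (etrans (mcoeffZ a (mkmalgU m 1) k)).
  apply: (etrans (congr1 ( *%R a) (mcoeffU m 1 k))); rewrite mulrnAr mulr1.
  exact/esym/mcoeffU.
have U_cons x s : mkmalgU (FMonom (x :: s)) 1
    = free_gen x * mkmalgU (FMonom s) 1 :> {malg F[{fmonom L}]}.
  have := @fgmulUU {fmonom L} F 1 1 (fmu x) (FMonom s).
  rewrite mulr1 => /esym E1; rewrite malgM_def; apply: etrans E1.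
  by rewrite fmuE; congr mkmalgU; rewrite /mmul /= fmmulE.
have word m : P (env_pi (mkmalgU m 1)).
  case: m; elim=> [|x s IHs].
    have -> : mkmalgU (FMonom [::]) 1 = 1 :> {malg F[{fmonom L}]}.
      by rewrite -fmoneE.
    by rewrite (rmorph1 (@env_pi F L)).
  by rewrite U_cons env_piM; apply: PM.
elim/env_ind=> u; rewrite [u]monalgE raddf_sum /=.
elim/big_ind: _ => [//|v w Pv Pw|m _]; first by rewrite -[v]scale1r; apply: PD.
by rewrite U_scale env_piZ -[_ *: _]addr0; apply: PD.
Qed.

Section Action.
Variables (V : lmodType F) (f : L -> V -> V).
Hypothesis f_linear : forall x, linear (f x).
Hypothesis f_linearl : forall v, linear (f^~ v).
Hypothesis f_lie : forall x y v, f (lie x y) v = f x (f y v) - f y (f x v).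

(** The universal property applied to the endomorphisms of V x F, where [L] acts by 0 on the second
    factor; the action on [V] is the restriction to V x 0. *)
Lemma envelope_action : exists act : U -> V -> V,
  [/\ forall u, linear (act u), forall v, linear (act^~ v),
      forall v, act 1 v = v,
      forall u w v, act (u * w) v = act u (act w v)
    & forall x v, act (env_iota x) v = f x v].
Proof.
pose h x (v : V * F^o) : V * F^o := (f x v.1, 0).
have hP x : endo_pred (h x).
  apply/asboolP => a u v; congr (_, _); first exact: f_linear.
  by change (0 = a *: (0 : F^o) + 0); rewrite scaler0 addr0.
have h_lin : linear (fun x => Endo (hP x)).
  move=> a x y; apply: val_inj; apply/funext => v.
  congr (_, _); first exact: f_linearl.
  by change (0 = a *: (0 : F^o) + 0); rewrite scaler0 addr0.
have h_lie x y : Endo (hP (lie x y))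
    = Endo (hP x) * Endo (hP y) - Endo (hP y) * Endo (hP x).
  apply: val_inj; apply/funext => v.
  by congr (_, _); [exact: f_lie | rewrite subrr].
have [phi [phiE _]] := envelope_universal h_lin h_lie.
exists (fun u v => (phi u (v, 0)).1); split.
- move=> u a v w /=.
  have /(congr1 fst) := endo_linear (phi u) a (v, 0) (w, 0).
  have -> : (a *: v + w, 0 : F^o) = a *: (v, 0 : F^o) + (w, 0).
    by congr (_, _); change (0 = a *: (0 : F^o) + 0); rewrite scaler0 addr0.
  exact.
- by move=> v a u w; rewrite linearP.
- by move=> v; rewrite rmorph1.
- move=> u w v; rewrite rmorphM.
  (* Discarding the second component is compatible with products only because V x 0 is stable. *)
  suff : (phi w (v, 0)).2 = 0.
    by change ((phi w (v, 0)).2 = 0 -> (phi u (phi w (v, 0))).1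
      = (phi u ((phi w (v, 0)).1, 0)).1); case: (phi w _) => p1 p2 /= ->.
  elim/envelope_ind: w => [a w w' E E'||x w _].
  + by rewrite linearP [LHS]/= E E' scaler0 addr0.
  + by rewrite rmorph1.
  + by rewrite rmorphM /= phiE.
- by move=> x v; rewrite phiE.
Qed.

End Action.
End EnvelopeInduction.

(** * Graded Lie algebras *)

Section PolynomialAlgebra.
Variables (F : fieldType) (A : algType F).

(* [{poly A}] is only a module over [A]; here the scalars are those of [F]. *)
Definition polyalg : Type := {poly A}.

HB.instance Definition _ := GRing.NzRing.copy polyalg {poly A}.

Definition polyalg_scale (a : F) (p : polyalg) : polyalg :=
  (a%:A *: (p : {poly A}))%R.

Fact polyalg_scaleA a b p :
  polyalg_scale a (polyalg_scale b p) = polyalg_scale (a * b) p.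
Proof. by rewrite /polyalg_scale scalerA mulr_algl scalerA. Qed.

Fact polyalg_scale1 : left_id 1 polyalg_scale.
Proof. by move=> p; rewrite /polyalg_scale scale1r scale1r. Qed.

Fact polyalg_scaleDr : right_distributive polyalg_scale +%R.
Proof. by move=> a p q; apply: (@scalerDr _ {poly A}). Qed.

Fact polyalg_scaleDl p : {morph polyalg_scale^~ p : a b / a + b}.
Proof. by move=> a b; rewrite /polyalg_scale scalerDl; apply: (@scalerDl _ {poly A}). Qed.

HB.instance Definition _ := GRing.Zmodule_isLmodule.Build F polyalg
  polyalg_scaleA polyalg_scale1 polyalg_scaleDr polyalg_scaleDl.

Lemma coef_polyalgZ (a : F) (p : polyalg) n :
  (a *: p : {poly A})`_n = a *: (p : {poly A})`_n.
Proof.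
by change (((a%:A *: (p : {poly A}))%R : {poly A})`_n = a *: (p : {poly A})`_n);
  rewrite coefZ mulr_algl.
Qed.

Fact polyalg_scaleAl (a : F) (p q : polyalg) : a *: (p * q) = a *: p * q.
Proof. by apply: (@scalerAl A {poly A}). Qed.

HB.instance Definition _ :=
  GRing.Lmodule_isLalgebra.Build F polyalg polyalg_scaleAl.

Fact polyalg_scaleAr (a : F) (p q : polyalg) : a *: (p * q) = p * (a *: q).
Proof.
apply/polyP => n; rewrite coef_polyalgZ.
transitivity (a *: \sum_(j < n.+1) (p : {poly A})`_j * (q : {poly A})`_(n - j)).
  by congr (_ *: _); apply: coefM.
apply/esym; transitivity (\sum_(j < n.+1) (p : {poly A})`_j
    * (a *: q : {poly A})`_(n - j)); first exact: coefM.
by rewrite scaler_sumr; apply: eq_bigr => j _; rewrite coef_polyalgZ scalerAr.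
Qed.

HB.instance Definition _ :=
  GRing.Lalgebra_isAlgebra.Build F polyalg polyalg_scaleAr.

Lemma polyalg_bracketE (p q : polyalg) :
  p * q - q * p = (p : {poly A}) * (q : {poly A}) - (q : {poly A}) * (p : {poly A}).
Proof. by []. Qed.

Lemma coef_polyalgD (p q : polyalg) n :
  (p + q : {poly A})`_n = (p : {poly A})`_n + (q : {poly A})`_n.
Proof. exact: coefD. Qed.

Lemma coef_polyalgM (p q : polyalg) n :
  (p * q : {poly A})`_n
    = \sum_(i < n.+1) (p : {poly A})`_i * (q : {poly A})`_(n - i).
Proof. exact: coefM. Qed.

Lemma horner1_polyalgZD (a : F) (p q : polyalg) :
  (a *: p + q : {poly A}).[1] = a *: (p : {poly A}).[1] + (q : {poly A}).[1].
Proof.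
by apply: etrans (hornerD _ _ _) _; congr (_ + _);
  apply: etrans (hornerZ _ _ _) _; rewrite mulr_algl.
Qed.

Lemma horner1_polyalgM (p q : polyalg) :
  (p * q : {poly A}).[1] = (p : {poly A}).[1] * (q : {poly A}).[1].
Proof. by apply: hornerM_comm; rewrite /comm_poly mul1r mulr1. Qed.

Lemma mulCX_comm (u v : A) i j :
  (u%:P * 'X^i) * (v%:P * 'X^j) = (u * v)%:P * 'X^(i + j) :> {poly A}.
Proof. by rewrite mulrA -(mulrA u%:P) -commr_polyXn mulrA -mulrA -exprD -polyCM. Qed.

End PolynomialAlgebra.

Section GradedLie.
Variables (F : fieldType) (L : lieAlgType F) (Lg : nat -> set L).
Hypothesis gr : is_grading Lg.

Lemma lie0l x : lie (0 : L) x = 0.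
Proof. by have := lie_linearl x (-1) 0 0; rewrite scaler0 addr0 scaleN1r addNr. Qed.

Lemma lie0r x : lie x (0 : L) = 0.
Proof. by have := lie_linearr x (-1) 0 0; rewrite scaler0 addr0 scaleN1r addNr. Qed.

Lemma lieDl (x y z : L) : lie (x + y) z = lie x z + lie y z.
Proof. by have := lie_linearl z 1 x y; rewrite !scale1r. Qed.

Lemma lieDr (x y z : L) : lie z (x + y) = lie z x + lie z y.
Proof. by have := lie_linearr z 1 x y; rewrite !scale1r. Qed.

Lemma lieZl a (x z : L) : lie (a *: x) z = a *: lie x z.
Proof. by have := lie_linearl z a x 0; rewrite lie0l !addr0. Qed.

Lemma lieZr a (x z : L) : lie z (a *: x) = a *: lie z x.
Proof. by have := lie_linearr z a x 0; rewrite lie0r !addr0. Qed.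

Lemma lieC (x y : L) : lie x y = - lie y x.
Proof.
apply/eqP; rewrite -addr_eq0; apply/eqP.
by have := liexx (x + y); rewrite lieDl !lieDr !liexx add0r addr0.
Qed.

Lemma grading0 k : (0 < k)%N -> Lg k 0.
Proof. by case/(grading_subspace gr). Qed.

Lemma gradingZD k a x y : (0 < k)%N -> Lg k x -> Lg k y -> Lg k (a *: x + y).
Proof. by move=> k0; have [_] := grading_subspace gr k0; apply. Qed.

(** Unlike in [coprod_from], the family is normalised to 0 at index 0 and beyond some bound. This
    makes it unique, so that components are functions of [x]. *)
Definition is_decomp (x : L) (y : nat -> L) : Prop :=
  [/\ forall k, (0 < k)%N -> Lg k (y k), y 0%N = 0
    & exists N, (forall k, (N <= k)%N -> y k = 0) /\ x = \sum_(k < N) y k].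

Lemma sum_from1 (V : nmodType) (t : nat -> V) n :
  t 0%N = 0 -> \sum_(1 <= j < n) t j = \sum_(j < n) t j.
Proof.
move=> t0; case: n => [|n]; first by rewrite big_geq ?big_ord0.
by rewrite -(big_mkord xpredT t) [RHS]big_nat_recl // t0 add0r big_add1.
Qed.

Lemma decomp_exists x : exists y, is_decomp x y.
Proof.
have : coprod_from Lg 1 x by rewrite (grading_span gr).
case=> N [y [yL ->]].
pose t k := if (0 < k < N)%N then y k else 0.
exists t; split=> [k k0||].
- by rewrite /t; case: ifP => _; [apply: yL | apply: grading0].
- by [].
exists N; split=> [k Nk|]; first by rewrite /t [(k < N)%N]ltnNge Nk andbF.
by rewrite -(@sum_from1 _ t) //; apply: eq_big_nat => k kN; rewrite /t kN.
Qed.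

Lemma decomp_sum x y N : (forall k, (N <= k)%N -> y k = 0) ->
  x = \sum_(k < N) y k :> L -> forall M, (N <= M)%N -> x = \sum_(k < M) y k.
Proof.
move=> yN -> M NM; rewrite -!(big_mkord xpredT y) [RHS](@big_cat_nat _ _ _ N) //=.
by rewrite [X in _ = _ + X]big_nat_cond [X in _ = _ + X]big1 ?addr0 // => k /andP[/andP[/yN]].
Qed.

Lemma decomp_uniq x y z : is_decomp x y -> is_decomp x z -> y =1 z.
Proof.
case=> yL y0 [N [yN xN]] [zL z0 [M [zM xM]]] [|k]; first by rewrite y0 z0.
(* This exceeds both bounds, so both sums extend to [K], and also k + 1, so directness reaches that
   index. *)
pose K := (maxn N M + k).+2.
have eK : \sum_(1 <= j < K) (-1 *: z j + y j) = 0.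
  have e1 := decomp_sum yN xN (M := K).
  have e2 := decomp_sum zM xM (M := K).
  rewrite big_split /= -scaler_sumr scaleN1r addrC.
  have NK : (N <= K)%N by rewrite /K -2![_.+1]addn1 -!addnA (leq_trans (leq_maxl N M)) ?leq_addr.
  have MK : (M <= K)%N by rewrite /K -2![_.+1]addn1 -!addnA (leq_trans (leq_maxr N M)) ?leq_addr.
  by rewrite !sum_from1 // -e1 // -e2 // subrr.
have := grading_direct gr (n := K) (y := fun j => -1 *: z j + y j) _ eK.
move=> /(_ _ k.+1); rewrite scaleN1r addrC => E; apply/eqP; rewrite -subr_eq0.
apply/eqP/E => [j j0|]; last by rewrite /K !ltnS leq_addl.
by apply: gradingZD => //; [apply: zL | apply: yL].
Qed.

Definition lcomp (x : L) : nat -> L := projT1 (cid (decomp_exists x)).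

Lemma lcompP x : is_decomp x (lcomp x).
Proof. exact: projT2 (cid (decomp_exists x)). Qed.

Lemma lcomp_eq x y : is_decomp x y -> lcomp x =1 y.
Proof. exact/decomp_uniq/lcompP. Qed.

Lemma lcomp_mem x k : (0 < k)%N -> Lg k (lcomp x k).
Proof. by have [H _ _] := lcompP x; apply: H. Qed.

Lemma lcomp0 x : lcomp x 0 = 0.
Proof. by have [_ H _] := lcompP x. Qed.

Lemma lcomp_fin x : exists N, forall M, (N <= M)%N ->
  lcomp x M = 0 /\ x = \sum_(k < M) lcomp x k.
Proof.
have [_ _ [N [H E]]] := lcompP x; exists N => M NM; split; first exact: H.
exact: decomp_sum H E _ NM.
Qed.

Lemma lcomp_linear k : linear (lcomp^~ k).
Proof.
move=> a x y; have [N HN] := lcomp_fin x; have [M HM] := lcomp_fin y.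
apply: (@lcomp_eq _ (fun k => a *: lcomp x k + lcomp y k)); split.
- by move=> j j0; apply: gradingZD => //; apply: lcomp_mem.
- by rewrite !lcomp0 scaler0 addr0.
exists (maxn N M); have [HN' HM'] := (leq_maxl N M, leq_maxr N M); split.
  move=> j Hj; have [-> _] := HN _ (leq_trans HN' Hj).
  by have [-> _] := HM _ (leq_trans HM' Hj); rewrite scaler0 addr0.
have [_ {1}->] := HN _ HN'; have [_ {1}->] := HM _ HM'.
by rewrite scaler_sumr -big_split.
Qed.

Lemma lcomp_homog k x j : (0 < k)%N -> Lg k x ->
  lcomp x j = if j == k then x else 0.
Proof.
move=> k0 xk; apply: (@lcomp_eq _ (fun j => if j == k then x else 0)); split.
- by move=> i i0; case: eqP => [->//|_]; apply: grading0.
- by case: k k0 {xk}.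
exists k.+1; split=> [i ki|]; first by rewrite gtn_eqF.
by rewrite big_ord_recr /= eqxx big1 ?add0r // => i _; rewrite ltn_eqF.
Qed.

Lemma grading_ind (P : L -> Prop) :
  (forall a x y, P x -> P y -> P (a *: x + y)) ->
  (forall k x, (0 < k)%N -> Lg k x -> P x) -> forall x, P x.
Proof.
move=> PD Ph x; have [N /(_ _ (leqnn _)) [_ ->]] := lcomp_fin x.
have P0 : P 0 by apply: (Ph 1%N) => //; apply: grading0.
elim/big_ind: _ => [//|y z Py Pz|[[|k] ? _]].
- by rewrite -[y]scale1r; apply: PD.
- by rewrite lcomp0.
- by apply: (Ph k.+1) => //; apply: lcomp_mem.
Qed.

(** Both sides are bilinear and homogeneous elements span, so the identity need only be checked on
    them. *)
Lemma lie_morph_graded (A : algType F) (f : L -> A) : linear f ->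
  (forall k l x y, (0 < k)%N -> (0 < l)%N -> Lg k x -> Lg l y ->
     f (lie x y) = f x * f y - f y * f x) ->
  forall x y, f (lie x y) = f x * f y - f y * f x.
Proof.
move=> f_lin fh x y.
have fZD a u v : f (a *: u + v) = a *: f u + f v by apply: f_lin.
elim/grading_ind: x => [a x x' E E'|k x k0 xk].
  rewrite lieDl lieZl !fZD E E' mulrDl mulrDr -scalerAl -scalerAr.
  by rewrite scalerBr opprD addrACA.
elim/grading_ind: y => [a y y' E E'|l y l0 yl].
  rewrite lieDr lieZr !fZD E E' mulrDl mulrDr -scalerAl -scalerAr.
  by rewrite scalerBr opprD addrACA.
exact: (fh k l).
Qed.

Lemma lcomp_linear0 k : lcomp 0 k = 0.
Proof. by have := lcomp_linear k (-1) 0 0; rewrite scaler0 addr0 scaleN1r addNr. Qed.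

End GradedLie.

(** * The grading of the envelope *)

Section GradedEnvelope.
Variables (F : fieldType) (L : lieAlgType F) (Lg : nat -> set L).
Hypothesis gr : is_grading Lg.
Local Notation U := (envelope L).

(** A grading of [U] amounts to a morphism U -> U[X] sending [x] of degree k to x X^k. The universal
    property gives it, brackets being respected because X is central. *)
Lemma delta_exists : exists phi : {lrmorphism U -> polyalg U},
  forall x n, (phi (env_iota x) : {poly U})`_n = env_iota (lcomp gr x n).
Proof.
have fE x : exists p : polyalg U,
    forall n, (p : {poly U})`_n = env_iota (lcomp gr x n).
  have [N HN] := lcomp_fin gr x; exists (\poly_(k < N) env_iota (lcomp gr x k)).
  move=> n; rewrite coef_poly; case: ltnP => // Nn.
  by have [-> _] := HN n Nn; rewrite linear0.
pose f x := projT1 (cid (fE x)).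
have fP x n : (f x : {poly U})`_n = env_iota (lcomp gr x n).
  exact: (projT2 (cid (fE x))).
have f_lin : linear f.
  move=> a x y; apply/polyP => n.
  by rewrite coef_polyalgD coef_polyalgZ !fP lcomp_linear linearP.
have fh k x : (0 < k)%N -> Lg k x -> f x = (env_iota x)%:P * 'X^k :> {poly U}.
  move=> k0 xk; apply/polyP => n; rewrite fP (lcomp_homog gr _ k0 xk) coefCM coefXn.
  by case: eqP => _; rewrite ?mulr1 ?mulr0 ?linear0.
have f_lie x y : f (lie x y) = f x * f y - f y * f x.
  apply: (lie_morph_graded gr) => // {x y} k l x y k0 l0 xk yl.
  rewrite polyalg_bracketE (fh _ _ k0 xk) (fh _ _ l0 yl) !mulCX_comm addnC.
  rewrite -mulrBl -polyCB -env_iota_lie addnC; apply: fh => //.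
    by rewrite addn_gt0 k0.
  exact: (grading_lie gr).
have [phi [phiE _]] := envelope_universal f_lin f_lie.
by exists phi => x n; rewrite phiE fP.
Qed.

Definition env_delta : {lrmorphism U -> polyalg U} := projT1 (cid delta_exists).

Definition ecomp (n : nat) (u : U) : U := (env_delta u : {poly U})`_n.

Lemma ecomp_iota n x : ecomp n (env_iota x) = env_iota (lcomp gr x n).
Proof. exact: (projT2 (cid delta_exists)). Qed.

Fact ecomp_is_linear n : linear (ecomp n).
Proof.
move=> a u v; rewrite /ecomp linearP; by rewrite coef_polyalgD coef_polyalgZ.
Qed.

HB.instance Definition _ n :=
  GRing.isLinear.Build F U U *:%R (ecomp n) (ecomp_is_linear n).

Lemma ecompZD n a u v : ecomp n (a *: u + v) = a *: ecomp n u + ecomp n v.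
Proof. exact: ecomp_is_linear. Qed.

Lemma ecompM n u v :
  ecomp n (u * v) = \sum_(i < n.+1) ecomp i u * ecomp (n - i) v.
Proof. by rewrite /ecomp rmorphM coef_polyalgM. Qed.

Lemma ecomp1 n : ecomp n 1 = (n == 0%N)%:R.
Proof. by rewrite /ecomp rmorph1; apply: coef1. Qed.

Lemma env_augM (u v : U) : env_aug (u * v) = env_aug u * env_aug v.
Proof. exact: (rmorphM (@env_aug F L)). Qed.

Lemma ecomp0 u : ecomp 0 u = (env_aug u)%:A.
Proof.
elim/envelope_ind: u => [a u v IHu IHv||x u _].
- by rewrite ecompZD IHu IHv raddfD /= env_augZ scalerDl scalerA.
- by rewrite ecomp1 (rmorph1 (@env_aug F L)) scale1r.
- rewrite ecompM big_ord1 ecomp_iota lcomp0 linear0 mul0r.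
  by rewrite env_augM env_aug_iota mul0r scale0r.
Qed.

Lemma ecomp_sum u : exists N, forall M, (N <= M)%N ->
  ecomp M u = 0 /\ u = \sum_(i < M) ecomp i u.
Proof.
(* Setting X = 1 undoes [env_delta], so [u] is the sum of the coefficients of its image. *)
have E : (env_delta u : {poly U}).[1] = u.
  elim/envelope_ind: u => [a u v IHu IHv||x u IHu].
  - have -> : env_delta (a *: u + v) = a *: env_delta u + env_delta v by apply: linearP.
    by rewrite horner1_polyalgZD IHu IHv.
  - by rewrite rmorph1; apply: hornerC.
  - rewrite rmorphM horner1_polyalgM IHu; congr (_ * _).
    pose p : {poly U} := env_delta (env_iota x).
    have [N /(_ (maxn N (size p)) (leq_maxl _ _)) [_ {2}->]] := lcomp_fin gr x.
    rewrite raddf_sum /= -[LHS]/(p.[1]) (horner_coef_wide _ (leq_maxr N _)).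
    by apply: eq_bigr => i _; rewrite expr1n mulr1; apply: ecomp_iota.
exists (size (env_delta u : {poly U})) => M NM; split; first exact: nth_default.
rewrite -[LHS]E (horner_coef_wide _ NM).
by apply: eq_bigr => i _; rewrite expr1n mulr1.
Qed.

Definition egrade (n : nat) : set U := [set u | ecomp n u = u].

(** This is the coassociativity of [env_delta]. It holds on generators and passes to products
    through the convolution formula [ecompM]. *)
Lemma ecomp_ecomp u m n : ecomp m (ecomp n u) = if m == n then ecomp n u else 0.
Proof.
move: m n; elim/envelope_ind: u => [a u v IHu IHv m n|m n|x u IHu m n].
- by rewrite !ecompZD IHu IHv; case: eqP => // _; rewrite scaler0 addr0.
- by rewrite ecomp1; case: n => [|n]; rewrite ?linear0 ?if_same // ecomp1; case: m.
have grx i j : ecomp j (env_iota (lcomp gr x i))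
    = if j == i then env_iota (lcomp gr x i) else 0.
  rewrite ecomp_iota; case: i => [|i].
    by rewrite lcomp0 (lcomp_linear0 gr) linear0 if_same.
  rewrite (lcomp_homog gr j (ltn0Sn i) (lcomp_mem gr x (ltn0Sn i))).
  by case: eqP => // _; rewrite linear0.
rewrite ecompM linear_sum /=.
transitivity (\sum_(i < n.+1)
    if m == n then ecomp i (env_iota x) * ecomp (n - i) u else 0); last first.
  by case: ifP => _ //; rewrite big1.
apply: eq_bigr => -[i /=]; rewrite ltnS => lin _; rewrite ecomp_iota ecompM.
have [lim|lmi] := leqP i m; last first.
  rewrite big1 => [|[j /=]]; first by rewrite ltn_eqF // (leq_trans lmi).
  by rewrite ltnS grx => jm _; rewrite ltn_eqF ?mul0r // (leq_ltn_trans jm).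
have ltim : (i < m.+1)%N by [].
rewrite (bigD1 (Ordinal ltim)) //= big1 => [|[j jm] /= ji]; last first.
  by rewrite grx (negPf (ji : j != i)) mul0r.
rewrite addr0 grx eqxx IHu -(eqn_add2r i) !subnK //.
by case: eqP => // _; rewrite mulr0.
Qed.

Lemma ecomp_grade n u : egrade n (ecomp n u).
Proof. by rewrite /egrade /= ecomp_ecomp eqxx. Qed.

Lemma egradeE n u : egrade n u -> forall m, ecomp m u = if m == n then u else 0.
Proof. by move=> un m; rewrite -un ecomp_ecomp un. Qed.

Lemma egrade_subspace n : Defs.subspace (egrade n).
Proof.
split=> [|a u v]; first by rewrite /egrade /= linear0.
by rewrite /egrade /= ecompZD => -> ->.
Qed.

Lemma egrade_iota n x : (0 < n)%N -> Lg n x -> egrade n (env_iota x).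
Proof.
by move=> n0 xn; rewrite /egrade /= ecomp_iota (lcomp_homog gr n n0 xn) eqxx.
Qed.

Lemma ecompMr m n u v : egrade m v ->
  ecomp n (u * v) = if (m <= n)%N then ecomp (n - m) u * v else 0.
Proof.
move=> vm; rewrite ecompM; case: leqP => [mn|nm].
  have nm : (n - m < n.+1)%N by rewrite ltnS leq_subr.
  rewrite (bigD1 (Ordinal nm)) //= big1 => [|[j jm] /= ji].
    rewrite addr0 (subKn mn); congr (_ * _); exact: vm.
  rewrite (egradeE vm) ifN ?mulr0 //; apply: contra (ji : j != (n - m)%N) => /eqP <-.
  by rewrite subKn.
rewrite big1 // => -[j /= jn] _.
by rewrite (egradeE vm) ltn_eqF ?mulr0 // (leq_ltn_trans (leq_subr _ _)).
Qed.

Lemma egrade1 : egrade 0 1.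
Proof. by rewrite /egrade /= ecomp1. Qed.

End GradedEnvelope.

(** * Dimensions *)

Section Dimension.
Variables (F : fieldType) (V : lmodType F).
Implicit Types A B : set V.

Definition independent n (e : 'I_n -> V) : Prop :=
  forall c : 'I_n -> F, \sum_i c i *: e i = 0 -> forall i, c i = 0.

Definition spanned_by (I : finType) (e : I -> V) (x : V) : Prop :=
  exists c : I -> F, x = \sum_i c i *: e i.

(** The matrix expressing [e] in terms of [f] has trivial left kernel, so its rank is [n]. An
    arbitrary finite index type lets later spanning families be indexed by dependent pairs. *)
Lemma independent_le (I : finType) n (e : 'I_n -> V) (f : I -> V) :
  independent e -> (forall i, spanned_by f (e i)) -> (n <= #|I|)%N.
Proof.
move=> ie /choice[C eC].
pose M : 'M[F]_(n, #|I|) := \matrix_(i, j) C i (enum_val j).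
suff /eqP <- : row_free M by apply: rank_leq_col.
apply: inj_row_free => v vM; apply/rowP => i; rewrite mxE.
apply: (ie (v 0)); transitivity (\sum_j (v *m M) 0 (enum_rank j) *: f j).
  under eq_bigr do rewrite eC scaler_sumr.
  rewrite exchange_big; apply: eq_bigr => j _; rewrite mxE scaler_suml.
  by apply: eq_bigr => k _; rewrite mxE enum_rankK scalerA.
by rewrite vM big1 // => j _; rewrite mxE scale0r.
Qed.

Lemma has_dim_uniq A m n : has_dim A m -> has_dim A n -> m = n.
Proof.
move=> [e [Ae se ie]] [f [Af sf jf]]; apply/eqP; rewrite eqn_leq; apply/andP; split.
  by rewrite -[X in (_ <= X)%N]card_ord (independent_le (f := f) ie) // => i; apply: sf.
by rewrite -[X in (_ <= X)%N]card_ord (independent_le (f := e) jf) // => i; apply: se.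
Qed.

Lemma subspace_sum A (I : Type) (r : seq I) (P : pred I) (x : I -> V) :
  Defs.subspace A -> (forall i, P i -> A (x i)) -> A (\sum_(i <- r | P i) x i).
Proof.
move=> [A0 AD] Ax; elim/big_ind: _ => // y z Ay Az.
by rewrite -[y]scale1r; apply: AD.
Qed.

Lemma subspaceZ A a x : Defs.subspace A -> A x -> A (a *: x).
Proof. by move=> [A0 AD] Ax; rewrite -[_ *: _]addr0; apply: AD. Qed.

(** The vectors [f i] may lie outside [A], so no basis can be extracted from them. They bound the
    length of independent families in [A], and one of maximal length spans. *)
Lemma finite_dim_spanned A (I : finType) (f : I -> V) :
  Defs.subspace A -> (forall x, A x -> spanned_by f x) -> finite_dim A.
Proof.
move=> sA Af.
pose P n := `[< exists e : 'I_n -> V, (forall i, A (e i)) /\ independent e >].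
have P0 : exists n, P n.
  exists 0%N; apply/asboolP; exists (fun=> 0); split; first by case.
  by move=> c _; case.
have Pm n : P n -> (n <= #|I|)%N.
  by move=> /asboolP[e [Ae ie]]; apply: independent_le ie _ => i; apply: Af.
have [n /asboolP[e [Ae ie]] nmax] := ex_maxnP P0 Pm.
exists n, e; split=> // x Ax.
pose e' (i : 'I_n.+1) := if unlift ord0 i is Some j then e j else x.
have : ~ independent e'.
  move=> ie'; suff /nmax : P n.+1 by rewrite ltnn.
  apply/asboolP; exists e'; split=> // i; rewrite /e'.
  by case: (unlift ord0 i).
move/existsNP => [c /not_implyP[ec /existsNP[i /eqP ci]]].
have {}ec : c ord0 *: x + \sum_j c (lift ord0 j) *: e j = 0.
  rewrite -[RHS]ec big_ord_recl /e' unlift_none.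
  by under [in RHS]eq_bigr do rewrite liftK.
have c0 : c ord0 != 0.
  apply: contra_neq ci => c0; rewrite c0 scale0r add0r in ec.
  by case: (unliftP ord0 i) => [j ->|-> //]; apply: (ie (fun j => c (lift ord0 j))).
exists (fun j => - (c ord0)^-1 * c (lift ord0 j)).
under eq_bigr do rewrite -scalerA.
rewrite -scaler_sumr; apply: (scalerI c0); rewrite scalerA mulrN divff // scaleN1r.
by apply/eqP; rewrite -addr_eq0 ec.
Qed.

Lemma finite_dim_sub A B :
  Defs.subspace A -> A `<=` B -> finite_dim B -> finite_dim A.
Proof.
move=> sA AB [n [e [_ se _]]].
by apply: (finite_dim_spanned (f := e)) => // x /AB /se.
Qed.

Definition fdim A : nat :=
  if pselect (finite_dim A) is left fA then projT1 (cid fA) else 0%N.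

Lemma fdimP A : finite_dim A -> has_dim A (fdim A).
Proof. by rewrite /fdim; case: pselect => // fA _; apply: projT2 (cid fA). Qed.

Lemma fdim_eq A n : has_dim A n -> fdim A = n.
Proof. by move=> An; apply: (has_dim_uniq _ An); apply: fdimP; exists n. Qed.

Lemma has_dim0 : has_dim [set (0 : V)] 0.
Proof.
exists (fun=> 0); split=> [|x ->|c _]; [by case| |by case].
by exists (fun=> 0); rewrite big_ord0.
Qed.

Lemma fdim0 : fdim [set (0 : V)] = 0%N.
Proof. exact/fdim_eq/has_dim0. Qed.

Lemma fdim_eq0 A : finite_dim A -> fdim A = 0%N -> forall x, A x -> x = 0.
Proof.
move=> fA A0 x Ax; have := fdimP fA; rewrite A0 => -[e [_ se _]].
by have [c ->] := se x Ax; rewrite big_ord0.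
Qed.

Lemma has_dim1 (x : V) : x != 0 -> has_dim [set y : V | exists a : F, y = a *: x] 1.
Proof.
move=> x0; exists (fun=> x); split=> [_|y [a ->]|c].
- by exists 1; rewrite scale1r.
- by exists (fun=> a); rewrite big_ord1.
- rewrite big_ord1 => /eqP; rewrite scaler_eq0 (negPf x0) orbF => /eqP c0 i.
  by rewrite ord1.
Qed.

End Dimension.

Section RankNullity.
Variables (F : fieldType) (V W : lmodType F) (T : V -> W) (A : set V).
Hypotheses (T_linear : linear T) (sA : Defs.subspace A).

Let T0 : T 0 = 0.
Proof. by have := T_linear (-1) 0 0; rewrite scaler0 addr0 scaleN1r addNr. Qed.

Let T_sum n (c : 'I_n -> F) (e : 'I_n -> V) :
  T (\sum_i c i *: e i) = \sum_i c i *: T (e i).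
Proof. by elim/big_rec2: _ => // i y x _ <-; rewrite T_linear. Qed.

Lemma subspace_ker : Defs.subspace [set x | A x /\ T x = 0].
Proof.
case: sA => A0 AD; split=> // a x y [Ax Tx] [Ay Ty].
by split; [apply: AD | rewrite T_linear Tx Ty scaler0 addr0].
Qed.

Lemma subspace_image : Defs.subspace (T @` A).
Proof.
case: sA => A0 AD; split=> [|a _ _ [x Ax <-] [y Ay <-]]; first by exists 0.
by exists (a *: x + y); [apply: AD | rewrite T_linear].
Qed.

Lemma has_dim_rank_nullity a b :
  has_dim [set x | A x /\ T x = 0] a -> has_dim (T @` A) b ->
  has_dim A (a + b).
Proof.
move=> [e [Ae se ie]] [f [Af sf jf]].
have /choice[g gP] : forall i, exists x, A x /\ T x = f i.
  by move=> i; have [x] := Af i; exists x.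
pose h (i : 'I_(a + b)) := match fintype.split i with inl j => e j | inr k => g k end.
have hl i : h (lshift b i) = e i by rewrite /h (unsplitK (inl i)).
have hr i : h (rshift a i) = g i by rewrite /h (unsplitK (inr i)).
exists h; split=> [i|x Ax|c].
- rewrite /h; case: (fintype.split i) => j; first by have [] := Ae j.
  by have [] := gP j.
- have [c Txc] : exists c, T x = \sum_i c i *: f i by apply: sf; exists x.
  pose y := \sum_i c i *: g i.
  have Ay : A y.
    by apply: subspace_sum => // i _; apply: subspaceZ => //; have [] := gP i.
  have Ty : T y = T x.
    by rewrite T_sum Txc; apply: eq_bigr => i _; have [_ ->] := gP i.
  have [|d xd] := se (-1 *: y + x).
    split; first by case: sA => _; apply.
    by rewrite T_linear Ty scaleN1r addNr.
  exists (fun i => match fintype.split i with inl j => d j | inr k => c k end).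
  rewrite big_split_ord /=.
  under eq_bigr do rewrite hl (unsplitK (inl _)).
  under [X in _ + X]eq_bigr do rewrite hr (unsplitK (inr _)).
  by rewrite -xd scaleN1r addrAC addNr add0r.
- rewrite big_split_ord /=.
  under eq_bigr do rewrite hl.
  under [X in _ + X]eq_bigr do rewrite hr.
  move=> c0; have cr k : c (rshift a k) = 0.
    apply: (jf (fun k => c (rshift a k))).
    have TD x y : T (x + y) = T x + T y by rewrite -[x]scale1r T_linear !scale1r.
    have /(congr1 T) := c0; rewrite T0 TD !T_sum.
    rewrite [X in X + _]big1 ?add0r => [E|i _]; last first.
      by have [_ ->] := Ae i; rewrite scaler0.
    by rewrite -[RHS]E; apply: eq_bigr => i _; have [_ ->] := gP i.
  have cl k : c (lshift b k) = 0.
    apply: (ie (fun k => c (lshift b k))); rewrite -[RHS]c0 [X in _ = _ + X]big1 ?addr0 //.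
    by move=> i _; rewrite cr scale0r.
  by move=> i; rewrite -(splitK i); case: (fintype.split i) => j; [apply: cl | apply: cr].
Qed.

Lemma finite_dim_image : finite_dim A -> finite_dim [set T x | x in A].
Proof.
move=> [n [e [_ se _]]].
apply: (finite_dim_spanned (f := T \o e)) subspace_image _ => _ [x /se[c ->] <-].
by exists c; rewrite T_sum.
Qed.

Lemma fdim_rank_nullity : finite_dim A ->
  fdim A = (fdim [set x | A x /\ T x = 0%R] + fdim [set T x | x in A])%N.
Proof.
move=> fA; apply: fdim_eq; apply: has_dim_rank_nullity; apply: fdimP.
  by apply: finite_dim_sub fA => [|x []//]; apply: subspace_ker.
exact: finite_dim_image.
Qed.

Lemma finite_dim_rank_nullity : finite_dim [set x | A x /\ T x = 0] ->
  finite_dim [set T x | x in A] -> finite_dim A.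
Proof. by move=> [a Ka] [b Ib]; exists (a + b)%N; apply: has_dim_rank_nullity. Qed.

Lemma has_dim_inj n : (forall x, A x -> T x = 0 -> x = 0) ->
  has_dim (T @` A) n -> has_dim A n.
Proof.
move=> Tinj In; rewrite -[n]add0n; apply: has_dim_rank_nullity => //.
suff -> : [set x | A x /\ T x = 0] = [set 0] by apply: has_dim0.
by apply/seteqP; split=> x /= => [[/Tinj]//|->]; split=> //; case: sA.
Qed.

End RankNullity.

(** * Derivations, Ore extensions and the peeling of one generator *)

(** * The Poincare-Birkhoff-Witt theorem *)

(** First coordinate of the commutator of the upper triangular matrices with diagonals [a], [b] and
    corners [a'], [b'], applied to the column (p, q). *)
Lemma dual_bracket (R : pzRingType) (a b a' b' p q : R) :
  (a * b - b * a) * p + ((a' * b - b * a') + (a * b' - b' * a)) * q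
  = (a * (b * p + b' * q) + a' * (b * q)) - (b * (a * p + a' * q) + b' * (a * q)).
Proof.
rewrite !(mulrBl, mulrDl, mulrDr) !mulrA !opprD !addrA.
by rewrite [RHS](ACl (1*4*3*5*2*6))%AC.
Qed.

Section DerivationExtension.
Variables (F : fieldType) (N : lieAlgType F) (ad : N -> N).
Hypothesis ad_linear : linear ad.
Hypothesis ad_lie : forall z t, ad (lie z t) = lie (ad z) t + lie z (ad t).

(* A derivation is a morphism to the dual numbers, here represented on pairs. *)
Section DualAction.
Variables (A : algType F) (i : N -> A).
Hypothesis i_linear : linear i.
Hypothesis i_lie : forall z t, i (lie z t) = i z * i t - i t * i z.

Definition dual_action (z : N) (v : A * A) : A * A :=
  (i z * v.1 + i (ad z) * v.2, i z * v.2).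

Lemma dual_action_linear z : linear (dual_action z).
Proof.
move=> a u v; congr (_, _) => /=; rewrite !mulrDr -!scalerAr //.
by rewrite scalerDr addrACA.
Qed.

Lemma dual_action_linearl v : linear (dual_action^~ v).
Proof.
move=> a z t; congr (_, _) => /=; rewrite ?ad_linear !i_linear !mulrDl -!scalerAl //.
by rewrite scalerDr addrACA.
Qed.

Lemma dual_action_lie z t v : dual_action (lie z t) v =
  dual_action z (dual_action t v) - dual_action t (dual_action z v).
Proof.
congr (_, _) => /=; last by rewrite i_lie mulrBl !mulrA.
rewrite ad_lie.
have -> : i (lie (ad z) t + lie z (ad t)) = i (lie (ad z) t) + i (lie z (ad t)).
  by rewrite -[lie _ _]scale1r i_linear !scale1r.
by rewrite !i_lie dual_bracket.
Qed.

End DualAction.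

(** Let [u] act on the pair (0, 1) by triangular matrices: the second coordinate of the result is
    [u] itself, and the first is taken as D u. *)
Lemma derivation_extension : exists D : envelope N -> envelope N,
  [/\ linear D, D 1 = 0 & forall z u,
      D (env_iota z * u) = env_iota z * D u + env_iota (ad z) * u].
Proof.
have i_lin : linear (@env_iota _ N) by apply: env_iota_is_linear.
have [act [act_lin act_linl act1 actM actE]] := envelope_action
  (dual_action_linear (@env_iota _ N)) (dual_action_linearl i_lin)
  (dual_action_lie i_lin (@env_iota_lie _ N)).
have act2 u : (act u (0, 1)).2 = u.
  elim/envelope_ind: u => [a u v IHu IHv||z u IHu].
  - by rewrite act_linl /= IHu IHv.
  - by rewrite act1.
  - by rewrite actM actE /= IHu.
exists (fun u => (act u (0, 1)).1); split=> [a u v||z u].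
- by rewrite act_linl.
- by rewrite act1.
- by rewrite actM actE /= act2.
Qed.

End DerivationExtension.

Section KernelLie.
Variables (F : fieldType) (L : lieAlgType F) (lam : L -> F).
Hypotheses (lam_linear : linear (lam : L -> F^o)).
Hypothesis lam_lie : forall y z, lam (lie y z) = 0.

(** The two proofs are arguments, so that closure under the module operations and the brackets can
    be inferred from the predicate itself. *)
Definition lie_ker_pred of linear (lam : L -> F^o)
  & (forall y z, lam (lie y z) = 0) : pred L := fun z => lam z == 0.

Fact lie_ker_submod_closed : submod_closed (lie_ker_pred lam_linear lam_lie).
Proof.
have E a u v : lam (a *: u + v) = a * lam u + lam v by exact: lam_linear.
have lam0 : lam 0 = 0.
  by have := E (-1) 0 0; rewrite scaler0 addr0 mulN1r addNr.
split=> [|a u v /eqP lu /eqP lv]; first exact/eqP.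
by apply/eqP; rewrite E lu lv mulr0 addr0.
Qed.

HB.instance Definition _ := GRing.isSubmodClosed.Build F L
  (lie_ker_pred lam_linear lam_lie) lie_ker_submod_closed.

Record lie_ker := LieKer {
  lie_ker_val : L;
  lie_kerP : lie_ker_pred lam_linear lam_lie lie_ker_val
}.

HB.instance Definition _ := [isSub for lie_ker_val].
HB.instance Definition _ := [Choice of lie_ker by <:].
HB.instance Definition _ := [SubChoice_isSubLmodule of lie_ker by <:].

Fact lie_ker_lie_subproof (y z : lie_ker) :
  lie_ker_pred lam_linear lam_lie (lie (lie_ker_val y) (lie_ker_val z)).
Proof. exact/eqP. Qed.

Definition lie_ker_lie y z : lie_ker := LieKer (lie_ker_lie_subproof y z).

Lemma lie_ker_valD y z : lie_ker_val (y + z) = lie_ker_val y + lie_ker_val z.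
Proof. by []. Qed.

Lemma lie_ker_valZ a y : lie_ker_val (a *: y) = a *: lie_ker_val y.
Proof. by []. Qed.

Lemma lie_ker_val0 : lie_ker_val 0 = 0.
Proof. by []. Qed.

Fact lie_ker_linearl y : linear (lie_ker_lie^~ y).
Proof. by move=> a u v; apply: val_inj; apply: lie_linearl. Qed.

Fact lie_ker_linearr y : linear (lie_ker_lie y).
Proof. by move=> a u v; apply: val_inj; apply: lie_linearr. Qed.

Fact lie_ker_xx y : lie_ker_lie y y = 0.
Proof. by apply: val_inj; apply: liexx. Qed.

Fact lie_ker_jacobi y z t : lie_ker_lie y (lie_ker_lie z t)
  + lie_ker_lie z (lie_ker_lie t y) + lie_ker_lie t (lie_ker_lie y z) = 0.
Proof. by apply: val_inj; apply: lie_jacobi. Qed.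

HB.instance Definition _ := Lmodule_isLieAlgebra.Build F lie_ker
  lie_ker_linearl lie_ker_linearr lie_ker_xx lie_ker_jacobi.

Lemma lie_ker_valL y z : lie_ker_val (lie y z) = lie (lie_ker_val y) (lie_ker_val z).
Proof. by []. Qed.

Local Notation M := lie_ker.
Local Notation UL := (envelope L).
Local Notation UM := (envelope M).

Lemma env_ker_exists : exists phi : {lrmorphism UM -> UL},
  forall z, phi (env_iota z) = env_iota (lie_ker_val z).
Proof.
have lin : linear (fun z : M => env_iota (lie_ker_val z)).
  by move=> a u v; rewrite lie_ker_valD lie_ker_valZ linearP.
have lie_lin (y z : M) : env_iota (lie_ker_val (lie y z)) =
    env_iota (lie_ker_val y) * env_iota (lie_ker_val z)
    - env_iota (lie_ker_val z) * env_iota (lie_ker_val y).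
  by rewrite lie_ker_valL env_iota_lie.
by have [phi [phiE _]] := envelope_universal lin lie_lin; exists phi.
Qed.

Definition env_ker : {lrmorphism UM -> UL} := projT1 (cid env_ker_exists).

Lemma env_ker_iota z : env_ker (env_iota z) = env_iota (lie_ker_val z).
Proof. exact: (projT2 (cid env_ker_exists)). Qed.

Lemma env_kerM u v : env_ker (u * v) = env_ker u * env_ker v.
Proof. exact: rmorphM. Qed.

Lemma env_ker1 : env_ker 1 = 1.
Proof. exact: rmorph1. Qed.

Lemma env_kerZD a u v : env_ker (a *: u + v) = a *: env_ker u + env_ker v.
Proof. exact: linearP. Qed.

Lemma env_kerD u v : env_ker (u + v) = env_ker u + env_ker v.
Proof. exact: linearD. Qed.

Lemma env_ker0 : env_ker 0 = 0.
Proof. exact: linear0. Qed.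

Variable x : L.
Hypothesis lamx : lam x = 1.

Fact ker_ad_subproof z :
  lie_ker_pred lam_linear lam_lie (lie x (lie_ker_val z)).
Proof. exact/eqP. Qed.

Definition ker_ad (z : M) : M := LieKer (ker_ad_subproof z).

Lemma ker_adE z : lie_ker_val (ker_ad z) = lie x (lie_ker_val z).
Proof. by []. Qed.

Lemma ker_derivation_exists : exists D : UM -> UM,
  [/\ linear D, D 1 = 0 & forall z u,
      D (env_iota z * u) = env_iota z * D u + env_iota (ker_ad z) * u].
Proof.
have ad_lin : linear ker_ad by move=> a u v; apply: val_inj; apply: lie_linearr.
have ad_lie z t : ker_ad (lie z t) = lie (ker_ad z) t + lie z (ker_ad t).
  apply: val_inj; case: z t => [z hz] [t ht].
  change (lie x (lie z t) = lie (lie x z) t + lie z (lie x t)).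
  have lieNr y w : lie y (- w) = - lie y w :> L by rewrite -scaleN1r lieZr scaleN1r.
  apply/eqP; rewrite (lieC (lie x z) t) (lieC x t) lieNr -opprD -addr_eq0.
  by rewrite (addrC (lie t _)) addrA lie_jacobi.
exact: derivation_extension.
Qed.

End KernelLie.

Lemma ore_action_expand (F : fieldType) (A : algType F) (a b b' w s s' r r' : A)
    (c d : F) :
  a * (b * w + d *: (s + s')) + c *: ((b * s + d *: r) + ((b * s' + b' * w) + d *: r'))
  = a * b * w + c *: (b' * w)
    + (d *: (a * (s + s')) + c *: (b * (s + s')) + (c * d) *: (r + r')).
Proof.
rewrite !mulrDr -!scalerAr !(mulrDr, scalerDr) !scalerA !mulrA !addrA.
by rewrite [LHS](ACl (1*7*2*3*4*6*5*8))%AC.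
Qed.

Lemma ore_action_linear (F : fieldType) (A : algType F) (m u v s s' t t' : A)
    (a c : F) :
  m * (a *: u + v) + c *: ((a *: s + s') + (a *: t + t'))
  = a *: (m * u + c *: (s + t)) + (m * v + c *: (s' + t')).
Proof.
rewrite mulrDr -scalerAr !scalerDr !scalerA (mulrC c a) !addrA.
by rewrite [LHS](ACl (1*3*5*2*4*6))%AC.
Qed.

Lemma ore_action_bracket (F : fieldType) (A : algType F) (a b a' b' w : A)
    (c d : F) :
  (a * b - b * a + c *: b' - d *: a') * w
  = a * b * w + c *: (b' * w) - (b * a * w + d *: (a' * w)).
Proof.
rewrite !(mulrBl, mulrDl) -!scalerAl opprD !addrA.
by rewrite [LHS](ACl (1*3*2*4))%AC.
Qed.

(* The Ore extension [A[X; D]], with sequences in place of polynomials. *)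
Section OreAction.
Variables (F : fieldType) (L N : lieAlgType F) (A : algType F).
Variables (i : N -> A) (D : A -> A) (ad : N -> N) (lam : L -> F) (pr : L -> N).
Hypotheses (i_linear : linear i) (D_linear : linear D) (pr_linear : linear pr).
Hypothesis lam_linear : forall a y z, lam (a *: y + z) = a * lam y + lam z.
Hypothesis i_lie : forall z t, i (lie z t) = i z * i t - i t * i z.
Hypothesis DM : forall z u, D (i z * u) = i z * D u + i (ad z) * u.
Hypothesis lam_lie : forall y z, lam (lie y z) = 0.
Hypothesis pr_lie : forall y z, pr (lie y z) =
  lie (pr y) (pr z) + lam y *: ad (pr z) - lam z *: ad (pr y).

Definition seq_shift (v : nat -> A) k := if k is k'.+1 then v k' else 0.
Local Notation S := seq_shift.

(** The sequence [v] stands for the sum of the v_k X^k. The formula is left multiplication by i (pr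
    y) + lam y X, using the rule X a = a X + D a. *)
Definition ore_action (y : L) (v : nat -> A) : nat -> A := fun k =>
  i (pr y) * v k + lam y *: (S v k + D (v k)).

Lemma ore_action_linearr y : linear (ore_action y).
Proof.
move=> a u v; apply/funext => k.
change (ore_action y (a *: u + v) k = a *: ore_action y u k + ore_action y v k).
rewrite /ore_action.
have -> : (a *: u + v) k = a *: u k + v k by [].
have -> : S (a *: u + v) k = a *: S u k + S v k.
  by case: k => //=; rewrite scaler0 addr0.
by rewrite D_linear ore_action_linear.
Qed.

Lemma ore_action_linearl v : linear (ore_action^~ v).
Proof.
move=> a y z; apply/funext => k.
change (ore_action (a *: y + z) v k = a *: ore_action y v k + ore_action z v k).
rewrite /ore_action pr_linear i_linear lam_linear.
by rewrite mulrDl -scalerAl scalerDl -scalerA addrACA -scalerDr.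
Qed.

Lemma ore_action_lie y z v : ore_action (lie y z) v =
  ore_action y (ore_action z v) - ore_action z (ore_action y v).
Proof.
have D0 : D 0 = 0.
  by have := D_linear (-1) 0 0; rewrite scaler0 addr0 scaleN1r addNr.
have DD u w : D (u + w) = D u + D w by rewrite -[u]scale1r D_linear !scale1r.
have DZ a u : D (a *: u) = a *: D u by rewrite -[a *: u]addr0 D_linear D0 addr0.
apply/funext => k.
change (ore_action (lie y z) v k
  = ore_action y (ore_action z v) k - ore_action z (ore_action y v) k).
pose t := S v k + D (v k).
pose q := S (S v) k + D (S v k) + D t.
(* The part of the double action that is symmetric in [y] and [z], and so cancels in the
   commutator. *)
pose sym y z := lam z *: (i (pr y) * t) + lam y *: (i (pr z) * t)
  + (lam y * lam z) *: q.
have symC : sym y z = sym z y by rewrite /sym mulrC [in LHS](addrC (lam z *: _)).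
have E y' z' : ore_action y' (ore_action z' v) k
  = i (pr y') * i (pr z') * v k + lam y' *: (i (ad (pr z')) * v k) + sym y' z'.
  rewrite [LHS]/ore_action.
  have -> : S (ore_action z' v) k = i (pr z') * S v k
      + lam z' *: (S (S v) k + D (S v k)).
    by rewrite /ore_action; case: k @t @q {sym symC} => //=;
      rewrite mulr0 D0 addr0 scaler0 addr0.
  by rewrite {1 2}/ore_action -/t DD DM DZ; apply: ore_action_expand.
rewrite !E symC opprD addrACA subrr addr0 /ore_action pr_lie lam_lie scale0r addr0.
have -> : i (lie (pr y) (pr z) + lam y *: ad (pr z) - lam z *: ad (pr y))
    = i (lie (pr y) (pr z)) + lam y *: i (ad (pr z)) - lam z *: i (ad (pr y)).
  rewrite addrC -scaleNr i_linear addrC scaleNr; congr (_ - _).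
  by rewrite addrC i_linear addrC.
by rewrite i_lie ore_action_bracket.
Qed.

End OreAction.

Section KernelEnvelope.
Variables (F : fieldType) (L : lieAlgType F) (lam : L -> F).
Hypotheses (lam_linear : linear (lam : L -> F^o)).
Hypothesis lam_lie : forall y z, lam (lie y z) = 0.
Variable x : L.
Hypothesis lamx : lam x = 1.

Local Notation M := (lie_ker lam_linear lam_lie).
Local Notation UL := (envelope L).
Local Notation UM := (envelope M).
Local Notation j := (env_ker lam_linear lam_lie).

Fact ker_proj_subproof y : lie_ker_pred lam_linear lam_lie (y - lam y *: x).
Proof.
have lamE a u v : lam (a *: u + v) = a * lam u + lam v by exact: lam_linear.
by apply/eqP; rewrite addrC -scaleNr lamE lamx mulr1 addNr.
Qed.

Definition ker_proj y : M := LieKer (ker_proj_subproof y).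

Lemma ker_projE y : lie_ker_val (ker_proj y) = y - lam y *: x.
Proof. by []. Qed.

Lemma ker_proj_val z : ker_proj (lie_ker_val z) = z.
Proof.
apply: val_inj; change (lie_ker_val z - lam (lie_ker_val z) *: x = lie_ker_val z).
by rewrite (eqP (lie_kerP z)) scale0r subr0.
Qed.

Lemma ker_proj_linear : linear ker_proj.
Proof.
move=> a u v; apply: val_inj.
change (a *: u + v - lam (a *: u + v) *: x
  = a *: (u - lam u *: x) + (v - lam v *: x)).
have -> : lam (a *: u + v) = a * lam u + lam v by exact: lam_linear.
by rewrite scalerDl scalerBr scalerA opprD addrACA.
Qed.

(** [L] is the semidirect product of the ideal [M] and the line through [x]; this is its bracket, in
    the form that [ore_action_lie] requires. *)
Lemma ker_proj_lie y z : ker_proj (lie y z) =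
  lie (ker_proj y) (ker_proj z) + lam y *: ker_ad x (ker_proj z)
    - lam z *: ker_ad x (ker_proj y) :> M.
Proof.
apply: val_inj.
change (lie y z - lam (lie y z) *: x = lie (y - lam y *: x) (z - lam z *: x)
  + lam y *: lie x (z - lam z *: x) - lam z *: lie x (y - lam y *: x)).
have lieNr u w : lie u (- w) = - lie u w :> L by rewrite -scaleN1r lieZr scaleN1r.
have lieNl u w : lie (- u) w = - lie u w :> L by rewrite -scaleN1r lieZl scaleN1r.
rewrite lam_lie scale0r subr0; move: (lam y) (lam z) => c d.
rewrite !(lieDl, lieDr, lieNl, lieNr, lieZl, lieZr) liexx !(scaler0, oppr0, addr0).
by rewrite [lie y x]lieC scalerN opprK subrK addrK.
Qed.

Lemma ker_action_exists : exists act : UL -> (nat -> UM) -> nat -> UM,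
  [/\ forall u, linear (act u), forall v, linear (act^~ v),
      forall v, act 1 v = v,
      forall u w v, act (u * w) v = act u (act w v)
    & exists2 D : UM -> UM, D 0 = 0 /\ D 1 = 0 & forall y v k,
        act (env_iota y) v k = env_iota (ker_proj y) * v k
          + lam y *: (seq_shift v k + D (v k))].
Proof.
have [D [D_lin D1 DM]] := @ker_derivation_exists _ _ _ lam_linear lam_lie x.
have D0 : D 0 = 0.
  by have := D_lin (-1) 0 0; rewrite scaler0 addr0 scaleN1r addNr.
have [act [? ? ? ? actE]] := envelope_action
  (ore_action_linearr (@env_iota _ M) lam ker_proj D_lin)
  (ore_action_linearl D (@env_iota_is_linear _ M) ker_proj_linear lam_linear)
  (ore_action_lie (@env_iota_is_linear _ M) D_lin (@env_iota_lie _ M) DM lam_lie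
    ker_proj_lie).
by exists act; split=> //; exists D => // y v k; rewrite actE.
Qed.

End KernelEnvelope.

(** * The larger algebra as an Ore extension of the smaller one *)

Section OreSplitting.
Variables (F : fieldType) (L N : lieAlgType F) (A B : algType F).
Variables (iA : N -> A) (iB : L -> B) (j : {lrmorphism A -> B}).
Variables (val : N -> L) (pr : L -> N) (ad : N -> N) (lam : L -> F) (x : L).
Hypothesis A_ind : forall P : A -> Prop,
  (forall a u v, P u -> P v -> P (a *: u + v)) -> P 1 ->
  (forall z u, P u -> P (iA z * u)) -> forall u, P u.
Hypothesis B_ind : forall P : B -> Prop,
  (forall a u v, P u -> P v -> P (a *: u + v)) -> P 1 ->
  (forall z u, P u -> P (iB z * u)) -> forall u, P u.
Hypothesis iA0 : iA 0 = 0.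
Hypothesis jE : forall z, j (iA z) = iB (val z).
Hypothesis iB_pr : forall y, iB y = iB (val (pr y)) + lam y *: iB x.
Hypothesis iB_ad : forall z, iB x * iB (val z) = iB (val z) * iB x + iB (val (ad z)).
Hypotheses (prK : forall z, pr (val z) = z) (lam_val : forall z, lam (val z) = 0).
Hypotheses (prx : pr x = 0) (lamx : lam x = 1).
Variable act : B -> (nat -> A) -> nat -> A.
Hypothesis act_linl : forall v, linear (act^~ v).
Hypothesis act1 : forall v, act 1 v = v.
Hypothesis actM : forall u w v, act (u * w) v = act u (act w v).
Variable D : A -> A.
Hypotheses (D0 : D 0 = 0) (D1 : D 1 = 0).
Hypothesis actE : forall y v k, act (iB y) v k
  = iA (pr y) * v k + lam y *: (seq_shift v k + D (v k)).

(** The candidate isomorphism of left [A]-modules from the Ore extension to [B]: coefficients on the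
    left, powers of [iB x] on the right. *)
Let E (p : {poly A}) : B := (map_poly j p).[iB x].

Let ED p q : E (p + q) = E p + E q.
Proof. by rewrite /E rmorphD hornerD. Qed.

Let ECM c p : E (c%:P * p) = j c * E p.
Proof. by rewrite /E rmorphM /= map_polyC hornerCM. Qed.

Let EC c : E c%:P = j c.
Proof. by rewrite /E map_polyC hornerC. Qed.

Let EMX p : E (p * 'X) = E p * iB x.
Proof. by rewrite /E rmorphM /= map_polyX hornerMX. Qed.

Let commute_ore a : exists b, iB x * j a = j a * iB x + j b.
Proof.
elim/A_ind: a => [c a a' [b ab] [b' ab']||z a [b ab]].
- exists (c *: b + b'); rewrite !linearP /= mulrDr mulrDl -!scalerAr -!scalerAl ab ab'.
  by rewrite scalerDr addrACA.
- by exists 0; rewrite rmorph1 raddf0 mulr1 mul1r addr0.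
exists (iA z * b + iA (ad z) * a).
rewrite raddfD /= !rmorphM /= !jE mulrA iB_ad mulrDl -mulrA ab mulrDr !mulrA.
by rewrite addrA.
Qed.

Let spanning u : exists p, u = E p.
Proof.
(* The image of [E] is stable under left multiplication by [iB x], which is moved past each
   coefficient by [commute_ore]. *)
have xE p : exists q, iB x * E p = E q.
  elim/poly_ind: p => [|p c [q pq]].
    by exists 0; rewrite /E rmorph0 horner0 mulr0.
  have [b cb] := commute_ore c.
  exists (q * 'X + (c%:P * 'X + b%:P)).
  by rewrite !ED !EMX !EC mulrDr mulrA pq cb.
elim/B_ind: u => [a u v [p ->] [q ->]||y u [p ->]].
- exists (a%:A%:P * p + q); rewrite ED ECM.
  by rewrite linearZ rmorph1 /= mulr_algl.
- by exists 1%:P; rewrite EC rmorph1.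
have [q pq] := xE p.
exists ((iA (pr y))%:P * p + (lam y)%:A%:P * q).
rewrite ED !ECM jE linearZ rmorph1 /= mulr_algl -pq [in LHS]iB_pr.
by rewrite mulrDl -scalerAl.
Qed.

(** Acting on the unit sequence recovers the coefficients of [p] from [E p], so [E] is bijective.
    Then [p0] takes the constant coefficient, and right multiplication by [iB x] shifts
    coefficients: it is injective, and its image is the kernel of [p0]. *)
Lemma ore_split : exists p0 : B -> A,
  [/\ linear p0, forall a, p0 (j a) = a, forall u, p0 (u * iB x) = 0,
      forall u, exists v, u = j (p0 u) + v * iB x
    & forall u, u * iB x = 0 -> u = 0].
Proof.
have act0 v k : act 0 v k = 0.
  by have := act_linl v (-1) 0 0; rewrite scaler0 addr0 scaleN1r => ->; rewrite addNr.
have act_lin a u w v k : act (a *: u + w) v k = a *: act u v k + act w v k.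
  by rewrite act_linl.
have act_j a v k : act (j a) v k = a * v k.
  move: v k; elim/A_ind: a => [c a a' IH IH' v k|v k|z a IH v k].
  - by rewrite linearP act_lin mulrDl -scalerAl -IH -IH'.
  - by rewrite rmorph1 act1 mul1r.
  - by rewrite rmorphM actM /= jE actE prK IH mulrA lam_val scale0r addr0.
(* The shift is right multiplication by X, so it commutes with the left action. *)
have actS u v k : act u (seq_shift v) k = seq_shift (act u v) k.
  move: k; elim/B_ind: u => [a u w IH IH' k|k|y u IH k].
  - by rewrite act_lin IH IH'; case: k => [|k] //=; rewrite ?act_lin // scaler0 addr0.
  - by rewrite !act1.
  - rewrite !actM !actE IH.
    have -> : seq_shift (act u (seq_shift v)) k = seq_shift (seq_shift (act u v)) k.
      by case: k => //= k; rewrite IH.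
    case: k => [|k] /=; last by rewrite ?actM actE.
    by rewrite mulr0 D0 addr0 scaler0 addr0.
pose d0 (k : nat) : A := (k == 0%N)%:R.
pose rho u k := act u d0 k.
have rhox u k : rho (u * iB x) k = seq_shift (rho u) k.
  rewrite /rho actM -actS; congr (act u _ k); apply/funext => l.
  rewrite actE prx iA0 mul0r add0r lamx scale1r.
  have -> : D (d0 l) = 0 by rewrite /d0; case: l.
  by rewrite addr0.
have rhoE p k : rho (E p) k = p`_k.
  move: k; elim/poly_ind: p => [|p c IH] k.
    by rewrite /E rmorph0 horner0 coef0 /rho act0.
  have -> : E (p * 'X + c%:P) = 1 *: (E p * iB x) + j c by rewrite ED EMX EC scale1r.
  rewrite /rho act_lin scale1r -/(rho (E p * iB x) k).
  rewrite rhox act_j coefD coefMX coefC /d0; case: k => [|k] /=.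
    by rewrite mulr1.
  by rewrite mulr0 IH.
have rho_inj u : (forall k, rho u k = 0) -> u = 0.
  have [p ->] := spanning u => p0; suff -> : p = 0 by rewrite /E rmorph0 horner0.
  by apply/polyP => k; rewrite -rhoE p0 coef0.
exists (fun u => rho u 0%N); split=> [a u v|a|u|u|u ux].
- by rewrite /rho act_lin.
- by rewrite /rho act_j mulr1.
- by rewrite rhox.
- have [p ->] := spanning u; elim/poly_ind: p => [|p c _].
    by exists 0; rewrite rhoE coef0 raddf0 mul0r addr0 /E rmorph0 horner0.
  exists (E p); rewrite rhoE coefD coefMX coefC /= add0r.
  by rewrite ED EMX EC addrC.
- by apply: rho_inj => k; rewrite -[LHS]/(seq_shift (rho u) k.+1) -rhox ux /rho act0.
Qed.

End OreSplitting.

Section KernelSplitting.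
Variables (F : fieldType) (L : lieAlgType F) (lam : L -> F).
Hypotheses (lam_linear : linear (lam : L -> F^o)).
Hypothesis lam_lie : forall y z, lam (lie y z) = 0.
Variable x : L.
Hypothesis lamx : lam x = 1.

Local Notation M := (lie_ker lam_linear lam_lie).
Local Notation UL := (envelope L).
Local Notation UM := (envelope M).
Local Notation j := (env_ker lam_linear lam_lie).

(** The retraction [p0] makes the envelope of [M] embed into that of [L], which is not visible from
    the presentation by generators and relations. *)
Lemma env_ker_split : exists p0 : UL -> UM,
  [/\ linear p0, forall a, p0 (j a) = a, forall u, p0 (u * env_iota x) = 0,
      forall u, exists v, u = j (p0 u) + v * env_iota x
    & forall u, u * env_iota x = 0 -> u = 0].
Proof.
have [act [_ act_linl act1 actM [D [D0 D1] actE]]] :=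
  ker_action_exists lam_linear lam_lie lamx.
have i0 : env_iota (0 : M) = 0 by exact: linear0.
have prx : ker_proj lam_linear lam_lie lamx x = 0.
  by apply: val_inj; change (x - lam x *: x = 0); rewrite lamx scale1r subrr.
have lam_val (z : M) : lam (lie_ker_val z) = 0 by exact: (eqP (lie_kerP z)).
have iB_pr y : env_iota y
    = env_iota (lie_ker_val (ker_proj lam_linear lam_lie lamx y)) + lam y *: env_iota x.
  by rewrite ker_projE linearB linearZ subrK.
have iB_ad (z : M) : env_iota x * env_iota (lie_ker_val z)
    = env_iota (lie_ker_val z) * env_iota x + env_iota (lie_ker_val (ker_ad x z)).
  by rewrite ker_adE env_iota_lie addrC subrK.
exact: (ore_split (@envelope_ind _ M) (@envelope_ind _ L) i0 (@env_ker_iota _ _ _ lam_linear lam_lie) iB_pr iB_ad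
  (@ker_proj_val _ _ _ lam_linear lam_lie x lamx) lam_val prx lamx act_linl act1 actM D0 D1 actE).
Qed.

End KernelSplitting.

Section GradedSplitting.
Variables (F : fieldType) (A B : algType F).
Variables (cA : nat -> A -> A) (cB : nat -> B -> B) (j : A -> B) (p0 : B -> A).
Variables (xi : B) (d : nat).
Hypotheses (p0_lin : linear p0) (p0j : forall a, p0 (j a) = a).
Hypothesis p0xi : forall u, p0 (u * xi) = 0.
Hypothesis split : forall u, exists v, u = j (p0 u) + v * xi.
Hypothesis xi_reg : forall u, u * xi = 0 -> u = 0.
Hypothesis cB_lin : forall n, linear (cB n).
Hypothesis cBB : forall n u, cB n (cB n u) = cB n u.
Hypothesis j_lin : linear j.
Hypothesis jc : forall n a, j (cA n a) = cB n (j a).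
Hypothesis cxi : forall n u,
  cB n (u * xi) = if (d <= n)%N then cB (n - d) u * xi else 0.
Let GA n : set A := [set a | cA n a = a].
Let GB n : set B := [set u | cB n u = u].
Hypothesis fGB : forall n, finite_dim (GB n).

(** Rank-nullity twice: in degree [n] the map [p0] is onto the component of [A], its kernel consists
    of the multiples v xi with [v] of degree n - d, and v determines v xi injectively. *)
Lemma graded_split_dim n : finite_dim (GA n) /\
  fdim (GB n) = (fdim (GA n) + (if d <= n then fdim (GB (n - d)) else 0))%N.
Proof.
have lin0 (V W : lmodType F) (f : V -> W) : linear f -> f 0 = 0.
  by move=> fl; have := fl (-1) 0 0; rewrite scaler0 addr0 scaleN1r addNr.
have linD (V W : lmodType F) (f : V -> W) : linear f -> {morph f : u v / u + v}.
  by move=> fl u v; rewrite -[u]scale1r fl !scale1r.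
have sGB m : Defs.subspace (GB m).
  split=> [|a u v /= Gu Gv]; first exact: lin0.
  by rewrite /GB /= cB_lin Gu Gv.
have p0G u : GB n u -> cA n (p0 u) = p0 u.
  move=> Gu; have [v uE] := split u.
  rewrite -[RHS]/(p0 u) -[in RHS]Gu [in RHS]uE (linD _ _ _ (cB_lin n)) -jc cxi.
  by case: ifP => _; rewrite ?addr0 ?(linD _ _ _ p0_lin) p0j ?p0xi ?addr0.
have imE : p0 @` GB n = GA n.
  apply/seteqP; split=> [_ [u Gu <-]|a Ga]; first exact: p0G.
  by exists (j a) => //; rewrite /GB /= -jc Ga.
have fGA : finite_dim (GA n) by rewrite -imE; apply: finite_dim_image.
split=> //; rewrite (fdim_rank_nullity p0_lin (sGB n) (fGB n)) imE addnC.
congr (_ + _)%N.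
have kerP u : GB n u -> p0 u = 0 ->
    exists2 v, GB (n - d)%N v & u = if (d <= n)%N then v * xi else 0.
  move=> Gu pu; have [v uE] := split u.
  rewrite pu (lin0 _ _ _ j_lin) add0r in uE.
  exists (cB (n - d)%N v); first exact: cBB.
  by rewrite -[LHS]Gu [in LHS]uE cxi.
case: ifP => dn; rewrite dn in kerP; last first.
  suff -> : [set u | GB n u /\ p0 u = 0] = [set 0] by apply: fdim0.
  apply/seteqP; split=> [u [Gu pu]|u ->] /=; first by have [v _ ->] := kerP u Gu pu.
  by split; [case: (sGB n) | apply: lin0].
have xi_lin : linear (fun v => v * xi) by move=> a u v; rewrite mulrDl scalerAl.
rewrite (fdim_rank_nullity xi_lin (sGB (n - d)%N) (fGB (n - d)%N)).
have -> : [set v | GB (n - d)%N v /\ v * xi = 0] = [set 0].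
  apply/seteqP; split=> [v [_ /xi_reg]//|v ->] /=.
  by split; [case: (sGB (n - d)%N) | rewrite mul0r].
rewrite fdim0 add0n; congr fdim; apply/seteqP; split=> [u [Gu pu]|_ [v Gv <-]] /=.
  by have [v Gv ->] := kerP u Gu pu; exists v.
by split=> //; rewrite /GB /= cxi dn Gv.
Qed.

End GradedSplitting.

Section KernelGrading.
Variables (F : fieldType) (L : lieAlgType F) (Lg : nat -> set L).
Hypothesis gr : is_grading Lg.
Variables (lam : L -> F) (x : L) (d : nat).
Hypotheses (lam_linear : linear (lam : L -> F^o)).
Hypothesis lam_lie : forall y z, lam (lie y z) = 0.
Hypotheses (d0 : (0 < d)%N) (Lx : Lg d x) (lamx : lam x = 1).
Hypothesis lam_homog : forall k y, (0 < k)%N -> k != d -> Lg k y -> lam y = 0.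

Local Notation M := (lie_ker lam_linear lam_lie).

Definition ker_grading (k : nat) : set M := [set z | Lg k (lie_ker_val z)].

Let lam0 : lam 0 = 0.
Proof. by rewrite -(liexx (0 : L)) lam_lie. Qed.

Let lamD y z : lam (y + z) = lam y + lam z.
Proof.
have := lam_linear 1 y z; rewrite scale1r => ->.
by congr (_ + _); apply: mul1r.
Qed.

(** By homogeneity only the component of degree [d] contributes to [lam z], so that its value equals
    [lam z], which is 0. Hence the kernel is a graded ideal. *)
Let lam_comp (z : M) k : lam (lcomp gr (lie_ker_val z) k) = 0.
Proof.
case: k => [|k]; first by rewrite lcomp0 lam0.
have [kd|] := eqVneq k.+1 d; last first.
  by move=> kd; apply: (lam_homog _ kd) => //; apply: lcomp_mem.
have [N HN] := lcomp_fin gr (lie_ker_val z).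
have [_ zE] := HN (maxn N k.+2) (leq_maxl _ _).
have kN : (k.+1 < maxn N k.+2)%N by rewrite leq_max leqnn orbT.
have := eqP (lie_kerP z); rewrite {1}zE (bigD1 (Ordinal kN)) //= lamD => <-.
rewrite [X in _ = _ + X](_ : _ = 0) ?addr0 //.
elim/big_ind: _ => //= [u v lu lv|[i iN] ik]; first by rewrite lamD lu lv addr0.
case: i iN ik => [|i] iN ik; first by rewrite lcomp0 lam0.
apply: (lam_homog (ltn0Sn i)); last exact: lcomp_mem.
by rewrite -kd; exact: ik.
Qed.

Lemma lie_ker_val_sum (I : Type) (r : seq I) (P : pred I) (f : I -> M) :
  lie_ker_val (\sum_(i <- r | P i) f i) = \sum_(i <- r | P i) lie_ker_val (f i).
Proof. exact: (big_morph _ (@lie_ker_valD _ _ _ _ _) (lie_ker_val0 _ _)). Qed.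

Lemma ker_grading_is_grading : is_grading ker_grading.
Proof.
split=> [k k0||n y yM y0 k kn|m n y z m0 n0 my nz].
- split=> [|a u v uM vM]; first exact: (grading0 gr).
  change (Lg k (a *: lie_ker_val u + lie_ker_val v)).
  exact: (gradingZD gr).
- apply/seteqP; split=> // z _.
  have [N HN] := lcomp_fin gr (lie_ker_val z).
  have [_ zE] := HN N (leqnn _).
  have lk k : lie_ker_pred lam_linear lam_lie (lcomp gr (lie_ker_val z) k).
    by apply/eqP/lam_comp.
  exists N, (fun k => LieKer (lk k)); split.
    by move=> k k0; apply: lcomp_mem.
  apply: val_inj; change (lie_ker_val z =
    lie_ker_val (\sum_(1 <= k < N) LieKer (lk k))).
  rewrite lie_ker_val_sum {1}zE -(sum_from1 N) //.
  by apply: lcomp0.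
- apply: val_inj; change (lie_ker_val (y k) = 0).
  apply: (grading_direct gr (y := fun k => lie_ker_val (y k)) _ _ kn) => [i i0|].
    exact: (yM i i0).
  by rewrite -lie_ker_val_sum y0.
- exact: (grading_lie gr).
Qed.

Lemma lcomp_lie_ker (z : M) n :
  lie_ker_val (lcomp ker_grading_is_grading z n) = lcomp gr (lie_ker_val z) n.
Proof.
apply/esym; apply: (@lcomp_eq _ _ _ gr _
  (fun n => lie_ker_val (lcomp ker_grading_is_grading z n))).
have [zk z0 [N [zN zE]]] := lcompP ker_grading_is_grading z; split.
- by move=> k /zk.
- by rewrite z0.
- exists N; split=> [k /zN ->//|]; first by rewrite -lie_ker_val_sum -zE.
Qed.

Lemma ecomp_ker n (a : envelope M) :
  env_ker lam_linear lam_lie (ecomp ker_grading_is_grading n a)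
  = ecomp gr n (env_ker lam_linear lam_lie a).
Proof.
move: n; elim/envelope_ind: a => [c a a' IH IH' n|n|z a IH n].
- by rewrite !(ecompZD, env_kerZD) IH IH'.
- by rewrite env_ker1 !ecomp1; case: n => [|n]; rewrite ?env_ker1 ?env_ker0.
rewrite ecompM env_kerM env_ker_iota ecompM.
rewrite (big_morph _ (@env_kerD _ _ _ lam_linear lam_lie) (env_ker0 lam_linear lam_lie)).
apply: eq_bigr => i _.
by rewrite env_kerM IH (ecomp_iota ker_grading_is_grading) env_ker_iota
  lcomp_lie_ker -(ecomp_iota gr).
Qed.

Lemma fdim_egrade_ker : (forall n, finite_dim (egrade gr n)) -> forall n,
  finite_dim (egrade ker_grading_is_grading n) /\
  fdim (egrade gr n) = (fdim (egrade ker_grading_is_grading n)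
    + (if d <= n then fdim (egrade gr (n - d)) else 0))%N.
Proof.
move=> fG n.
have [p0 [p0_lin p0j p0x psplit xreg]] := env_ker_split lam_linear lam_lie lamx.
have jlin : linear (env_ker lam_linear lam_lie) by move=> a u v; apply: env_kerZD.
have cc m u : ecomp gr m (ecomp gr m u) = ecomp gr m u by apply: ecomp_grade.
have cx m u : ecomp gr m (u * env_iota x)
    = if (d <= m)%N then ecomp gr (m - d) u * env_iota x else 0.
  exact/ecompMr/egrade_iota.
exact: (graded_split_dim p0_lin p0j p0x psplit xreg (ecomp_is_linear gr)
  cc jlin ecomp_ker cx fG n).
Qed.

End KernelGrading.

Section PBWSeries.
Variable F : fieldType.

Lemma eq_coefMl (R : nzRingType) (p q r : {poly R}) N :
  (forall n, (n <= N)%N -> p`_n = q`_n) ->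
  forall n, (n <= N)%N -> (p * r)`_n = (q * r)`_n.
Proof.
move=> pq n nN; rewrite !coefM; apply: eq_bigr => -[i /=]; rewrite ltnS => iN _.
by rewrite pq // (leq_trans iN).
Qed.

Lemma fdim_inj (V W : lmodType F) (T : V -> W) (A : set V) (B : set W) :
  linear T -> Defs.subspace A -> finite_dim B -> T @` A = B ->
  (forall x, A x -> T x = 0 -> x = 0) -> finite_dim A /\ fdim A = fdim B.
Proof.
move=> T_lin sA fB TA T_inj.
have : has_dim A (fdim B) by apply: (has_dim_inj T_lin sA T_inj); rewrite TA; apply: fdimP.
by move=> Ad; split; [exists (fdim B) | apply: fdim_eq].
Qed.

Section Split.
Variables (L : lieAlgType F) (Lg : nat -> set L).
Hypothesis gr : is_grading Lg.
Variable d : nat.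
Hypotheses (d0 : (0 < d)%N) (Ld : finite_dim (Lg d)) (Ld0 : fdim (Lg d) <> 0%N).
Hypothesis low : forall k y, (0 < k < d)%N -> Lg k y -> y = 0.

(** Take the first coordinate of the component of degree [d]. It kills brackets, since a bracket of
    degree [d] has a factor of degree below [d], and such factors vanish. *)
Lemma lowest_functional : exists (lam : L -> F) (x : L),
  [/\ linear (lam : L -> F^o), forall y z, lam (lie y z) = 0, Lg d x, lam x = 1
    & forall k y, (0 < k)%N -> k != d -> Lg k y -> lam y = 0].
Proof.
have := fdimP Ld; case: (fdim (Lg d)) Ld0 => // r _ [e [Le se ie]].
have /choice[c cE] : forall y, exists c : 'I_r.+1 -> F, lcomp gr y d = \sum_i c i *: e i.
  by move=> y; apply: se; apply: lcomp_mem.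
have uniq_c (a b : 'I_r.+1 -> F) : \sum_i a i *: e i = \sum_i b i *: e i -> a =1 b.
  move=> ab i; apply/eqP; rewrite -subr_eq0; apply/eqP.
  apply: (ie (fun i => a i - b i)); under eq_bigr do rewrite scalerBl.
  by rewrite sumrB ab subrr.
have c0 y : lcomp gr y d = 0 -> c y ord0 = 0.
  move=> y0; apply: (uniq_c _ (fun=> 0)); rewrite -cE y0 big1 // => i _.
  by rewrite scale0r.
exists (fun y => c y ord0), (e ord0); split.
- move=> a u v; apply: (uniq_c _ (fun i => a * c u i + c v i)).
  rewrite -cE lcomp_linear !cE scaler_sumr -big_split; apply: eq_bigr => i _.
  by rewrite scalerDl scalerA.
- move=> y z; apply: c0; elim/(grading_ind gr): y => [a y y' E E'|k y k0 Ly].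
    by rewrite lieDl lieZl lcomp_linear E E' scaler0 addr0.
  elim/(grading_ind gr): z => [a z z' E E'|l z l0 Lz].
    by rewrite lieDr lieZr lcomp_linear E E' scaler0 addr0.
  rewrite (lcomp_homog gr d (k := (k + l)%N)) ?addn_gt0 ?k0 //; last exact: (grading_lie gr).
  case: eqP => // dkl; rewrite (low (k := k) (y := y)) ?lie0l //.
  by rewrite k0 dkl -addn1 leq_add2l.
- exact: Le.
- apply: etrans (uniq_c _ (fun i => (i == ord0)%:R) _ ord0) _; last by rewrite eqxx.
  rewrite -cE (lcomp_homog gr d d0 (Le _)) eqxx (bigD1 ord0) //= scale1r.
  by rewrite big1 ?addr0 // => i /negPf ->; rewrite scale0r.
- by move=> k y k0 kd Ly; apply: c0; rewrite (lcomp_homog gr d k0 Ly) eq_sym (negPf kd).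
Qed.

End Split.

Lemma fdim_ker_grading (L : lieAlgType F) (Lg : nat -> set L) (gr : is_grading Lg)
    (lam : L -> F) (x : L) d (lam_linear : linear (lam : L -> F^o))
    (lam_lie : forall y z, lam (lie y z) = 0) :
  (0 < d)%N -> Lg d x -> lam x = 1 ->
  (forall k y, (0 < k)%N -> k != d -> Lg k y -> lam y = 0) ->
  (forall k, (0 < k)%N -> finite_dim (Lg k)) ->
  forall k, (0 < k)%N -> finite_dim (@ker_grading _ _ Lg _ lam_linear lam_lie k) /\
    fdim (Lg k) = (fdim (@ker_grading _ _ Lg _ lam_linear lam_lie k) + (k == d))%N.
Proof.
move=> d0 Lx lamx lam_homog fL k k0.
have sL := grading_subspace gr k0.
pose A : set L := [set y | Lg k y /\ (lam y : F^o) = 0].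
have sA : Defs.subspace A by apply: subspace_ker.
have fA : finite_dim A by apply: (finite_dim_sub sA) (fL k k0) => y [].
pose val : lie_ker lam_linear lam_lie -> L := @lie_ker_val _ _ _ lam_linear lam_lie.
have val_lin : linear val by move=> a u v.
have sM : Defs.subspace (@ker_grading _ _ Lg _ lam_linear lam_lie k).
  exact: (grading_subspace (ker_grading_is_grading gr lam_linear lam_lie lam_homog)).
have [||fM dM] := fdim_inj val_lin sM fA.
- apply/seteqP; split=> [_ [z Lz <-]|y [Ly ly]]; first by split=> //; apply: (eqP (lie_kerP z)).
  have py : lie_ker_pred lam_linear lam_lie y by apply/eqP.
  by exists (LieKer py).
- by move=> z _ z0; apply: val_inj.
split=> //; rewrite (fdim_rank_nullity lam_linear sL (fL k k0)) dM; congr (_ + _)%N.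
have [->|kd] := eqVneq k d.
  apply: fdim_eq; suff -> : [set (lam y : F^o) | y in Lg d]
      = [set y : F^o | exists a : F, y = a *: (1 : F^o)].
    by apply: has_dim1; apply: oner_neq0.
  apply/seteqP; split=> [_ [y _ <-]|_ [a ->]] /=.
    by exists (lam y); apply/esym/mulr1.
  exists (a *: x + 0).
    by apply: (gradingZD gr) => //; apply: (grading0 gr).
  rewrite lam_linear lamx; suff -> : lam 0 = 0 by rewrite addr0.
  by rewrite -(liexx (0 : L)) lam_lie.
suff -> : [set (lam y : F^o) | y in Lg k] = [set 0] by rewrite fdim0.
apply/seteqP; split=> [_ [y Ly <-]|_ ->] /=; first exact: (lam_homog k).
exists 0; first exact: (grading0 gr).
by rewrite -(liexx (0 : L)) lam_lie.
Qed.

Lemma egrade_fdim_low (L : lieAlgType F) (Lg : nat -> set L) (gr : is_grading Lg) N :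
  (forall k y, (0 < k <= N)%N -> Lg k y -> y = 0) ->
  forall n, (n <= N)%N -> fdim (egrade gr n) = (n == 0%N).
Proof.
move=> low n nN; apply: fdim_eq.
case: n nN => [|n] nN.
  suff -> : egrade gr 0 = [set u | exists a : F, u = a *: 1].
    by apply: has_dim1; apply: oner_neq0.
  apply/seteqP; split=> [u <-|_ [a ->]] /=; first by rewrite ecomp0; exists (env_aug u).
  by apply: subspaceZ; [apply: egrade_subspace | apply: egrade1].
suff -> : egrade gr n.+1 = [set 0] by apply: has_dim0.
apply/seteqP; split=> [u <-|_ ->] /=; last by case: (egrade_subspace gr n.+1).
elim/envelope_ind: u => [a u v Eu Ev||x u _].
- by rewrite ecompZD Eu Ev scaler0 addr0.
- by rewrite ecomp1.
rewrite ecompM big1 // => -[[|i] /= iN] _; rewrite ecomp_iota.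
  by rewrite lcomp0 linear0 mul0r.
rewrite (low i.+1 _ _ (lcomp_mem gr x (ltn0Sn i))) ?linear0 ?mul0r //=.
by rewrite (leq_trans _ nN).
Qed.

(** Induction on the total dimension of [L] in degrees 1 to [N], over all graded Lie algebras at
    once because the algebra is replaced by an ideal. Each step lowers this dimension by one and
    removes one factor 1 - X^d. *)
Lemma pbw_series N (L : lieAlgType F) (Lg : nat -> set L) (gr : is_grading Lg) :
  (forall n, finite_dim (egrade gr n)) ->
  (forall k, (0 < k)%N -> finite_dim (Lg k)) ->
  forall n, (n <= N)%N ->
  ((\poly_(i < N.+1) (fdim (egrade gr i))%:Z)
    * \prod_(1 <= k < N.+1) (1 - 'X^k) ^+ fdim (Lg k))`_n = (n == 0%N)%:Z.
Proof.
move rE : (\sum_(1 <= k < N.+1) fdim (Lg k))%N => r.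
elim: r L Lg gr rE => [|r IH] L Lg gr rE fU fL n nN.
  have Lg0 k : (0 < k <= N)%N -> fdim (Lg k) = 0%N.
    move=> kN; apply/eqP; rewrite -leqn0 -rE (bigD1_seq k) ?iota_uniq ?leq_addr //=.
    by rewrite mem_index_iota ltnS.
  rewrite big_nat_cond big1 ?mulr1 => [|k]; last first.
    by rewrite ltnS andbT => /Lg0 ->.
  rewrite coef_poly ltnS nN (egrade_fdim_low gr (N := N)) // => k y kN.
  by apply: fdim_eq0 (Lg0 k kN) _; apply: fL; case/andP: kN.
have [d [/andP[d0 dN] Ld0 low]] : exists d, [/\ (0 < d <= N)%N, fdim (Lg d) <> 0%N
    & forall k, (0 < k < d)%N -> fdim (Lg k) = 0%N].
  have ex : exists d, (0 < d <= N)%N && (fdim (Lg d) != 0%N).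
    apply/not_existsP => H; suff : (\sum_(1 <= k < N.+1) fdim (Lg k) = 0)%N by rewrite rE.
    rewrite big_nat_cond big1 // => k; rewrite ltnS andbT => kN.
    by apply/eqP/negPn/negP => k0; apply: (H k); rewrite kN.
  case: (ex_minnP ex) => d /andP[dN /eqP Ld] dmin; exists d; split=> // k /andP[k0 kd].
  apply/eqP/negPn/negP => Lk; have := dmin k; rewrite Lk k0 andbT.
  by rewrite (leq_trans (ltnW kd)) ?(andP dN).2 // leqNgt kd => /(_ isT).
have [lam [x [lam_linear lam_lie Lx lamx lam_homog]]] :=
  lowest_functional gr d0 (fL d d0) Ld0 (fun k y kd =>
    fdim_eq0 (fL k (proj1 (andP kd))) (low k kd) (x := y)).
pose grM := ker_grading_is_grading gr lam_linear lam_lie lam_homog.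
have dU := fdim_egrade_ker lam_linear lam_lie d0 Lx lamx lam_homog fU.
have dL := fdim_ker_grading gr lam_linear lam_lie d0 Lx lamx lam_homog fL.
have rM : (\sum_(1 <= k < N.+1) fdim (@ker_grading _ _ Lg _ lam_linear lam_lie k) = r)%N.
  apply: succn_inj; rewrite -rE.
  rewrite [RHS](eq_big_nat _ _ (F2 := fun k =>
    fdim (@ker_grading _ _ Lg _ lam_linear lam_lie k) + (k == d)))%N; last first.
    by move=> k /andP[k0 _]; apply: (dL k k0).2.
  rewrite big_split /= -addn1; congr (_ + _)%N.
  rewrite (bigD1_seq d) ?iota_uniq ?mem_index_iota ?ltnS ?d0 //= eqxx big1 // => k.
  by move/negPf ->.
rewrite -(IH _ _ grM rM (fun n => (dU n).1) (fun k k0 => (dL k k0).1) n nN).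
have -> : \prod_(1 <= k < N.+1) (1 - 'X^k) ^+ fdim (Lg k) = (1 - 'X^d)
    * \prod_(1 <= k < N.+1) (1 - 'X^k) ^+ fdim (@ker_grading _ _ Lg _ lam_linear lam_lie k)
    :> {poly int}.
  rewrite [LHS](eq_big_nat _ _ (F2 := fun k => (if k == d then 1 - 'X^d else 1)
    * (1 - 'X^k) ^+ fdim (@ker_grading _ _ Lg _ lam_linear lam_lie k))); last first.
    move=> k /andP[k0 _]; rewrite (dL k k0).2 exprD mulrC.
    by case: eqP => [->|_]; rewrite ?expr1 ?expr0.
  rewrite big_split /=; congr (_ * _).
  rewrite (bigD1_seq d) ?iota_uniq ?mem_index_iota ?ltnS ?d0 //= eqxx big1 ?mulr1 //.
  by move=> k /negPf ->.
(* What remains is u_L (1 - X^d) = u_M up to degree [N], which is [dU]. *)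
rewrite mulrA; apply: eq_coefMl nN => {n} n nN.
rewrite mulrBr mulr1 coefB coefMXn !coef_poly !ltnS nN (dU n).2.
case: (leqP d n) => dn; last by rewrite subr0 addn0.
by rewrite (leq_trans (leq_subr _ _)) // PoszD addrK.
Qed.

End PBWSeries.

(** * Comparison with a projective resolution *)

Section ProjectiveLifting.
Variables (A : nzRingType) (M N : lmodType A) (d : {linear M -> N}).

Definition linear_image_pred of {linear M -> N} : pred N :=
  fun y => `[< exists x, d x = y >].

Fact linear_image_submod_closed : submod_closed (linear_image_pred d).
Proof.
split=> [|a u v /asboolP[x <-] /asboolP[y <-]]; apply/asboolP.
  by exists 0; rewrite linear0.
by exists (a *: x + y); rewrite linearP.
Qed.

HB.instance Definition _ :=
  GRing.isSubmodClosed.Build A N (linear_image_pred d) linear_image_submod_closed.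

Record linear_image := LinearImage {
  linear_image_val : N;
  linear_imageP : linear_image_pred d linear_image_val
}.

HB.instance Definition _ := [isSub for linear_image_val].
HB.instance Definition _ := [Choice of linear_image by <:].
HB.instance Definition _ := [SubChoice_isSubLmodule of linear_image by <:].

(** [projective_module] lifts along surjections only, so [d] is first restricted to its image, made
    into a module of its own. *)
Lemma projective_lift_image (P : lmodType A) (h : {linear P -> N}) :
  projective_module P -> (forall p, exists x, d x = h p) ->
  exists h' : {linear P -> M}, forall p, d (h' p) = h p.
Proof.
move=> Pproj dh.
have dP x : linear_image_pred d (d x) by apply/asboolP; exists x.
have hP p : linear_image_pred d (h p) by apply/asboolP.
have d_lin : linear (fun x => LinearImage (dP x)).
  by move=> a x y; apply: val_inj; apply: linearP.
have h_lin : linear (fun p => LinearImage (hP p)).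
  by move=> a x y; apply: val_inj; apply: linearP.
pose d' : {linear M -> linear_image} := HB.pack (fun x => LinearImage (dP x))
  (GRing.isLinear.Build _ _ _ _ _ d_lin).
pose h' : {linear P -> linear_image} := HB.pack (fun p => LinearImage (hP p))
  (GRing.isLinear.Build _ _ _ _ _ h_lin).
have [|k kE] := Pproj _ _ d' h'.
  by move=> [y yP]; have /asboolP[x xy] := yP; exists x; apply: val_inj.
by exists k => p; have /(congr1 (@linear_image_val)) := kE p.
Qed.

End ProjectiveLifting.

Section FreeModules.
Variable A : nzRingType.

Lemma row_basis m (y : 'rV[A]_m) : y = \sum_j y 0 j *: delta_mx 0 j.
Proof. by rewrite {1}(row_sum_delta y). Qed.

Definition row_comb m (V : lmodType A) (e : 'I_m -> V) (y : 'rV[A]_m) : V :=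
  \sum_j y 0 j *: e j.

Fact row_comb_is_linear m (V : lmodType A) (e : 'I_m -> V) : linear (row_comb e).
Proof.
move=> a u v; rewrite /row_comb scaler_sumr -big_split; apply: eq_bigr => j _.
by rewrite !mxE scalerDl scalerA.
Qed.

HB.instance Definition _ m (V : lmodType A) (e : 'I_m -> V) :=
  GRing.isLinear.Build A 'rV[A]_m V *:%R (row_comb e) (row_comb_is_linear e).

Lemma linear_row_comb m (V : lmodType A) (f : {linear 'rV[A]_m -> V}) y :
  f y = row_comb (fun j => f (delta_mx 0 j)) y.
Proof. by rewrite {1}[y]row_basis linear_sum; apply: eq_bigr => j _; rewrite linearZ. Qed.

Lemma linear_row_comb_comp m (V W : lmodType A) (f : {linear V -> W}) (e : 'I_m -> V) y :
  f (row_comb e y) = row_comb (f \o e) y.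
Proof. by rewrite linear_sum; apply: eq_bigr => j _; rewrite linearZ. Qed.

Definition submodule m (K : set 'rV[A]_m) : Prop :=
  K 0 /\ forall a x y, K x -> K y -> K (a *: x + y).

Definition generates m n (e : 'I_n -> 'rV[A]_m) (K : set 'rV[A]_m) : Prop :=
  (forall k, K (e k)) /\ forall y, K y -> exists c, y = row_comb e c.

Lemma submodule_comb m n (e : 'I_n -> 'rV[A]_m) (K : set 'rV[A]_m) c :
  submodule K -> (forall k, K (e k)) -> K (row_comb e c).
Proof.
move=> [K0 KD] Ke; rewrite /row_comb; elim/big_ind: _ => // [x y Kx Ky|k _].
  by rewrite -[x]scale1r; apply: KD.
by rewrite -[_ *: _]addr0; apply: KD.
Qed.

End FreeModules.

Section Comparison.
Variables (A : nzRingType) (T : lmodType A) (P : projective_resolution T).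
Local Notation d := (res_diff P).

(* [K] plays the role of the (i+1)-st syzygy of [T] in a resolution by free
   modules: [f] and [g] are parts of comparison maps with [P], and [Phi] is
   the part of a homotopy between [g f] and the identity. *)
Definition comparison i m (K : set 'rV[A]_m) : Prop :=
  exists (f : {linear 'rV[A]_m -> res_module P i})
    (g : {linear res_module P i -> 'rV[A]_m}) (Phi : {linear 'rV[A]_m -> 'rV[A]_m}),
  [/\ forall y, K y -> exists q, d i q = f y, forall q, K (g (d i q)),
      forall y, K (Phi y) & forall y, K y -> y = g (f y) + Phi y].

(** In y = g (f y) + Phi y, the first term is a combination of the images under g d of the
    generators of P_(i+1), the second one of the values of [Phi] on the unit rows. *)
Lemma comparison_fg i m (K : set 'rV[A]_m) : submodule K -> comparison i K ->
  finitely_generated (res_module P i.+1) ->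
  exists n (e : 'I_n -> 'rV[A]_m), generates e K.
Proof.
move=> sK [f [g [Phi [fK gK PhiK KE]]]] [n [p pgen]].
pose e (k : 'I_(n + m)) := match fintype.split k with
  inl k => g (d i (p k)) | inr j => Phi (delta_mx 0 j) end.
have eK k : K (e k) by rewrite /e; case: (fintype.split k) => j; [apply: gK | apply: PhiK].
exists (n + m)%N, e; split=> // y Ky.
have [q qf] := fK y Ky; have [c qc] := pgen q.
exists (row_mx (\row_k c k) y); rewrite /row_comb big_split_ord /= {1}(KE y Ky); congr (_ + _).
  rewrite -qf qc !linear_sum; apply: eq_bigr => k _.
  by rewrite row_mxEl mxE /e (unsplitK (inl _)) !linearZ.
rewrite linear_row_comb; apply: eq_bigr => k _.
by rewrite row_mxEr /e (unsplitK (inr _)).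
Qed.

(** The usual construction of a homotopy. The map [f'] lifts f e through [d], [g'] lifts g d through
    e by projectivity, and [Psi] lifts [Phi] through e. Then 1 - g' f' - Psi e takes values in the
    kernel of e, and equals 1 - g' f' on that kernel. *)
Lemma comparison_step i m n (K : set 'rV[A]_m) (e : 'I_n -> 'rV[A]_m) :
  submodule K -> generates e K -> comparison i K ->
  comparison i.+1 [set y | row_comb e y = 0].
Proof.
move=> sK [eK egen] [f [g [Phi [fK gK PhiK KE]]]].
have [p pE] := choice (fun j => fK _ (eK j)).
have [w wE] := choice (fun j => egen _ (PhiK (delta_mx 0 j))).
pose f' : {linear 'rV[A]_n -> res_module P i.+1} := row_comb p.
pose Psi : {linear 'rV[A]_m -> 'rV[A]_n} := row_comb w.
have df' y : d i (f' y) = f (row_comb e y).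
  rewrite /f' linear_row_comb_comp linear_row_comb_comp; apply: eq_bigr => j _ /=.
  by rewrite pE.
have dPsi y : row_comb e (Psi y) = Phi y.
  rewrite /Psi linear_row_comb_comp [RHS]linear_row_comb; apply: eq_bigr => j _ /=.
  by rewrite -wE.
have [g' g'E] : exists g' : {linear res_module P i.+1 -> 'rV[A]_n},
    forall q, row_comb e (g' q) = g (d i q).
  apply: (@projective_lift_image _ _ _ (row_comb e) _ (g \o d i)).
    exact: res_projective.
  by move=> q; have [c cE] := egen _ (gK q); exists c.
pose Phi' y := y - g' (f' y) - Psi (row_comb e y).
have Phi'_lin : linear Phi'.
  move=> a u v; rewrite /Phi' (linearP f') (linearP g') row_comb_is_linear.
  by rewrite (linearP Psi) !scalerBr !opprD !addrA [LHS](ACl (1*3*5*2*4*6))%AC.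
pose Phi'' : {linear 'rV[A]_n -> 'rV[A]_n} :=
  HB.pack Phi' (GRing.isLinear.Build _ _ _ _ _ Phi'_lin).
exists f', g', Phi''; split.
- by move=> y /= Ky; apply/res_exact; rewrite df' Ky linear0.
- move=> q /=; rewrite g'E (_ : d i _ = 0) ?linear0 //.
  by apply/res_exact; exists q.
- move=> y /=; rewrite /Phi' !linearB /= g'E dPsi df'.
  have Ky : K (row_comb e y) by apply: submodule_comb.
  by rewrite {1}(KE _ Ky) addrAC addrK subrr.
- by move=> y /= Ky; rewrite /Phi' Ky linear0 subr0 addrC subrK.
Qed.

Lemma comparison_start (eps : A -> Prop) (t : T) :
  (forall u, exists a, u = a *: t) -> (forall a, a *: t = 0 <-> eps a) ->
  comparison 0 [set y : 'rV[A]_1 | eps (y 0 0)].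
Proof.
move=> tgen teps.
have [p pE] := res_aug_surjective P t.
pose tau : {linear 'rV[A]_1 -> T} := row_comb (fun=> t).
have tauE y : tau y = y 0 0 *: t by rewrite /tau /= /row_comb big_ord1.
pose f : {linear 'rV[A]_1 -> res_module P 0} := row_comb (fun=> p).
have [g gE] : exists g : {linear res_module P 0 -> 'rV[A]_1},
    forall q, tau (g q) = res_aug P q.
  apply: projective_lift_image; first exact: res_projective.
  move=> q; have [a aE] := tgen (res_aug P q).
  by exists (const_mx a); rewrite tauE mxE aE.
have fE y : res_aug P (f y) = tau y by rewrite /f linear_row_comb_comp /tau /= /row_comb !big_ord1 /= pE.
pose Phi y := y - g (f y).
have Phi_lin : linear Phi.
  by move=> a u v; rewrite /Phi (linearP f) (linearP g) scalerBr opprD addrACA.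
pose Phi' : {linear 'rV[A]_1 -> 'rV[A]_1} :=
  HB.pack Phi (GRing.isLinear.Build _ _ _ _ _ Phi_lin).
exists f, g, Phi'; split.
- by move=> y /= /teps ty; apply/res_exact0; rewrite fE tauE.
- by move=> q /=; apply/teps; rewrite -tauE gE; apply/res_exact0; exists q.
- by move=> y /=; apply/teps; rewrite -tauE /Phi linearB /= gE fE subrr.
- by move=> y _ /=; rewrite /Phi addrC subrK.
Qed.

(** When P_(i+1) = 0 the map [f] vanishes on [K], so [Phi] is a retraction onto [K]: the syzygy is a
    direct summand of a free module. *)
Lemma comparison_retract i m (K : set 'rV[A]_m) : comparison i K ->
  (forall q : res_module P i.+1, q = 0) ->
  exists Phi : {linear 'rV[A]_m -> 'rV[A]_m},
    (forall y, K (Phi y)) /\ forall y, K y -> Phi y = y.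
Proof.
move=> [f [g [Phi [fK gK PhiK KE]]]] P0; exists Phi; split=> // y Ky.
have [q qf] := fK y Ky; have fy0 : f y = 0 by rewrite -qf (P0 q) linear0.
by rewrite [RHS](KE y Ky) fy0 linear0 add0r.
Qed.

End Comparison.

(** * Graded free modules *)

Section RestrictionOfScalars.
Variables (F : fieldType) (A : algType F) (V : lmodType A).

(** An alias of [V] that carries the scalars of [F], so that dimensions over [F] make sense for
    modules over [A]. *)
Definition restr : Type := V.

HB.instance Definition _ := GRing.Zmodule.on restr.

Definition restr_scale (a : F) (v : restr) : restr := (a%:A : A) *: (v : V).

Fact restr_scaleA a b v : restr_scale a (restr_scale b v) = restr_scale (a * b) v.
Proof. by rewrite /restr_scale scalerA mulr_algl scalerA. Qed.

Fact restr_scale1 : left_id 1 restr_scale.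
Proof. by move=> v; rewrite /restr_scale !scale1r. Qed.

Fact restr_scaleDr : right_distributive restr_scale +%R.
Proof. by move=> a u v; apply: (@scalerDr _ V). Qed.

Fact restr_scaleDl v : {morph restr_scale^~ v : a b / a + b}.
Proof. by move=> a b; rewrite /restr_scale scalerDl; apply: (@scalerDl _ V). Qed.

HB.instance Definition _ := GRing.Zmodule_isLmodule.Build F restr
  restr_scaleA restr_scale1 restr_scaleDr restr_scaleDl.

End RestrictionOfScalars.

(* [c n] is the projection onto the component of degree [n]. *)
Record connected_grading (F : fieldType) (A : algType F) (c : nat -> A -> A)
    (eps : A -> F) : Prop := {
  cg_linear : forall n, linear (c n);
  cg_proj : forall m n u, c m (c n u) = if m == n then c n u else 0;
  cg_mul : forall n u v, c n (u * v) = \sum_(i < n.+1) c i u * c (n - i)%N v;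
  cg_one : c 0%N 1 = 1;
  cg_eps : forall u, c 0%N u = (eps u)%:A;
  cg_sum : forall u, exists N, forall M, (N <= M)%N ->
    c M u = 0 /\ u = \sum_(i < M) c i u
}.

Section GradedRows.
Variables (F : fieldType) (A : algType F) (c : nat -> A -> A) (eps : A -> F).
Hypothesis cg : connected_grading c eps.

Definition homog n : set A := [set u | c n u = u].

(** Component of degree [n] in the graded free module whose j-th basis row has degree [dg j]. The
    test guards against the truncated subtraction. *)
Definition rcomp m (dg : 'I_m -> nat) n (y : 'rV[A]_m) : 'rV[A]_m :=
  \row_j if (dg j <= n)%N then c (n - dg j) (y 0 j) else 0.

Let cgZD n a u v : c n (a *: u + v) = a *: c n u + c n v.
Proof. exact: (cg_linear cg). Qed.

Let cg0 n : c n 0 = 0.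
Proof. by have := cgZD n (-1) 0 0; rewrite scaler0 addr0 scaleN1r addNr. Qed.

Let cgD n u v : c n (u + v) = c n u + c n v.
Proof. by rewrite -[u]scale1r cgZD !scale1r. Qed.

Lemma rcompD m (dg : 'I_m -> nat) n x y :
  rcomp dg n (x + y) = rcomp dg n x + rcomp dg n y.
Proof. by apply/rowP => j; rewrite !mxE; case: ifP => _; rewrite ?cgD ?addr0. Qed.

Lemma rcomp0 m (dg : 'I_m -> nat) n : rcomp dg n 0 = 0.
Proof. by apply/rowP => j; rewrite !mxE cg0 if_same. Qed.

Lemma rcomp_big m (dg : 'I_m -> nat) n (I : Type) (r : seq I) (P : pred I) f :
  rcomp dg n (\sum_(i <- r | P i) f i) = \sum_(i <- r | P i) rcomp dg n (f i).
Proof. exact: (big_morph (rcomp dg n) (rcompD dg n) (rcomp0 dg n)). Qed.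

Lemma rcomp_linear m (dg : 'I_m -> nat) n :
  linear (rcomp dg n : restr 'rV[A]_m -> restr 'rV[A]_m).
Proof.
move=> a x y; apply: etrans (rcompD _ _ _ _) _; congr (_ + _).
apply/rowP => j; rewrite !mxE !mulr_algl; case: ifP => _; last by rewrite scaler0.
by rewrite -[_ *: _]addr0 cgZD cg0 addr0.
Qed.

Lemma rcomp_rcomp m (dg : 'I_m -> nat) k n y :
  rcomp dg k (rcomp dg n y) = if k == n then rcomp dg n y else 0.
Proof.
apply/rowP => j; rewrite !mxE; case: (leqP (dg j) k) => jk; last first.
  case: eqP => [<-|_]; last by rewrite mxE.
  by rewrite mxE leqNgt jk.
case: (leqP (dg j) n) => jn; last first.
  by rewrite cg0; case: eqP => _; rewrite mxE // leqNgt jn.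
rewrite (cg_proj cg) -(eqn_add2r (dg j)) !subnK //.
by case: eqP => _; rewrite mxE // jn.
Qed.

Lemma rcompM m (dg : 'I_m -> nat) n u y :
  rcomp dg n (u *: y) = \sum_(i < n.+1) c i u *: rcomp dg (n - i) y.
Proof.
apply/rowP => j; rewrite mxE summxE.
under eq_bigr do rewrite !mxE.
rewrite mxE; case: leqP => jn; last first.
  rewrite big1 // => -[i /= _] _; rewrite leqNgt (leq_trans _ jn) ?mulr0 //.
  by rewrite ltnS leq_subr.
rewrite (cg_mul cg).
have le : ((n - dg j).+1 <= n.+1)%N by rewrite ltnS leq_subr.
rewrite (big_ord_widen n.+1 (fun i => c i u * c (n - dg j - i)%N (y 0 j)) le).
rewrite big_mkcond; apply: eq_bigr => -[i /= iN] _; rewrite ltnS.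
have -> : (i <= n - dg j)%N = (dg j <= n - i)%N.
  by rewrite leq_subRL // addnC -leq_subRL // -ltnS.
by case: ifP => _; rewrite ?mulr0 // -!subnDA addnC.
Qed.

Lemma rcomp_sum m (dg : 'I_m -> nat) y : exists N, forall M, (N <= M)%N ->
  rcomp dg M y = 0 /\ y = \sum_(i < M) rcomp dg i y.
Proof.
have /choice[N HN] := fun j => cg_sum cg (y 0 j).
exists (\sum_j (N j + dg j))%N => M NM.
have jM j : (N j + dg j <= M)%N by apply: leq_trans NM; rewrite (bigD1 j) //= leq_addr.
have dM j : (dg j <= M)%N by apply: leq_trans (jM j); rewrite leq_addl.
have NM' j : (N j <= M - dg j)%N by rewrite leq_subRL // addnC.
split.
  by apply/rowP => j; rewrite !mxE dM; have [->] := HN j _ (NM' j).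
apply/rowP => j; rewrite summxE; under eq_bigr do rewrite mxE.
have [_ {1}->] := HN j _ (NM' j).
rewrite -(big_mkord xpredT (fun i => if (dg j <= i)%N then c (i - dg j) (y 0 j) else 0)).
rewrite (@big_cat_nat _ _ _ (dg j)) //= [X in X + _](_ : _ = 0) ?add0r; last first.
  by apply: big1_seq => i /=; rewrite mem_index_iota => /andP[_ ij]; rewrite leqNgt ij.
rewrite -[X in \sum_(X <= _ < _) _]add0n big_addn big_mkord; apply: eq_bigr => i _.
by rewrite leq_addl addnK.
Qed.

Definition hrow m (dg : 'I_m -> nat) n : set (restr 'rV[A]_m) :=
  [set y | rcomp dg n y = y].

Lemma hrow_subspace m (dg : 'I_m -> nat) n : Defs.subspace (hrow dg n).
Proof.
split=> [|a x y xn yn]; first exact: rcomp0.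
by rewrite /hrow /= rcomp_linear xn yn.
Qed.

Lemma homog_subspace n : Defs.subspace (homog n).
Proof.
split=> [|a x y xn yn]; first exact: cg0.
by rewrite /homog /= cgZD xn yn.
Qed.

Hypothesis fh : forall n, finite_dim (homog n).

(** Filter by the rows supported on the first k coordinates: coordinate k maps one layer onto a
    component of [A], with the previous layer as kernel. *)
Lemma fdim_hrow m (dg : 'I_m -> nat) n : finite_dim (hrow dg n) /\
  fdim (hrow dg n) = (\sum_j if dg j <= n then fdim (homog (n - dg j)) else 0)%N.
Proof.
pose E k : set (restr 'rV[A]_m) :=
  [set y | hrow dg n y /\ forall j : 'I_m, (k <= j)%N -> y 0 j = 0].
have sE k : Defs.subspace (E k).
  split=> [|a x y [xn x0] [yn y0]].
    by split=> [|j _]; [case: (hrow_subspace dg n) | rewrite mxE].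
  split=> [|j kj]; first by case: (hrow_subspace dg n) => _; apply.
  by rewrite !mxE x0 // y0 // mulr0 addr0.
suff H k : (k <= m)%N -> finite_dim (E k) /\ fdim (E k) =
    (\sum_(j < m | (j < k)%N) if dg j <= n then fdim (homog (n - dg j)) else 0)%N.
  have <- : E m = hrow dg n.
    by apply/seteqP; split=> [y []//|y yn]; split=> // j; rewrite leqNgt ltn_ord.
  have [fE ->] := H m (leqnn _); split=> //.
  by apply: eq_bigl => j; rewrite ltn_ord.
elim: k => [_|k IH km].
  have -> : E 0%N = [set 0].
    apply/seteqP; split=> [y [_ y0]|y ->]; last by case: (sE 0%N).
    by apply/rowP => j; rewrite mxE; apply: y0.
  rewrite fdim0 big1 //; split=> //; exists 0%N; exact: has_dim0.
have [fk dk] := IH (ltnW km).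
pose K := Ordinal km.
pose T (y : restr 'rV[A]_m) : A := (y : 'rV[A]_m) 0 K.
have T_lin : linear T by move=> a x y; rewrite /T !mxE mulr_algl.
have kerE : [set y | E k.+1 y /\ T y = 0] = E k.
  apply/seteqP; split=> [y [[yn y0] Ty]|y [yn y0]] /=.
    split=> // j; rewrite leq_eqVlt => /orP[/eqP kj|/y0//].
    by have -> : j = K by apply: val_inj.
  by split; [split=> // j /ltnW /y0 | apply: (y0 K); rewrite leqnn].
have imE : [set T y | y in E k.+1]
    = if (dg K <= n)%N then homog (n - dg K) else [set 0].
  apply/seteqP; split=> [_ [y [yn y0] <-]|u].
    rewrite /T -yn mxE; case: ifP => // _.
    by rewrite /homog /= (cg_proj cg) eqxx.
  move=> un; have cu : (if (dg K <= n)%N then c (n - dg K) u else 0) = u.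
    by move: un; case: ifP.
  exists (\row_j if j == K then u else 0); last by rewrite /T mxE eqxx.
  split=> [|j kj]; last first.
    by rewrite mxE; case: eqP => // jK; move: kj; rewrite jK /= ltnn.
  apply/rowP => j; rewrite !mxE; case: eqP => [->//|_].
  by rewrite cg0 if_same.
have fi : finite_dim [set T y | y in E k.+1].
  by rewrite imE; case: ifP => // _; exists 0%N; apply: has_dim0.
have fE : finite_dim (E k.+1).
  by apply: (finite_dim_rank_nullity T_lin (sE k.+1)) => //; rewrite kerE.
split=> //; rewrite (fdim_rank_nullity T_lin (sE k.+1) fE) kerE imE dk.
rewrite [RHS](bigD1 K) ?ltnSn //= addnC; congr (_ + _)%N.
  by case: ifP => _; rewrite ?fdim0.
by apply: eq_bigl => j; rewrite ltnS (ltn_neqAle j k) andbC.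
Qed.

End GradedRows.

Section GradedSubmodules.
Variables (F : fieldType) (A : algType F) (c : nat -> A -> A) (eps : A -> F).
Hypothesis cg : connected_grading c eps.
Local Notation rcomp := (rcomp c).
Local Notation homog := (homog c).
Local Notation hrow := (hrow c).

Definition graded_submodule m (dg : 'I_m -> nat) (K : set 'rV[A]_m) : Prop :=
  submodule K /\ forall n y, K y -> K (rcomp dg n y).

Definition homog_generates m (dg : 'I_m -> nat) n (dg' : 'I_n -> nat)
    (e : 'I_n -> 'rV[A]_m) (K : set 'rV[A]_m) : Prop :=
  generates e K /\ forall k, rcomp dg (dg' k) (e k) = e k.

(** The homogeneous components of the generators are finite in number, lie in the graded [K] and
    generate it. *)
Lemma homog_generators m (dg : 'I_m -> nat) n (e : 'I_n -> 'rV[A]_m) K :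
  graded_submodule dg K -> generates e K ->
  exists n' (dg' : 'I_n' -> nat) e', homog_generates dg dg' e' K.
Proof.
move=> [sK gK] [eK egen].
have /choice[N HN] := fun j => rcomp_sum cg dg (e j).
pose B := (\sum_j N j)%N.
have NB j : (N j <= B)%N by rewrite /B (bigD1 j) //= leq_addr.
pose I := ('I_n * 'I_B)%type.
pose v (k : 'I_#|{: I}|) : I := enum_val k.
exists #|{: I}|, (fun k => nat_of_ord (v k).2), (fun k => rcomp dg (v k).2 (e (v k).1)).
split; last by move=> k; rewrite (rcomp_rcomp cg) eqxx.
split=> [k|y Ky]; first exact/gK/eK.
have [z ->] := egen y Ky; exists (\row_k z 0 (v k).1).
rewrite /row_comb.
transitivity (\sum_(p : I) z 0 p.1 *: rcomp dg p.2 (e p.1)).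
  rewrite -(pair_big xpredT xpredT (fun j (i : 'I_B) => z 0 j *: rcomp dg i (e j))) /=.
  apply: eq_bigr => j _; have [_ {1}->] := HN j B (NB j).
  by rewrite scaler_sumr.
rewrite (reindex v) /=; last exact/onW_bij/enum_val_bij.
by apply: eq_bigr => k _; rewrite mxE.
Qed.

Section HomogeneousMap.
Variables (m : nat) (dg : 'I_m -> nat) (n : nat) (dg' : 'I_n -> nat).
Variable e : 'I_n -> 'rV[A]_m.
Hypothesis e_homog : forall k, rcomp dg (dg' k) (e k) = e k.

Lemma rcomp_row_comb l y : rcomp dg l (row_comb e y) = row_comb e (rcomp dg' l y).
Proof.
rewrite /row_comb (rcomp_big cg); apply: eq_bigr => j _.
rewrite (rcompM cg) mxE.
have eE k : rcomp dg k (e j) = if k == dg' j then e j else 0.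
  by rewrite -{1}e_homog (rcomp_rcomp cg) e_homog.
case: leqP => jl; last first.
  rewrite scale0r big1 // => -[i il] _ /=; rewrite eE ltn_eqF ?scaler0 //.
  by rewrite (leq_ltn_trans _ jl) ?leq_subr.
have lj : (l - dg' j < l.+1)%N by rewrite ltnS leq_subr.
rewrite (bigD1 (Ordinal lj)) //= eE subKn // eqxx big1 ?addr0 // => -[i il] /= ij.
rewrite eE ifN ?scaler0 //; apply: contra (ij : i != (l - dg' j)%N) => /eqP <-.
by rewrite subKn.
Qed.

Lemma kernel_graded : graded_submodule dg' [set y | row_comb e y = 0].
Proof.
split=> [|l y /= y0]; last by rewrite -rcomp_row_comb y0 (rcomp0 cg).
split=> [|a x y /= x0 y0]; first by rewrite /= linear0.
by rewrite row_comb_is_linear x0 y0 scaler0 addr0.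
Qed.

End HomogeneousMap.

Definition hsub m (dg : 'I_m -> nat) (K : set 'rV[A]_m) l : set (restr 'rV[A]_m) :=
  [set y | hrow dg l y /\ K y].

Lemma hsub_subspace m (dg : 'I_m -> nat) (K : set 'rV[A]_m) l :
  submodule K -> Defs.subspace (hsub dg K l).
Proof.
move=> [K0 KD]; have [h0 hD] := hrow_subspace cg dg l.
split=> [//|a x y [xl Kx] [yl Ky]]; split; first exact: hD.
exact: (KD a%:A x y).
Qed.

Lemma eps_eq0 u : eps u = 0 <-> c 0%N u = 0.
Proof.
rewrite (cg_eps cg); split=> [->|/eqP]; first by rewrite scale0r.
by rewrite scaler_eq0 oner_eq0 orbF => /eqP.
Qed.

Lemma homog0E u : homog 0 u -> u = (eps u)%:A.
Proof. by move=> u0; rewrite -(cg_eps cg) u0. Qed.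

Lemma homog_eps n u : (0 < n)%N -> homog n u -> eps u = 0.
Proof.
by move=> n0 un; apply/eps_eq0; rewrite -un (cg_proj cg) eq_sym gtn_eqF.
Qed.

Definition aug_ideal : set 'rV[A]_1 := [set y | eps (y 0 0) = 0].

Lemma aug_ideal_graded : graded_submodule (fun=> 0%N) aug_ideal.
Proof.
have c0D a u v : c 0%N (a * u + v) = c 0%N a * c 0%N u + c 0%N v.
  rewrite -[a * u]scale1r (cg_linear cg) scale1r (cg_mul cg) big_ord1.
  by rewrite subn0.
split=> [|l y /eps_eq0 y0]; last first.
  apply/eps_eq0; rewrite mxE leq0n subn0 (cg_proj cg); case: eqP => // <-.
  by rewrite y0.
split=> [|a x y /eps_eq0 x0 /eps_eq0 y0]; apply/eps_eq0; rewrite !mxE.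
  by have := cg_linear cg 0%N (-1) 0 0; rewrite scaler0 addr0 scaleN1r addNr.
by rewrite c0D x0 y0 mulr0 addr0.
Qed.

(** By strong induction: in positive degree l, the component of [A] is the sum of the products of
    the components of degree l - dg j with [e j]. *)
Lemma finite_dim_homog n (e : 'I_n -> 'rV[A]_1) (dg : 'I_n -> nat) :
  homog_generates (fun=> 0%N) dg e aug_ideal -> forall l, finite_dim (homog l).
Proof.
move=> [[eK egen] eh]; elim/ltn_ind => -[|l] IH.
  apply: (finite_dim_spanned (f := fun _ : 'I_1 => 1)); first exact: (homog_subspace cg).
  by move=> u /homog0E ->; exists (fun=> eps u); rewrite big_ord1.
have ehomog j : homog (dg j) (e j 0 0).
  by have /rowP/(_ 0) := eh j; rewrite mxE leq0n subn0.
(* A generator of degree 0 would leave the degree unchanged, but in the augmentation ideal it is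
   zero. *)
have e0 j : dg j = 0%N -> e j 0 0 = 0.
  move=> dj; have := ehomog j; rewrite dj => /homog0E ->.
  by rewrite (eK j) scale0r.
(* The condition sits inside the existential, so that a family can be chosen for every [j], empty by
   default. *)
have fj j : exists nb : {n & 'I_n -> A}, (0 < dg j <= l.+1)%N ->
    forall u, homog (l.+1 - dg j) u -> spanned_by (tagged nb) u.
  case: (boolP (0 < dg j <= l.+1)%N) => [/andP[dj jl]|_]; last first.
    by exists (Tagged (fun n => 'I_n -> A) (fun _ : 'I_0 => 0)).
  have [|k [b [_ sb _]]] := IH (l.+1 - dg j)%N; first by rewrite ltn_subrL dj.
  by exists (Tagged (fun n => 'I_n -> A) b).
have /choice[nb nbE] := fj.
pose I := {j : 'I_n & 'I_(tag (nb j))}.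
pose f (p : I) := tagged (nb (tag p)) (tagged p) * e (tag p) 0 0.
apply: (finite_dim_spanned (f := f)); first exact: (homog_subspace cg).
move=> u uh.
have [|z zE] := egen (\row__ u); first by rewrite /aug_ideal /= mxE; apply: (homog_eps (ltn0Sn l)).
have uE : u = \sum_j if (dg j <= l.+1)%N then c (l.+1 - dg j) (z 0 j) * e j 0 0 else 0.
  have : rcomp (fun=> 0%N) l.+1 (\row__ u : 'rV_1) = \row__ u.
    by apply/rowP => k; rewrite !mxE leq0n subn0.
  rewrite {1}zE (rcomp_row_comb eh) => /rowP/(_ 0); rewrite mxE => <-.
  rewrite /row_comb summxE; apply: eq_bigr => j _; rewrite !mxE.
  by case: ifP => _; rewrite ?mul0r.
have aex j : exists a : 'I_(tag (nb j)) -> F,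
    (if (dg j <= l.+1)%N then c (l.+1 - dg j) (z 0 j) * e j 0 0 else 0)
    = \sum_i a i *: (tagged (nb j) i * e j 0 0).
  have [dj|dj] := posnP (dg j).
    by exists (fun=> 0); rewrite e0 // mulr0 if_same big1 // => i _; rewrite scale0r.
  case: leqP => jl; last by exists (fun=> 0); rewrite big1 // => i _; rewrite scale0r.
  have [||a ->] := nbE j _ (c (l.+1 - dg j) (z 0 j)); first by rewrite dj.
    by rewrite /homog /= (cg_proj cg) eqxx.
  by exists a; rewrite mulr_suml; apply: eq_bigr => i _; rewrite scalerAl.
pose a j := projT1 (cid (aex j)); have aE j := projT2 (cid (aex j)).
exists (fun p => a (tag p) (tagged p)); rewrite uE.
under eq_bigr do rewrite aE.
by rewrite sig_big_dep.
Qed.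

Hypothesis fh : forall n, finite_dim (homog n).

Lemma fdim_hrow_kernel m (dg : 'I_m -> nat) n (dg' : 'I_n -> nat) e K l :
  submodule K -> homog_generates dg dg' e K ->
  fdim (hrow dg' l)
    = (fdim (hsub dg' [set y | row_comb e y = 0%R] l) + fdim (hsub dg K l))%N.
Proof.
move=> sK [[eK egen] eh].
pose T (y : restr 'rV[A]_n) : restr 'rV[A]_m := row_comb e y.
have T_lin : linear T.
  by move=> a x y; apply: (row_comb_is_linear e (a%:A) x y).
have sh := hrow_subspace cg dg' l.
rewrite (fdim_rank_nullity T_lin sh (fdim_hrow cg fh dg' l).1); congr (_ + fdim _)%N.
apply/seteqP; split=> [_ [y yl <-]|y [yl Ky]] /=.
  split; last exact: submodule_comb.
  by rewrite /hrow /= (rcomp_row_comb eh) yl.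
have [z yz] := egen y Ky; exists (rcomp dg' l z).
  by rewrite /hrow /= (rcomp_rcomp cg) eqxx.
by rewrite /T -(rcomp_row_comb eh) -yz yl.
Qed.

Lemma fdim_aug_ideal l :
  fdim (homog l) = ((l == 0%N) + fdim (hsub (fun=> 0%N) aug_ideal l))%N.
Proof.
case: l => [|l].
  have -> : homog 0 = [set u | exists a : F, u = a *: 1].
    apply/seteqP; split=> [u /homog0E uE|_ [a ->]]; first by exists (eps u).
    apply: (subspaceZ _ (homog_subspace cg 0)).
    exact: (cg_one cg).
  have -> : hsub (fun=> 0%N) aug_ideal 0 = [set 0].
    apply/seteqP; split=> [y [y0 Ky]|y ->]; last first.
      by case: (hsub_subspace (fun=> 0%N) 0 aug_ideal_graded.1).
    apply/rowP => k; rewrite ord1 mxE.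
    have /rowP/(_ 0) := y0; rewrite mxE leq0n subn0 => /homog0E ->.
    by rewrite (Ky : eps _ = 0) scale0r.
  by rewrite fdim0 (fdim_eq (has_dim1 (oner_neq0 A))).
have -> : hsub (fun=> 0%N) aug_ideal l.+1 = hrow (fun _ : 'I_1 => 0%N) l.+1.
  apply/seteqP; split=> [y []//|y yl]; split=> //.
  have /rowP/(_ 0) := yl; rewrite mxE leq0n subn0 => yh.
  exact: (homog_eps (ltn0Sn l)).
have [_ ->] := fdim_hrow cg fh (fun _ : 'I_1 => 0%N) l.+1.
by rewrite big_ord1.
Qed.
End GradedSubmodules.

(** * The Euler characteristic of a graded free resolution *)

Section ResolutionSeries.
Variables (F : fieldType) (A : algType F) (c : nat -> A -> A) (eps : A -> F).
Hypothesis cg : connected_grading c eps.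
Local Notation rcomp := (rcomp c).
Local Notation homog := (homog c).
Local Notation hrow := (hrow c).
Local Notation hsub := (hsub c).
Local Notation graded_submodule := (graded_submodule c).
Local Notation homog_generates := (homog_generates c).

(* A minimal homogeneous generating family has its relations in the
   augmentation ideal; since [K] is a direct summand of a free module, a graded
   Nakayama argument shows that there are none. *)
Lemma free_generators m (dg : 'I_m -> nat) n (dg' : 'I_n -> nat) e K
    (Phi : {linear 'rV[A]_m -> 'rV[A]_m}) :
  graded_submodule dg K -> homog_generates dg dg' e K ->
  (forall y, K (Phi y)) -> (forall y, K y -> Phi y = y) ->
  exists n' (dg' : 'I_n' -> nat) e', homog_generates dg dg' e' K /\
    forall y, row_comb e' y = 0 -> y = 0.
Proof.
move=> [sK gK] he PhiK PhiE.
pose Q n := `[< exists (dg' : 'I_n -> nat) e', homog_generates dg dg' e' K >].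
have exQ : exists n, Q n by exists n; apply/asboolP; exists dg', e.
have {n dg' e he exQ} [n /asboolP[dg' [e he]] nmin] := ex_minnP exQ.
exists n, dg', e; split=> //; have [[eK egen] eh] := he.
(* A relation whose j-th coefficient has nonzero constant term would express [e j] by the other
   generators, against minimality. *)
have minimal y j : row_comb e y = 0 -> c 0%N (y 0 j) = 0.
  move=> y0; apply/eqP/negPn/negP => yj.
  case: n dg' e he nmin eK egen eh y j y0 yj => [|n] dg' e he nmin eK egen eh y j y0 yj.
    by case: j {yj}.
  have a0 : eps (y 0 j) != 0.
    by apply: contra yj => /eqP /(eps_eq0 cg) ->.
  (* In the component of degree [dg' j] of the relation, the j-th coefficient is a nonzero scalar,
     hence invertible. *)
  pose z := rcomp dg' (dg' j) y.
  have z0 : row_comb e z = 0.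
    by rewrite /z -(rcomp_row_comb cg eh) y0 (rcomp0 cg).
  have zj : z 0 j = (eps (y 0 j))%:A by rewrite mxE leqnn subnn (cg_eps cg).
  have ej : e j = row_comb (e \o lift j)
      (\row_k (- (eps (y 0 j))^-1 *: z 0 (lift j k))).
    have z0' : (eps (y 0 j))%:A *: e j + \sum_k z 0 (lift j k) *: e (lift j k) = 0.
      by rewrite -zj -[RHS]z0 /row_comb (bigD1_ord j).
    rewrite /row_comb; under eq_bigr do rewrite mxE -mulr_algl -scalerA.
    rewrite -scaler_sumr.
    have -> : \sum_k z 0 (lift j k) *: e (lift j k) = - ((eps (y 0 j))%:A *: e j).
      by apply/eqP; rewrite -addr_eq0 addrC z0'.
    rewrite scalerN scalerA mulr_algl scalerA mulNr mulVf // scaleN1r scaleN1r.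
    by rewrite opprK.
  suff /nmin : Q n by rewrite ltnn.
  apply/asboolP; exists (dg' \o lift j), (e \o lift j); split; last by move=> k; apply: eh.
  split=> [k|x Kx]; first exact: eK.
  have [d ->] := egen x Kx.
  exists (\row_k d 0 (lift j k)
    + d 0 j *: (\row_k (- (eps (y 0 j))^-1 *: z 0 (lift j k)))).
  rewrite linearD linearZ /= -ej addrC {1}/row_comb (bigD1_ord j) //=; congr (_ + _).
  by rewrite /row_comb; apply: eq_bigr => k _; rewrite mxE.
have /choice[a aE] := fun j => egen _ (PhiK (delta_mx 0 j)).
pose s : {linear 'rV[A]_m -> 'rV[A]_n} := row_comb a.
have ds x : row_comb e (s x) = Phi x.
  rewrite /s linear_row_comb_comp [RHS]linear_row_comb; apply: eq_bigr => j _ /=.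
  by rewrite -aE.
(* Since [Phi] fixes [K], the map [s] splits the generating map over [K], and [E] projects onto the
   relations. *)
pose E y := y - s (row_comb e y).
have EN y : row_comb e (E y) = 0.
  by rewrite /E linearB /= ds PhiE ?subrr //; apply: submodule_comb.
have E_lin : linear E.
  move=> b u v; rewrite /E row_comb_is_linear (linearP s) scalerBr opprD.
  by rewrite addrACA.
pose E' : {linear 'rV[A]_n -> 'rV[A]_n} := HB.pack E
  (GRing.isLinear.Build _ _ _ _ _ E_lin).
(* A relation z is the combination of the relations E (delta_j) with coefficients z_j. As z_j has no
   part of degree 0, degree [l] of z involves only lower degrees of relations, which vanish by
   induction. *)
have Nl l : forall y, row_comb e y = 0 -> rcomp dg' l y = 0.
  elim/ltn_ind: l => l IH y y0.
  pose z := rcomp dg' l y.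
  have z0 : row_comb e z = 0 by rewrite /z -(rcomp_row_comb cg eh) y0 (rcomp0 cg).
  have zE : z = \sum_j z 0 j *: E (delta_mx 0 j).
    have -> : z = E' z by rewrite /= /E z0 linear0 subr0.
    by rewrite {1}linear_row_comb /= /E z0 linear0 subr0.
  have -> : rcomp dg' l y = rcomp dg' l z by rewrite /z (rcomp_rcomp cg) eqxx.
  rewrite zE (rcomp_big cg) big1 // => j _; rewrite (rcompM cg) big1 // => -[[|i] il] _ /=.
    by rewrite minimal // scale0r.
  by rewrite IH ?scaler0 // ltn_subrL /=; apply: (leq_ltn_trans (leq0n i) il).
move=> y y0; have [N /(_ N (leqnn _)) [_ ->]] := rcomp_sum cg dg' y.
by rewrite big1 // => l _; apply: Nl.
Qed.

(** Coefficient of degree [n] in the product of [chi] with the Hilbert series of [A]. *)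
Definition hconv (chi : {poly int}) n : int :=
  \sum_(k < n.+1) chi`_k * (fdim (homog (n - k)))%:Z.

Lemma hconvD p q n : hconv (p + q) n = hconv p n + hconv q n.
Proof. by rewrite /hconv -big_split; apply: eq_bigr => k _; rewrite coefD mulrDl. Qed.

Lemma hconvZ a p n : hconv (a *: p) n = a * hconv p n.
Proof. by rewrite /hconv mulr_sumr; apply: eq_bigr => k _; rewrite coefZ mulrA. Qed.

Lemma hconv0 n : hconv 0 n = 0.
Proof. by rewrite /hconv big1 // => k _; rewrite coef0 mul0r. Qed.

Lemma hconvXn d n : hconv 'X^d n = if (d <= n)%N then (fdim (homog (n - d)))%:Z else 0.
Proof.
rewrite /hconv; case: leqP => dn.
  rewrite (bigD1 (Ordinal (dn : (d < n.+1)%N))) //= coefXn eqxx mul1r.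
  by rewrite big1 ?addr0 // => k kd; rewrite coefXn (negPf (kd : k != d :> nat)) mul0r.
by rewrite big1 // => k _; rewrite coefXn ltn_eqF ?mul0r // (leq_trans _ dn).
Qed.

Variables (T : lmodType A) (t : T).
Hypothesis tgen : forall u, exists a, u = a *: t.
Hypothesis teps : forall a, a *: t = 0 <-> eps a = 0.

Variables (P Q : projective_resolution T) (N : nat).
Hypothesis Pfg : forall k, finitely_generated (res_module P k).
Hypothesis Q0 : forall k, (N <= k)%N -> forall p : res_module Q k, p = 0.

(** Finite generation of P_1 makes the augmentation ideal finitely generated. *)
Lemma resolution_finite_dim n : finite_dim (homog n).
Proof.
have cK : comparison P 0 (aug_ideal eps) by apply: comparison_start tgen teps.
have gK := aug_ideal_graded cg.
have [k [e eK]] := comparison_fg gK.1 cK (Pfg 1%N).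
have [k' [dg [e' he]]] := homog_generators cg gK eK.
exact: (finite_dim_homog cg he).
Qed.

Let fh := resolution_finite_dim.

(** Each new free module enters [chi] with alternating sign, and the syzygy [K] is the error term.
    Both comparisons are carried along: [P] keeps the next step finite, [Q] will end the process. *)
Lemma partial_resolution i : exists m (dg : 'I_m -> nat) K (chi : {poly int}),
  [/\ graded_submodule dg K, comparison P i K, comparison Q i K
    & forall n, hconv chi n = (n == 0%N)%:Z
        + (-1) ^+ i * (fdim (hsub dg K n))%:Z].
Proof.
elim: i => [|i [m [dg [K [chi [gK cP cQ hK]]]]]].
  exists 1%N, (fun=> 0%N), (aug_ideal eps), 1; split.
  - exact: aug_ideal_graded.
  - exact: comparison_start tgen teps.
  - exact: comparison_start tgen teps.
  - move=> n; rewrite -(expr0 'X) hconvXn leq0n subn0 (fdim_aug_ideal cg fh).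
    by rewrite expr0 mul1r PoszD.
have [k [e eK]] := comparison_fg gK.1 cP (Pfg i.+1).
have [n [dg' [e' he]]] := homog_generators cg gK eK.
have [[e'K e'gen] e'h] := he.
exists n, dg', [set y | row_comb e' y = 0], (chi - (-1) ^+ i *: \sum_j 'X^(dg' j)); split.
- exact: (kernel_graded cg e'h).
- exact: (comparison_step gK.1).
- exact: (comparison_step gK.1).
move=> l; rewrite -scaleNr hconvD hconvZ hK.
have -> : hconv (\sum_j 'X^(dg' j)) l = (fdim (hrow dg' l))%:Z.
  have [_ ->] := fdim_hrow cg fh dg' l; rewrite (big_morph (hconv^~ l) (fun p q => hconvD p q l) (hconv0 l)).
  rewrite (big_morph Posz PoszD (erefl _)); apply: eq_bigr => j _.
  by rewrite hconvXn; case: ifP.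
by rewrite (fdim_hrow_kernel cg fh l gK.1 he) PoszD exprS; ring.
Qed.

(** At step [N], vanishing of [Q] makes the syzygy a direct summand of a free module, hence free on
    homogeneous generators. Adding these to [chi] leaves no error term. *)
Lemma resolution_series : exists chi : {poly int},
  forall n, hconv chi n = (n == 0%N)%:Z.
Proof.
have [m [dg [K [chi [gK cP cQ hK]]]]] := partial_resolution N.
have [Phi [PhiK PhiE]] := comparison_retract cQ (Q0 (leqnSn N)).
have [k [e eK]] := comparison_fg gK.1 cP (Pfg N.+1).
have [n [dg' [e' he]]] := homog_generators cg gK eK.
have [n' [dg'' [e'' [he'' free]]]] := free_generators gK he PhiK PhiE.
exists (chi - (-1) ^+ N *: \sum_j 'X^(dg'' j)) => l.
rewrite -scaleNr hconvD hconvZ hK.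
have -> : hconv (\sum_j 'X^(dg'' j)) l = (fdim (hrow dg'' l))%:Z.
  have [_ ->] := fdim_hrow cg fh dg'' l; rewrite (big_morph (hconv^~ l) (fun p q => hconvD p q l) (hconv0 l)).
  rewrite (big_morph Posz PoszD (erefl _)); apply: eq_bigr => j _.
  by rewrite hconvXn; case: ifP.
rewrite (fdim_hrow_kernel cg fh l gK.1 he'').
have -> : hsub dg'' [set y | row_comb e'' y = 0] l = [set 0].
  apply/seteqP; split=> [y [_ /free]//|y ->].
  by case: (hsub_subspace cg dg'' l (kernel_graded cg he''.2).1).
by rewrite fdim0 add0n mulNr addrK.
Qed.

End ResolutionSeries.

(** * The Hilbert series *)

Section Span.
Variables (F : fieldType) (V : lmodType F) (I : finType) (f : I -> V).

Lemma spanned_subspace : Defs.subspace (spanned_by f).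
Proof.
split=> [|a _ _ [c ->] [d ->]].
  by exists (fun=> 0); rewrite big1 // => i _; rewrite scale0r.
exists (fun i => a * c i + d i); rewrite scaler_sumr -big_split.
by apply: eq_bigr => i _; rewrite scalerDl scalerA.
Qed.

Lemma spanned_gen i : spanned_by f (f i).
Proof.
exists (fun j => (j == i)%:R); rewrite (bigD1 i) //= eqxx scale1r big1 ?addr0 //.
by move=> j /negPf ->; rewrite scale0r.
Qed.

End Span.

(** * Finite dimension of the homogeneous components *)

Section FiniteType.
Variables (F : fieldType) (L : lieAlgType F) (Lg : nat -> set L).
Hypothesis gr : is_grading Lg.

Lemma lcompZD n a x y : lcomp gr (a *: x + y) n = a *: lcomp gr x n + lcomp gr y n.
Proof. exact: lcomp_linear. Qed.

Lemma lcomp_lie n x y :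
  lcomp gr (lie x y) n = \sum_(a < n.+1) lie (lcomp gr x a) (lcomp gr y (n - a)).
Proof.
elim/(grading_ind gr): x => [a x x' E E'|k x k0 xk].
  rewrite lieDl lieZl lcompZD E E' scaler_sumr -big_split; apply: eq_bigr => i _.
  by rewrite lcompZD lieDl lieZl.
elim/(grading_ind gr): y => [a y y' E E'|l y l0 yl].
  rewrite lieDr lieZr lcompZD E E' scaler_sumr -big_split; apply: eq_bigr => i _.
  by rewrite lcompZD lieDr lieZr.
rewrite (lcomp_homog gr n (k := (k + l)%N)) ?addn_gt0 ?k0 //; last exact: (grading_lie gr).
have [kn|nk] := leqP k n; last first.
  rewrite big1 => [|[i /= iN] _]; first by rewrite ltn_eqF // ltn_addr.
  by rewrite (lcomp_homog gr i k0 xk) ltn_eqF ?lie0l // (leq_trans _ nk).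
rewrite (bigD1 (Ordinal (kn : (k < n.+1)%N))) //= big1 ?addr0 => [|i ik]; last first.
  by rewrite (lcomp_homog gr i k0 xk) (negPf (ik : i != k :> nat)) lie0l.
rewrite (lcomp_homog gr k k0 xk) eqxx (lcomp_homog gr (n - k) l0 yl).
rewrite -(eqn_add2r k (n - k)) subnK // addnC.
by case: eqP => // _; rewrite lie0r.
Qed.

(** Let [y] send (w, s) to (s y_1, 0), where y_1 is its component of degree 1. This is a
    representation, as composites vanish and brackets have no component of degree 1; [x] sends (0,
    1) to (x, 0). *)
Lemma env_iota_inj1 x : Lg 1%N x -> env_iota x = 0 -> x = 0.
Proof.
move=> x1 ix0.
pose f y (v : L * F^o) : L * F^o := ((v.2 : F) *: lcomp gr y 1, 0).
have f_lin y : linear (f y).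
  move=> a u v; congr (_, _) => /=; first by rewrite scalerDl scalerA.
  by change (0 = a *: (0 : F^o) + 0); rewrite scaler0 addr0.
have f_linl v : linear (f^~ v).
  move=> a u w; congr (_, _) => /=.
    by rewrite lcompZD scalerDr !scalerA mulrC.
  by change (0 = a *: (0 : F^o) + 0); rewrite scaler0 addr0.
have f_lie y z v : f (lie y z) v = f y (f z v) - f z (f y v).
  congr (_, _) => /=; last by rewrite subrr.
  rewrite lcomp_lie !big_ord_recl big_ord0 /= !lcomp0 lie0l lie0r !addr0.
  by rewrite !scale0r subrr scaler0.
have [act [_ act_linl _ _ actE]] := envelope_action f_lin f_linl f_lie.
have := actE x (0, 1); rewrite ix0.
have -> : act 0 (0, 1) = 0.
  by have := act_linl (0, 1) (-1) 0 0; rewrite scaler0 addr0 scaleN1r addNr.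
move=> /(congr1 fst) /=; rewrite scale1r (lcomp_homog gr 1 (ltn0Sn 0) x1) eqxx.
by move=> <-.
Qed.

Hypothesis gen1 : generated_in_degree1 Lg.
Hypothesis fU : forall n, finite_dim (egrade gr n).

(** Degree 1 embeds into the envelope. Each higher degree is spanned by brackets of basis elements
    of lower degrees, by generation in degree 1. *)
Lemma finite_dim_grade n : (0 < n)%N -> finite_dim (Lg n).
Proof.
elim/ltn_ind: n => -[|[|n]] // IH _.
  have s1 := grading_subspace gr (ltn0Sn 0).
  have i_lin : linear (@env_iota _ L) by apply: env_iota_is_linear.
  have fI : finite_dim [set env_iota x | x in Lg 1%N].
    apply: (finite_dim_sub (subspace_image i_lin s1)) (fU 1%N) => _ [x x1 <-].
    exact: egrade_iota.
  by have [] := fdim_inj i_lin s1 fI (erefl _) env_iota_inj1.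
have eb a : exists b : {k & 'I_k -> L}, (0 < a < n.+2)%N ->
    forall x, Lg a x -> spanned_by (tagged b) x.
  case: (boolP (0 < a < n.+2)%N) => [/andP[a0 an]|_].
    have [k [e [_ se _]]] := IH a an a0.
    by exists (Tagged (fun k => 'I_k -> L) e).
  by exists (Tagged (fun k => 'I_k -> L) (fun _ : 'I_0 => 0)).
pose b a := projT1 (cid (eb a)).
have bE a : (0 < a < n.+2)%N -> forall x, Lg a x -> spanned_by (tagged (b a)) x.
  exact: (projT2 (cid (eb a))).
pose I := {a : 'I_n.+2 & ('I_(tag (b a)) * 'I_(tag (b (n.+2 - a)%N)))%type}.
pose f (p : I) := lie (tagged (b (tag p)) (tagged p).1)
  (tagged (b (n.+2 - tag p)%N) (tagged p).2).
have sf := spanned_subspace f.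
apply: (finite_dim_spanned (f := f)); first exact: (grading_subspace gr).
move=> x xn.
(* By [gen1], [x] is then a combination of brackets of arbitrary elements; its component of degree n
   + 2 only involves brackets of homogeneous components. *)
have : coprod_from Lg 2 x.
  exists n.+3, (fun k => if k == n.+2 then x else 0); split.
    by move=> k k2; case: eqP => [->//|_]; apply: (grading0 gr); apply: leq_trans k2.
  rewrite big_nat_recr //= eqxx big_nat_cond big1 ?add0r // => k.
  by rewrite andbT => /andP[_ kn]; rewrite ltn_eqF.
rewrite -gen1 => -[r [cf [y [z [_ _ xE]]]]].
have -> : x = \sum_i cf i *: lcomp gr (lie (y i) (z i)) n.+2.
  have <- : lcomp gr x n.+2 = x by rewrite (lcomp_homog gr _ _ xn) ?eqxx.
  rewrite {1}xE; elim/big_rec2: _ => [|i u v _ <-]; first exact: lcomp_linear0.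
  by rewrite lcompZD.
apply: subspace_sum => // i _; apply: subspaceZ => //.
rewrite lcomp_lie; apply: subspace_sum => // -[a /= an] _.
have [->|a0] := posnP a; first by rewrite lcomp0 lie0l; case: sf.
have [a2|a2] := leqP n.+2 a.
  have -> : (n.+2 - a = 0)%N by apply/eqP; rewrite subn_eq0.
  by rewrite lcomp0 lie0r; case: sf.
have na0 : (0 < n.+2 - a)%N by rewrite subn_gt0.
have [||c1 ->] := bE a _ (lcomp gr (y i) a); [by rewrite a0|exact: lcomp_mem|].
have [||c2 ->] := bE (n.+2 - a)%N _ (lcomp gr (z i) (n.+2 - a)%N).
- by rewrite na0 /= ltn_subrL a0.
- exact: lcomp_mem.
rewrite (big_morph (fun u => lie u _) (fun u v => lieDl u v _) (lie0l _)).
apply: subspace_sum => // j _; rewrite lieZl; apply: subspaceZ => //.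
rewrite (big_morph (lie _) (fun u v => lieDr u v _) (lie0r _)).
apply: subspace_sum => // k _; rewrite lieZr; apply: subspaceZ => //.
exact: (spanned_gen f (Tagged (fun a : 'I_n.+2 =>
  ('I_(tag (b a)) * 'I_(tag (b (n.+2 - a)%N)))%type) (i := Ordinal a2) (j, k))).
Qed.

End FiniteType.

Section HilbertSeries.
Variables (F : fieldType) (L : lieAlgType F) (Lg : nat -> set L).
Hypotheses (gr : is_grading Lg) (gen1 : generated_in_degree1 Lg) (fp : type_FP L).

Lemma envelope_connected : connected_grading (ecomp gr) (@env_aug F L).
Proof.
split.
- exact: ecomp_is_linear.
- by move=> m n u; apply: ecomp_ecomp.
- by move=> n u v; apply: ecompM.
- by rewrite ecomp1.
- exact: ecomp0.
- exact: ecomp_sum.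
Qed.

Lemma hilbert_series :
  (forall k, (0 < k)%N -> finite_dim (Lg k)) /\
  exists chi : {poly int}, forall N n, (n <= N)%N ->
    chi`_n = (\prod_(1 <= k < N.+1) (1 - 'X^k) ^+ fdim (Lg k))`_n.
Proof.
have [[P Pfg] [Q [M Q0]]] := fp.
have cg := envelope_connected.
pose t : trivial_module L := (1 : F).
have tE (a : envelope L) : a *: t = env_aug a :> F by rewrite trivial_moduleE mulr1.
have tgen (u : trivial_module L) : exists a : envelope L, u = a *: t.
  by exists ((u : F)%:A); rewrite [RHS]tE env_augZ (rmorph1 (@env_aug F L)) mulr1.
have teps (a : envelope L) : a *: t = 0 <-> env_aug a = 0 by rewrite -tE.
have fU : forall n, finite_dim (egrade gr n).
  by move=> n; apply: (resolution_finite_dim cg tgen teps Pfg).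
have fL k : (0 < k)%N -> finite_dim (Lg k) by apply: (finite_dim_grade gen1 fU).
split=> //; have [chi chiE] := resolution_series cg tgen teps Pfg Q0.
exists chi => N n nN.
pose h : {poly int} := \poly_(i < N.+1) (fdim (egrade gr i))%:Z.
have chih k : (k <= N)%N -> (chi * h)`_k = (1 : {poly int})`_k.
  move=> kN; rewrite coef1 coefM; apply: etrans (_ : hconv (ecomp gr) chi k = _).
    apply: eq_bigr => i _; rewrite coef_poly ltnS (leq_trans (leq_subr _ _) kN).
    by [].
  by rewrite chiE; case: k {kN}.
have pbw k : (k <= N)%N ->
    (h * \prod_(1 <= k < N.+1) (1 - 'X^k) ^+ fdim (Lg k))`_k = (1 : {poly int})`_k.
  by move=> kN; rewrite (pbw_series fU fL kN) coef1; case: k {kN}.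
have := eq_coefMl (\prod_(1 <= k < N.+1) (1 - 'X^k) ^+ fdim (Lg k)) chih nN.
rewrite mul1r => <-; have := eq_coefMl chi pbw nN.
by rewrite mul1r => <-; rewrite mulrC mulrA.
Qed.

End HilbertSeries.

(** * Power sums and growth *)

Section LogDerivative.
Variables (R : comNzRingType) (N : nat).
Implicit Types p q S T : {poly R}.

(* [S] is [- X p' / p] modulo [X^(N+1)]: for [p = \prod_i (1 - a_i X)] this is
   the generating series of the power sums of the [a_i]. *)
Definition log_deriv p S : Prop :=
  forall n, (n <= N)%N -> (p * S)`_n = - ('X * p^`())`_n.

Lemma log_deriv1 : log_deriv 1 0.
Proof. by move=> n _; rewrite mul1r -polyC1 derivC mulr0 coef0 oppr0. Qed.

Lemma log_derivM p q S T : log_deriv p S -> log_deriv q T ->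
  log_deriv (p * q) (S + T).
Proof.
move=> pS qT n nN.
have pS' k : (k <= N)%N -> (p * S)`_k = (- ('X * p^`()))`_k.
  by move=> kN; rewrite coefN pS.
have qT' k : (k <= N)%N -> (q * T)`_k = (- ('X * q^`()))`_k.
  by move=> kN; rewrite coefN qT.
have -> : p * q * (S + T) = p * S * q + q * T * p by ring.
rewrite coefD (eq_coefMl q pS' nN) (eq_coefMl p qT' nN) -coefD -coefN derivM.
by have -> : - ('X * p^`()) * q + - ('X * q^`()) * p = - ('X * (p^`() * q + p * q^`())) by ring.
Qed.

Lemma log_derivX p S k : log_deriv p S -> log_deriv (p ^+ k) (S *+ k).
Proof.
move=> pS; elim: k => [|k IH]; first exact: log_deriv1.
by rewrite exprS mulrS; apply: log_derivM.
Qed.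

Lemma log_deriv_prod (I : Type) (r : seq I) (p S : I -> {poly R}) :
  (forall i, log_deriv (p i) (S i)) ->
  log_deriv (\prod_(i <- r) p i) (\sum_(i <- r) S i).
Proof.
move=> pS; elim: r => [|i r IH]; first by rewrite !big_nil; apply: log_deriv1.
by rewrite !big_cons; apply: log_derivM.
Qed.

(** Differentiation loses one degree of precision and the factor X restores it. *)
Lemma log_deriv_eqp p q S : (forall n, (n <= N)%N -> p`_n = q`_n) ->
  log_deriv p S -> log_deriv q S.
Proof.
move=> pq pS n nN; have qp k (kN : (k <= N)%N) := esym (pq k kN).
rewrite (eq_coefMl S qp nN) pS // !coefXM; case: n nN => // n nN.
by rewrite !coef_deriv pq.
Qed.

Lemma log_deriv_uniq p S T : p`_0 = 1 -> log_deriv p S -> log_deriv p T ->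
  forall n, (n <= N)%N -> S`_n = T`_n.
Proof.
move=> p0 pS pT; elim/ltn_ind => n IH nN.
have := pS n nN; rewrite -(pT n nN) !coefM !big_ord_recl /= p0 !mul1r !subn0.
rewrite (eq_bigr (fun i : 'I_n => p`_(bump 0 i) * T`_(n - bump 0 i))) => [/addIr//|i _].
rewrite IH // ?(leq_trans _ nN) ?leq_subr //.
by rewrite ltn_subrL /bump /=; case: n i {IH nN} => // -[].
Qed.

(** Expansion of k X^k / (1 - X^k) as a geometric series. *)
Lemma log_deriv_1subXn k : (0 < k)%N ->
  log_deriv (1 - 'X^k) (\poly_(i < N.+1) if (0 < i)%N && (k %| i)%N then k%:R else 0).
Proof.
move=> k0 n nN; rewrite mulrBl mul1r coefB coefXnM !coef_poly !ltnS nN.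
rewrite derivB -polyC1 derivC sub0r derivXn mulrN coefN opprK.
rewrite (leq_trans (leq_subr k n) nN) mulrnAr -exprS prednK // coefMn coefXn.
case: (ltngtP n k) => [nk|kn|->].
- rewrite mul0rn subr0; case: n nk {nN} => //= n nk.
  by rewrite gtnNdvd.
- rewrite subn_gt0 kn (ltn_trans k0 kn) /= dvdn_subl ?(ltnW kn) ?dvdnn // subrr.
  by rewrite mul0rn.
- by rewrite k0 dvdnn subnn /= subr0.
Qed.

Lemma log_deriv_1subZX a :
  log_deriv (1 - a *: 'X) (\poly_(i < N.+1) if (0 < i)%N then a ^+ i else 0).
Proof.
move=> n nN; have -> : 'X * (1 - a *: 'X)^`() = - (a *: 'X) :> {poly R}.
  by rewrite derivB -polyC1 derivC sub0r derivZ derivX mulrN -scalerAr mulr1.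
rewrite coefN opprK mulrBl mul1r coefB -scalerAl !coefZ coefXM coefX !coef_poly.
rewrite ltnS nN; case: n nN => [|[|n]] nN /=; first by rewrite mulr0 subr0.
  by rewrite mulr0 subr0 mulr1 expr1.
by rewrite ltnS (ltnW nN) mulr0 exprS subrr.
Qed.

End LogDerivative.

Section SubexponentialSeries.
Variables (chi : {poly int}) (l : nat -> nat).
Hypothesis chiE : forall N n, (n <= N)%N ->
  chi`_n = (\prod_(1 <= k < N.+1) (1 - 'X^k) ^+ l k)`_n.

Definition divisor_sum n := (\sum_(1 <= k < n.+1) if k %| n then l k * k else 0)%N.

(** The list consists of the inverses of the roots of [chi]. The constant coefficient 1 excludes the
    root 0 and fixes the scalar in the factorisation. *)
Lemma power_sums : exists rs : seq algC, forall n, (0 < n)%N ->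
  \sum_(a <- rs) a ^+ n = (divisor_sum n)%:R.
Proof.
pose p : {poly algC} := map_poly intr chi.
have p0 : p`_0 = 1.
  rewrite coef_map /= (chiE (N := 0) (leqnn 0)) big_geq // coef1 /=.
  by [].
have [r rE] := closed_field_poly_normal p.
have pE : p = \prod_(a <- [seq z^-1 | z <- r]) (1 - a *: 'X).
  have r0 z : z \in r -> z != 0.
    move=> zr; apply: contra_eq_neq p0 => z0; rewrite rE (big_rem z) //= z0 subr0.
    by rewrite coefZ coefXM mulr0 eq_sym oner_neq0.
  have e z : z \in r -> 'X - z%:P = (- z) *: (1 - z^-1 *: 'X).
    move=> /r0 z0; rewrite scalerBr scalerA mulNr divff // scaleN1r opprK scaleNr.
    by rewrite alg_polyC addrC.
  have rE' : p = (lead_coef p * \prod_(z <- r) (- z))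
      *: \prod_(a <- [seq z^-1 | z <- r]) (1 - a *: 'X).
    rewrite {1}rE -scalerA; congr (_ *: _); rewrite big_map -scaler_prod.
    by apply: eq_big_seq => z /e.
  have q0 : (\prod_(a <- [seq z^-1 | z <- r]) (1 - a *: 'X))`_0 = 1 :> algC.
    elim: [seq _ | _ <- r] => [|a s IH]; first by rewrite big_nil coef1.
    by rewrite big_cons coef0M IH coefB coef1 coefZ coefX mulr0 subr0 mulr1.
  by rewrite {1}rE'; move: p0; rewrite {1}rE' coefZ q0 mulr1 => ->; rewrite scale1r.
exists [seq z^-1 | z <- r] => n n0.
have L1 := log_deriv_prod [seq z^-1 | z <- r] (@log_deriv_1subZX _ n).
have L2 : log_deriv n (\prod_(1 <= k < n.+1) (1 - 'X^k) ^+ l k : {poly algC})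
    (\sum_(1 <= k < n.+1) (\poly_(i < n.+1) if (0 < i)%N && (k %| i)%N then k%:R else 0) *+ l k).
  (* Filtering the indices keeps the fact 0 < k at hand during the induction on the list. *)
  rewrite big_nat [X in log_deriv _ _ X]big_nat.
  rewrite -!(big_filter _ (fun k => 1 <= k < n.+1)%N).
  have : all (fun k => 0 < k)%N [seq k <- index_iota 1 n.+1 | (1 <= k < n.+1)%N].
    by apply/allP => k; rewrite mem_filter => /andP[/andP[]].
  elim: [seq _ <- _ | _] => [|k s IH]; first by rewrite !big_nil => _; apply: log_deriv1.
  move=> /andP[k0 /IH Ls]; rewrite !big_cons; apply: log_derivM => //.
  by apply: log_derivX; apply: log_deriv_1subXn.
have L2' : log_deriv n p
    (\sum_(1 <= k < n.+1) (\poly_(i < n.+1) if (0 < i)%N && (k %| i)%N then k%:R else 0) *+ l k).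
  apply: log_deriv_eqp L2 => k kn; rewrite coef_map /= (chiE kn) -[RHS]coef_map.
  rewrite rmorph_prod; congr (nth 0 (polyseq _) k); apply: eq_bigr => i _.
  by rewrite rmorphXn rmorphB rmorph1 /= map_polyXn.
rewrite -pE in L1; have := log_deriv_uniq p0 L1 L2' (leqnn n).
rewrite !coef_sum.
under eq_bigr do rewrite coef_poly ltnSn n0.
under [in X in _ = X -> _]eq_bigr do rewrite coefMn coef_poly ltnSn n0.
move=> ->; rewrite /divisor_sum natr_sum; apply: eq_bigr => k _ /=.
by case: ifP => _; rewrite ?mul0rn // natrM mulr_natl.
Qed.

End SubexponentialSeries.

Section PowerSumGrowth.

Lemma bernoulli_ineq (R : numDomainType) (x : R) n : 0 <= x ->
  1 + n%:R * x <= (1 + x) ^+ n.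
Proof.
move=> x0; elim: n => [|n IH]; first by rewrite mul0r addr0 expr0.
rewrite exprS; apply: le_trans (_ : (1 + x) * (1 + n%:R * x) <= _).
  rewrite -natr1 -subr_ge0.
  have -> : (1 + x) * (1 + n%:R * x) - (1 + (n%:R + 1) * x) = n%:R * x ^+ 2 by ring.
  by rewrite mulr_ge0 ?exprn_ge0.
by rewrite ler_wpM2l // addr_ge0.
Qed.

(* Evaluating the power sums against a polynomial vanishing at all the
   [a <- rs] but [b] isolates the power of [b]. *)
Lemma power_sum_growth (rs : seq algC) (s : nat -> algC) (b rho C : algC) :
  (forall n, (0 < n)%N -> \sum_(a <- rs) a ^+ n = s n) ->
  b \in rs -> 0 < rho -> 0 <= C ->
  (forall n, (0 < n)%N -> `|s n| <= C * rho ^+ n) -> `|b| <= rho.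
Proof.
move=> sE brs rho0 C0 sC.
rewrite real_leNgt ?normr_real ?gtr0_real //; apply/negP => rb.
pose P : {poly algC} := \prod_(a <- undup rs | a != b) ('X - a%:P).
have Pb : P.[b] != 0.
  rewrite horner_prod prodf_seq_neq0; apply/allP => a _; apply/implyP => ab.
  by rewrite hornerXsubC subr_eq0 eq_sym.
have Pa a : a \in rs -> a != b -> P.[a] = 0.
  move=> ars ab; rewrite horner_prod -big_filter.
  by rewrite (big_rem a) ?mem_filter ?ab ?mem_undup //= hornerXsubC subrr mul0r.
(* The multiplicity of [b] appears because [P] is built on the distinct elements of [rs]. *)
pose K := (count_mem b rs)%:R * P.[b].
have K0 : K != 0.
  by rewrite mulf_neq0 // pnatr_eq0 -lt0n -has_count has_pred1.
have KE n : (0 < n)%N -> b ^+ n * K = \sum_(k < size P) P`_k * s (n + k)%N.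
  move=> n0; transitivity (\sum_(a <- rs) a ^+ n * P.[a]).
    rewrite (bigID (pred1 b)) /= [X in _ + X]big1_seq ?addr0; last first.
      by move=> a /andP[ab ars]; rewrite Pa // mulr0.
    rewrite (eq_bigr (fun=> b ^+ n * P.[b])) => [|a /eqP -> //].
    by rewrite big_const_seq iter_addr_0 /K mulrCA mulr_natl.
  under eq_bigr do rewrite horner_coef mulr_sumr.
  rewrite exchange_big; apply: eq_bigr => k _ /=.
  rewrite -sE ?addn_gt0 ?n0 // mulr_sumr; apply: eq_bigr => a _.
  by rewrite exprD mulrCA.
pose B := \sum_(k < size P) `|P`_k| * (C * rho ^+ k).
have KB n : (0 < n)%N -> `|b| ^+ n * `|K| <= rho ^+ n * B.
  move=> n0; rewrite -normrX -normrM KE // mulr_sumr.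
  apply: le_trans (ler_norm_sum _ _ _) _; apply: ler_sum => k _.
  rewrite normrM mulrCA ler_wpM2l // mulrCA -exprD.
  by apply: sC; rewrite addn_gt0 n0.
(* If |b| > rho then [x] is positive, and (1 + x)^n >= 1 + n x is unbounded, whereas [KB] bounds it
   by B / |K|. *)
pose x := `|b| / rho - 1.
have x0 : 0 < x by rewrite subr_gt0 ltr_pdivlMr // mul1r.
have K0' : 0 < `|K| by rewrite normr_gt0.
have B0 : 0 <= B.
  by apply: sumr_ge0 => k _; rewrite !mulr_ge0 // exprn_ge0 // ltW.
have xB n : (0 < n)%N -> n%:R * x <= B / `|K|.
  move=> n0; apply: le_trans (_ : (1 + x) ^+ n <= _).
    by apply: le_trans (bernoulli_ineq n (ltW x0)); rewrite lerDr.
  rewrite /x addrC subrK expr_div_n ler_pdivlMr // mulrAC ler_pdivrMr ?exprn_gt0 //.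
  by rewrite [B * _]mulrC KB.
have y0 : 0 <= B / `|K| / x by rewrite !divr_ge0 // ltW.
have := archi_boundP y0; rewrite ltr_pdivrMr //; set M := Num.Def.archi_bound _ => yM.
have MM : M%:R * x <= M.+1%:R * x by rewrite ler_wpM2r ?(ltW x0) // ler_nat.
by have := lt_le_trans yM (le_trans MM (xB _ (ltn0Sn M))); rewrite ltxx.
Qed.

End PowerSumGrowth.

Section Subexponential.
Variables (chi : {poly int}) (l : nat -> nat).
Hypothesis chiE : forall N n, (n <= N)%N ->
  chi`_n = (\prod_(1 <= k < N.+1) (1 - 'X^k) ^+ l k)`_n.
Hypothesis subexp : forall q, (0 < q)%N -> exists N, forall n, (N <= n)%N ->
  (l n * q ^ n <= q.+1 ^ n)%N.

(** With rho = 1 + 1/q, at most n terms occur, each at most n C0 rho^n. Bernoulli's inequality gives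
    n <= q rho^n, so the two factors n cost q^2 rho^(2n); hence the exponent 3. *)
Lemma divisor_sum_growth q : (0 < q)%N -> exists2 C : algC, 0 <= C &
  forall n, (divisor_sum l n)%:R <= C * ((1 + q%:R^-1) ^+ 3) ^+ n.
Proof.
move=> q0; have [N lN] := subexp q0.
pose rho : algC := 1 + q%:R^-1.
have q0' : 0 < q%:R :> algC by rewrite ltr0n.
have rho1 : 1 <= rho by rewrite lerDl invr_ge0 ltW.
have rho0 : 0 <= rho by apply: le_trans rho1.
have rhoE : rho = q.+1%:R / q%:R by rewrite -natr1 mulrDl divff ?gt_eqF // mul1r.
(* The sum covers the degrees below [N], where [lN] says nothing. *)
pose C0 : algC := 1 + (\sum_(k < N) l k)%:R.
have C00 : 0 <= C0 by rewrite addr_ge0.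
have C01 : 1 <= C0 by rewrite lerDl.
have lC n : (l n)%:R <= C0 * rho ^+ n.
  have rn1 : 1 <= rho ^+ n by apply: exprn_ege1.
  have [nN|Nn] := ltnP n N.
    apply: le_trans (_ : C0 <= _); last by rewrite ler_peMr.
    apply: le_trans (_ : (\sum_(k < N) l k)%:R <= _); last by rewrite lerDr.
    by rewrite ler_nat (bigD1 (Ordinal nN)) //= leq_addr.
  apply: le_trans (_ : rho ^+ n <= _); last by rewrite ler_peMl // (le_trans _ rn1).
  rewrite rhoE expr_div_n ler_pdivlMr ?exprn_gt0 // -!natrX -natrM ler_nat.
  exact: lN.
have nq n : n%:R <= q%:R * rho ^+ n.
  have := bernoulli_ineq n (ltW (_ : 0 < q%:R^-1 :> algC)); rewrite invr_gt0 => /(_ q0').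
  rewrite -/rho => H; rewrite -ler_pdivrMl // mulrC.
  by apply: le_trans H; rewrite lerDr.
exists (C0 * q%:R ^+ 2); first by rewrite mulr_ge0 // exprn_ge0 // ltW.
move=> n; rewrite -/rho -exprM.
apply: le_trans (_ : n%:R * (C0 * rho ^+ n * n%:R) <= _).
  rewrite /divisor_sum natr_sum big_nat.
  apply: le_trans (_ : \sum_(1 <= k < n.+1 | (1 <= k < n.+1)%N) C0 * rho ^+ n * n%:R <= _).
    apply: ler_sum => k /andP[_ kn]; case: ifP => _; last by rewrite !mulr_ge0 ?exprn_ge0.
    rewrite natrM ler_pM // ?ler_nat //; apply: le_trans (lC k) _.
    by rewrite ler_wpM2l // ler_weXn2l.
  by rewrite -big_nat sumr_const_nat subn1 /= mulr_natl.
have -> : n%:R * (C0 * rho ^+ n * n%:R) = C0 * rho ^+ n * n%:R ^+ 2 by ring.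
have -> : C0 * q%:R ^+ 2 * rho ^+ (3 * n) = C0 * rho ^+ n * (q%:R * rho ^+ n) ^+ 2.
  by rewrite mulnC exprM; ring.
by rewrite ler_wpM2l ?mulr_ge0 ?exprn_ge0 // ler_pXn2r ?nnegrE ?mulr_ge0 ?exprn_ge0 // ltW.
Qed.

Lemma subexponential_vanishing : exists D, forall n, (D < n)%N -> l n = 0%N.
Proof.
have [rs rsE] := power_sums chiE.
have rs1 a : a \in rs -> `|a| <= 1.
  move=> ars; rewrite real_leNgt ?normr_real ?real1 //; apply/negP => a1.
  have x0 : 0 < `|a| - 1 by rewrite subr_gt0.
  (* For 0 <= y <= 1 one has (1 + y)^3 <= 1 + 7 y. Taking q > 7 / (|a| - 1) and y = 1/q brings the
     cube below |a|. *)
  have y0 : 0 <= 7 / (`|a| - 1) by rewrite divr_ge0 // ltW.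
  have := archi_boundP y0; set q := Num.Def.archi_bound _ => yq.
  have q0 : (0 < q)%N by rewrite -(ltr0n algC); apply: le_lt_trans yq.
  have [C C0 sC] := divisor_sum_growth q0.
  have q0' : 0 < q%:R :> algC by rewrite ltr0n.
  have rho0 : 0 < (1 + q%:R^-1) ^+ 3 :> algC.
    by rewrite exprn_gt0 // addr_gt0 // invr_gt0.
  have : `|a| <= (1 + q%:R^-1) ^+ 3.
    apply: (power_sum_growth rsE ars rho0 C0) => n _.
    by rewrite normr_nat.
  apply/negP; rewrite -real_ltNge ?normr_real ?gtr0_real //.
  have qi1 : q%:R^-1 <= 1 :> algC by rewrite invf_le1 // ler1n.
  apply: le_lt_trans (_ : 1 + 7 * q%:R^-1 < _).
    set y := q%:R^-1 in qi1 *; have y0' : 0 <= y by rewrite invr_ge0 ltW.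
    rewrite -subr_ge0.
    have -> : 1 + 7 * y - (1 + y) ^+ 3 = y * ((1 - y) * (4 + y)) by ring.
    by rewrite !mulr_ge0 ?subr_ge0 // addr_ge0.
  by rewrite -ltrBrDl ltr_pdivrMr // mulrC -ltr_pdivrMr.
exists (size rs) => n Dn; have n0 : (0 < n)%N by apply: leq_ltn_trans Dn.
have : ((l n * n)%N%:R : algC) <= (size rs)%:R.
  apply: le_trans (_ : (divisor_sum l n)%:R <= _).
    by rewrite ler_nat /divisor_sum big_nat_recr //= dvdnn leq_addl.
  rewrite -normr_nat -rsE //; apply: le_trans (ler_norm_sum _ _ _) _.
  rewrite -sum1_size natr_sum big_seq [X in _ <= X]big_seq; apply: ler_sum => a ars.
  by rewrite normrX exprn_ile1 // rs1.
rewrite ler_nat => ln; case: (l n) ln => // k; rewrite mulSn => ln.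
by move: Dn; rewrite ltnNge (leq_trans (leq_addr _ _) ln).
Qed.

End Subexponential.

(** * Proof of the theorem *)

Section Entropy.
Variables (R : realType) (F : fieldType) (L : lieAlgType F) (Lg : nat -> set L).
Hypothesis fL : forall k, (0 < k)%N -> finite_dim (Lg k).

Lemma edim_fdim (V : lmodType F) (A : set V) : finite_dim A ->
  edim R A = (fdim A)%:R%:E.
Proof.
move=> /fdimP dA; rewrite /edim -[RHS]ereal_inf1; congr ereal_inf.
by apply/seteqP; split=> [_ [n /fdim_eq <- <-]//|_ ->]; exists (fdim A).
Qed.

(** An upper limit at most 1 lies strictly below 1 + 1/q, hence so do the n-th roots from some rank
    on. Clearing denominators leaves natural numbers, free of the real field [R]. *)
Lemma entropy_le1_subexp : (entropy R Lg <= 1)%E -> forall q, (0 < q)%N ->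
  exists N, forall n, (N <= n)%N -> (fdim (Lg n) * q ^ n <= q.+1 ^ n)%N.
Proof.
move=> h1 q q0; have q0' : 0 < q%:R :> R by rewrite ltr0n.
have : (entropy R Lg < (1 + q%:R^-1)%:E)%E.
  by apply: le_lt_trans h1 _; rewrite lte_fin ltrDl invr_gt0.
rewrite /entropy /limn_esup /limf_esup => /ereal_inf_lt[_ [V [N _ NV] <-] supV].
(* Index n of the sequence in [entropy] stands for degree n + 1. *)
exists N.+1 => -[//|n]; rewrite ltnS => Nn.
have un : (((fdim (Lg n.+1))%:R `^ (n.+1%:R^-1))%R%:E < (1 + q%:R^-1)%R%:E :> \bar R)%E.
  apply: le_lt_trans supV; apply: ereal_sup_ubound; exists n; first exact: NV.
  by rewrite edim_fdim ?poweR_EFin //; apply: fL.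
move: un; rewrite lte_fin => /ltW un.
have n0 : n.+1%:R != 0 :> R by rewrite pnatr_eq0.
have : (fdim (Lg n.+1))%:R <= (1 + q%:R^-1) ^+ n.+1 :> R.
  have -> : (fdim (Lg n.+1))%:R = ((fdim (Lg n.+1))%:R `^ (n.+1%:R^-1)) ^+ n.+1 :> R.
    by rewrite -powR_mulrn ?powR_ge0 // -powRrM mulVf // powRr1.
  by rewrite lerXn2r ?nnegrE ?powR_ge0 // addr_ge0 // invr_ge0 ltW.
have -> : 1 + q%:R^-1 = q.+1%:R / q%:R :> R.
  by rewrite -natr1 mulrDl divff ?gt_eqF // mul1r.
by rewrite expr_div_n ler_pdivlMr ?exprn_gt0 // -!natrX -natrM ler_nat.
Qed.

Lemma entropy_eq0 D : (forall n, (D < n)%N -> fdim (Lg n) = 0%N) ->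
  entropy R Lg = 0%E.
Proof.
move=> L0; apply/le_anti/andP; split; last first.
  rewrite /entropy /limn_esup; apply: limf_esup_ge0 => [|n]; last exact: poweR_ge0.
  by case=> N _ /(_ N (leqnn N)).
rewrite /entropy /limn_esup /limf_esup; apply: ge_ereal_inf.
(* The bound is [D], not D + 1, because index n stands for degree n + 1. The n-th roots vanish on
   this tail. *)
pose V := [set n | (D <= n)%N].
eexists; first by exists V; [exists D | reflexivity].
apply: ge_ereal_sup => _ [n Dn <-].
by rewrite (edim_fdim (fL (ltn0Sn n))) (L0 n.+1 Dn) poweR_EFin powR0.
Qed.

Hypothesis gr : is_grading Lg.

Lemma vanishing_finite_dim D : (forall n, (D < n)%N -> fdim (Lg n) = 0%N) ->
  finite_dim [set: L].
Proof.
move=> L0.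
have zero n x : (D < n)%N -> Lg n x -> x = 0.
  by move=> Dn; apply: fdim_eq0 (L0 n Dn) _; apply: fL; apply: leq_ltn_trans Dn.
have eb n : exists b : {k & 'I_k -> L}, (0 < n)%N ->
    forall x, Lg n x -> spanned_by (tagged b) x.
  case: (posnP n) => [_|n0].
    by exists (Tagged (fun k => 'I_k -> L) (fun _ : 'I_0 => 0)).
  have [k [e [_ se _]]] := fL n0.
  by exists (Tagged (fun k => 'I_k -> L) e).
pose b n := projT1 (cid (eb n)); have bE n := projT2 (cid (eb n)).
pose f (p : {n : 'I_D.+1 & 'I_(tag (b n))}) := tagged (b (tag p)) (tagged p).
apply: (finite_dim_spanned (f := f)) => // x _.
have sf := spanned_subspace f.
have [N /(_ (maxn N D.+1) (leq_maxl _ _)) [_ ->]] := lcomp_fin gr x.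
apply: subspace_sum => // -[n /= nN] _.
have [->|n0] := posnP n; first by rewrite lcomp0; case: sf.
have [nD|Dn] := leqP n D; last first.
  by rewrite (zero n _ Dn (lcomp_mem gr x n0)); case: sf.
have [c ->] := bE n n0 _ (lcomp_mem gr x n0).
apply: subspace_sum => // i _; apply: subspaceZ => //.
exact: (spanned_gen f (Tagged (fun n : 'I_D.+1 => 'I_(tag (b n)))
  (i := Ordinal (nD : (n < D.+1)%N)) i)).
Qed.

(** All degrees in [L] are positive, so each bracketing raises the lowest occurring degree by at
    least 1. *)
Lemma lower_central_lcomp n x k : lower_central n x -> (k <= n)%N -> lcomp gr x k = 0.
Proof.
elim: n x k => [|n IH] x k.
  by move=> _; rewrite leqn0 => /eqP ->; apply: lcomp0.
move=> [r [c [y [z [_ zn ->]]]]] kn.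
elim/big_rec: _ => [|i u _ u0]; first exact: lcomp_linear0.
rewrite lcompZD u0 addr0 lcomp_lie big1 ?scaler0 // => -[[|a] /= ak] _.
  by rewrite lcomp0 lie0l.
rewrite (IH (z i) _ (zn i)) ?lie0r // leq_subLR addSn (leq_trans kn) // ltnS.
exact: leq_addl.
Qed.

Lemma vanishing_nilpotent D : (forall n, (D < n)%N -> fdim (Lg n) = 0%N) ->
  lie_nilpotent L.
Proof.
move=> L0; exists D; apply/seteqP; split=> [x xD|_ ->] /=.
  have [N /(_ N (leqnn _)) [_ ->]] := lcomp_fin gr x.
  rewrite big1 // => -[k /= kN] _; have [kD|Dk] := leqP k D.
    exact: (lower_central_lcomp xD kD).
  have k0 : (0 < k)%N by apply: leq_ltn_trans Dk.
  exact: fdim_eq0 (fL k0) (L0 k Dk) _ (lcomp_mem gr x k0).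
case: D {L0} => [//|D] /=.
exists 0%N, (fun=> 0), (fun=> 0), (fun=> 0); split=> [//|[]//|].
by rewrite big_ord0.
Qed.

End Entropy.

Theorem theoremA (R : realType) (F : fieldType) (L : lieAlgType F)
    (Lg : nat -> set L) :
  is_grading Lg -> generated_in_degree1 Lg -> type_FP L ->
  (entropy R Lg <= 1)%E ->
  [/\ finite_dim [set: L]%classic, lie_nilpotent L & entropy R Lg = 0%E].
Proof.
move=> gr gen1 fp h1.
have [fL [chi chiE]] := hilbert_series gr gen1 fp.
have [D LD] := subexponential_vanishing chiE (entropy_le1_subexp fL h1).
split.
- exact: (vanishing_finite_dim fL gr LD).
- exact: (vanishing_nilpotent fL gr LD).
- exact: (entropy_eq0 R fL LD).
Qed.
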